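(* Let $R$ be a commutative Artinian ring with $1\neq 0$ such that $0<\gamma(\mathbb{AG}(R))<\infty$. Then $R$ has only finitely many ideals.
   Context: Annihilating-ideal graph: an ideal $I$ of a commutative ring $R$ is an annihilating-ideal if there is a nonzero ideal $J$ of $R$ with $IJ=(0)$. The annihilating-ideal graph $\mathbb{AG}(R)$ is the simple undirected graph whose vertices are the nonzero annihilating-ideals of $R$, two distinct vertices $I\neq J$ being adjacent if and only if $IJ=(0)$. Genus: $S_k$ denotes the oriented surface of genus $k$ (the sphere with $k$ handles), $k\ge 0$. The genus $\gamma(G)$ of a graph $G$ is the minimal integer $n\geq 0$ such that $G$ can be embedded in $S_n$ (i.e. drawn in $S_n$ so that edges intersect only at common vertices). An infinite graph $G$ has infinite genus, $\gamma(G)=\infty$, if for every natural number $n$ there is a finite subgraph $G_n$ of $G$ with $\gamma(G_n)=n$. *)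

(* Defs.v *)
From HB Require Import structures.
From mathcomp Require Import all_boot all_order all_algebra.
From mathcomp Require Import all_classical all_reals all_analysis.

Set Implicit Arguments.
Unset Strict Implicit.
Unset Printing Implicit Defensive.

Import Order.TTheory GRing.Theory Num.Theory.
Import numFieldNormedType.Exports.

Local Open Scope classical_set_scope.
Local Open Scope ring_scope.

(* Unlike idealr_closed of ring_quotient, this admits the unit ideal. *)
Definition is_ideal (R : comNzRingType) (I : set R) : Prop :=
  [/\ I 0,
      forall a b, I a -> I b -> I (a + b) &
      forall r a, I a -> I (r * a)].

Definition ideal_mul (R : comNzRingType) (I J : set R) : set R :=
  [set x | exists n (a b : 'I_n -> R),
     [/\ forall i, I (a i), forall i, J (b i) & x = \sum_(i < n) a i * b i]].

Definition artinian (R : comNzRingType) : Prop :=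
  forall I : nat -> set R,
    (forall n, is_ideal (I n)) ->
    (forall n, I n.+1 `<=` I n) ->
    exists n, forall m, (n <= m)%N -> I m = I n.

Definition annihilating_ideal (R : comNzRingType) (I : set R) : Prop :=
  is_ideal I /\
  exists J : set R,
    [/\ is_ideal J, J <> [set 0] & ideal_mul I J = [set 0]].

(* Vertex sets may be infinite, so adjacency is Prop-valued. *)
Record sgraph := SGraph {
  vertex :> Type;
  adj : vertex -> vertex -> Prop;
  adj_sym : forall u v, adj u v -> adj v u;
  adj_irrefl : forall u, ~ adj u u }.

Section AnnihilatingIdealGraph.
Variable R : comNzRingType.

Definition AG_vertex : Type :=
  {I : set R | annihilating_ideal I /\ I <> [set 0]}.

Definition AG_adj (I J : AG_vertex) : Prop :=
  I <> J /\ ideal_mul (sval I) (sval J) = [set 0].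

Lemma ideal_mulC (I J : set R) : ideal_mul I J = ideal_mul J I.
Proof.
suff sub (A B : set R) : ideal_mul A B `<=` ideal_mul B A.
  by apply/seteqP; split; exact: sub.
move=> x [n [a [b [Aa Bb ->]]]]; exists n, b, a; split => //.
by apply: eq_bigr => i _; rewrite mulrC.
Qed.

Lemma AG_adj_sym (I J : AG_vertex) : AG_adj I J -> AG_adj J I.
Proof. by move=> [IJ IJ0]; split; [exact/nesym | rewrite ideal_mulC]. Qed.

Lemma AG_adj_irrefl (I : AG_vertex) : ~ AG_adj I I.
Proof. by case. Qed.

Definition AG : sgraph := SGraph AG_adj_sym AG_adj_irrefl.

End AnnihilatingIdealGraph.

Section Genus.
Variable K : realType.

Definition space : Type := (K * K * K)%type.

(* The polynomial surface
     z^2 = ((3g+1)^2 - x^2 - y^2) * \prod_(i < g) ((x - 3i)^2 + y^2 - 1).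
   The right-hand side is nonnegative exactly on the closed disc of radius
   3g+1 about the origin with the g open unit discs centred at (3i, 0),
   i < g, removed; these have pairwise disjoint closures inside the big open
   disc.  It vanishes to first order on the g+1 boundary circles, so the
   surface is the double of a disc with g holes along its boundary, i.e. the
   sphere with g handles.  For g = 0 it is the unit sphere. *)
Definition surface (g : nat) : set space :=
  [set q | let: (x, y, z) := q in
     z ^+ 2 = ((3 * g + 1)%:R ^+ 2 - x ^+ 2 - y ^+ 2) *
              \prod_(i < g) ((x - (3 * i)%:R) ^+ 2 + y ^+ 2 - 1)].

Definition is_arc (A : set space) (p q : space) : Prop :=
  exists f : K -> space,
    [/\ {within `[0, 1], continuous f},
        {in `[0, 1] &, injective f},
        f 0 = p, f 1 = q & A = f @` `[0, 1]].

(* Edges are undirected: arc u v and arc v u are the same curve. *)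
Definition embeddable (G : sgraph) (g : nat) : Prop :=
  exists (pt : G -> space) (arc : G -> G -> set space),
    [/\ injective pt /\ (forall u, surface g (pt u)),
        forall u v, adj u v ->
          [/\ is_arc (arc u v) (pt u) (pt v), arc u v `<=` surface g &
              arc u v = arc v u],
        forall u v w, adj u v -> arc u v (pt w) -> w = u \/ w = v &
        forall u v x y, adj u v -> adj x y -> [set u; v] <> [set x; y] ->
          arc u v `&` arc x y `<=` pt @` ([set u; v] `&` [set x; y])].

(* G may be infinite: the whole of G is drawn.  A graph with a genus g in this
   sense has no finite subgraph of genus greater than g, so its genus is not
   infinite. *)
Definition has_genus (G : sgraph) (g : nat) : Prop :=
  embeddable G g /\ forall m, embeddable G m -> (g <= m)%N.

End Genus.

(* Main.v *)
Require Import Defs.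
From HB Require Import structures.
From mathcomp Require Import all_boot all_order all_algebra.
From mathcomp Require Import all_classical all_reals all_analysis.
From mathcomp Require Import zify ring lra.

Set Implicit Arguments.
Unset Strict Implicit.
Unset Printing Implicit Defensive.

Import Order.TTheory GRing.Theory Num.Theory.
Import numFieldNormedType.Exports.

(** Suppose that R has infinitely many ideals and that AG R is drawn on the
    surface of genus g.  Then AG R can also be drawn on the sphere, so its genus
    is 0.  The argument has a topological half, which excludes two kinds of
    subgraphs and limits a third to countable size, and an algebraic half, which
    shows that a ring without the excluded subgraphs has a planar graph.

    Topology.  An embedded graph contains no complete bipartite graph between
    three and infinitely many vertices ([no_tripods_direct]), not even when one
    of the three bundles of edges is subdivided ([no_tripods_subdivided]); and
    only countably many triods with two common feet and distinct third feet fit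
    on a surface ([triods_countable]), a variant of a theorem of Moore on the
    plane.  All three follow from [no_drawing], a bound on the number of such
    triods whose third feet are close together.  The surface consists of four
    sheets over a rectangle, indexed by the signs of y and z and glued along
    the sides.  Over a fine grid in the rectangle a path becomes a walk of
    faces, and disjoint paths become disjoint walks.  A walk from a face T to a
    face T' carries a mod 2 cochain with coboundary T + T'.  Let e_i, f_i, h_i be
    the cochains of the three legs of the triod i.  If a primitive of e_i + f_i and
    one of e_j + f_j agree at certain corners, whose number depends on g and not on
    the grid, then e_i + f_i + e_j + f_j is exact on the glued surface; among many
    triods there are three for which all these sums are exact.
    Integrating their primitives along the legs then computes the sum over the
    three pairs of the integral of e_i e_j + e_j e_i (cup product) in two
    ways, with results 0 and 1 ([no_grid_drawing]).  This is the mod 2 form of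
    the van Kampen obstruction.

    Algebra.  If I J = 0 and J has infinitely many subideals, then I has at most
    two nonzero subideals ([embedded_thin]).  It follows that R is local with
    nilpotent maximal ideal M ([nilpotent_or_unit]).  Let W be minimal among the
    ideals with infinitely many subideals, and V = M W.  The residue field is
    infinite, proper subideals of W are principal, W / V has dimension two, and
    V = R u is killed by M ([residue_field_infinite], [two_generators],
    [dual_basis]).  The annihilator N of W has at most two nonzero subideals.
    If N = R u, every vertex is joined to R u and the other edges form a
    matching.  Otherwise N = R n for some n outside R u, and either there are
    triods that the topology forbids ([no_quadric_data]) or M = (z, y) with
    z y = 0 and y ^ 2 = b z ^ 3, b a unit ([trichotomy]).

    In the first case the graph is planar: the vertex R u is the point at infinity
    and matched pairs lie on vertical lines, of which there are enough because the
    drawing at hand injects the vertices into space ([embed_pencil]).  In the cusp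
    case the ideals are four exceptional ones and two pencils of principal ideals
    ([cusp_classification]); the pairs of orthogonal lines together with the poles
    R z ^ 3 and R z ^ 2 are triods as in Moore's theorem, so there are countably
    many vertices, and outside the two poles the edges form a matching.  Such a
    graph is planar as well ([embed_book]). *)

(** * Infinite sets *)

Section Sets.
Local Open Scope classical_set_scope.

Lemma infinite_seq (T : Type) (A : set T) : infinite_set A ->
  exists f : nat -> T, injective f /\ forall n, A (f n).
Proof.
move=> /infiniteP/card_leP[f].
exists (fun n => val (f (to_setT n))); split; last by move=> n; exact: set_valP.
move=> m n /val_inj h.
by have /(congr1 val) := 'inj_f (mem_set I) (mem_set I) h.
Qed.

Lemma finite_reps (T U : Type) (f : T -> U) (A : set T) : finite_set (f @` A) ->
  exists D : set T, [/\ finite_set D, D `<=` A & forall a, A a -> exists2 d, D d & f d = f a].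
Proof.
move=> fin; have [[a0 Aa0]|n] := pselect (exists a, A a); last first.
  by exists set0; split=> // a Aa; case: n; exists a.
have ex (u : U) : exists a, A a /\ ((f @` A) u -> f a = u).
  have [[a Aa <-]|nu] := pselect ((f @` A) u); first by exists a.
  by exists a0.
have [r hr] := choice ex.
exists (r @` (f @` A)); split; first exact: finite_image.
  by move=> _ [u _ <-]; case: (hr u).
move=> a Aa; have fa : (f @` A) (f a) by exists a.
by exists (r (f a)); [exists (f a)|exact: (proj2 (hr (f a)))].
Qed.

Lemma finite_powerset (T : choiceType) (D : set T) : finite_set D ->
  finite_set [set B : set T | B `<=` D].
Proof.
move=> /finite_seqP[s DE].
apply: (@sub_finite_set _ _ ((fun m : (size s).-tuple bool => [set` mask m s]) @` setT)); last first.
  by apply: finite_image; exact: finite_finset.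
move=> B /= BD; exists (map_tuple (fun x => `[< B x >]) (in_tuple s)) => //.
apply/seteqP; split=> x /=; rewrite -filter_mask mem_filter.
  by move=> /andP[/asboolP].
move=> Bx; apply/andP; split; first exact/asboolP.
by have := BD x Bx; rewrite DE.
Qed.

Lemma infinite_of_seq (T : Type) (A : set T) (f : nat -> T) : injective f ->
  (forall n, A (f n)) -> infinite_set A.
Proof.
move=> fi fA finA; apply: infinite_nat.
have -> : [set: nat] = f @^-1` A by apply/seteqP; split=> // n _; exact: fA.
by apply: finite_preimage => // m n _ _; exact: fi.
Qed.

End Sets.

(** * Mod 2 cochains on a grid with four sheets *)

Lemma sum_addb (I : finType) (F G : I -> bool) :
  (\big[addb/false]_i F i) (+) (\big[addb/false]_i G i) =
  \big[addb/false]_i (F i (+) G i).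
Proof. by rewrite big_split. Qed.

Section Grid.
Local Open Scope nat_scope.
Variables (I J : nat) (zm : nat -> bool).
Hypotheses (I0 : 0 < I) (J0 : 0 < J).

Definition face : Type := nat * nat * bool * bool.
Definition valid (f : face) : bool := (f.1.1.1 < I) && (f.1.1.2 < J).

Definition cell_fun := nat -> nat -> bool -> bool -> bool.
(** A face (i, j, s, t) is the square [i, i + 1] x [j, j + 1] on the sheet (s, t).
    A cochain assigns a bit to the horizontal edge from (i, j) to (i + 1, j) and
    to the vertical edge from (i, j) to (i, j + 1) of every sheet. *)
Record cochain := Cochain { hz : cell_fun; vt : cell_fun }.

(** The sheets are glued along the sides of the rectangle, so a cochain of the
    glued surface takes equal values on the identified boundary edges.  The left,
    right and top sides exchange t; the bottom edge i exchanges t if [zm i] and s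
    otherwise. *)
Definition mirrored (u : cochain) : Prop :=
  [/\ forall i s t, i < I ->
        hz u i 0 s t = if zm i then hz u i 0 s (~~ t) else hz u i 0 (~~ s) t,
      forall i s t, i < I -> hz u i J s t = hz u i J s (~~ t),
      forall j s t, j < J -> vt u 0 j s t = vt u 0 j s (~~ t) &
      forall j s t, j < J -> vt u I j s t = vt u I j s (~~ t)].

Definition eB (u : cochain) (f : face) : bool :=
  let: (i, j, s, t) := f in hz u i j s t.
Definition eT (u : cochain) (f : face) : bool :=
  let: (i, j, s, t) := f in hz u i j.+1 s t.
Definition eL (u : cochain) (f : face) : bool :=
  let: (i, j, s, t) := f in vt u i j s t.
Definition eR (u : cochain) (f : face) : bool :=
  let: (i, j, s, t) := f in vt u i.+1 j s t.

Definition cobd (u : cochain) (f : face) : bool :=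
  eB u f (+) eR u f (+) eL u f (+) eT u f.

Definition integral2 (c : face -> bool) : bool :=
  \big[addb/false]_(s : bool) \big[addb/false]_(t : bool)
    \big[addb/false]_(i < I) \big[addb/false]_(j < J) c (i : nat, j : nat, s, t).

Lemma telescope_addb (a : nat -> bool) n :
  \big[addb/false]_(i < n) (a i (+) a i.+1) = a 0 (+) a n.
Proof.
elim: n => [|n IH]; first by rewrite big_ord0 addbb.
by rewrite big_ord_recr /= IH; case: (a 0); case: (a n); case: (a n.+1).
Qed.

(** The interior edges telescope and the boundary edges cancel in glued pairs: the
    grid is a closed surface. *)
Lemma stokes u : mirrored u -> integral2 (cobd u) = false.
Proof.
case=> hb ht vl vr; rewrite /integral2.
have E s t : \big[addb/false]_(i < I) \big[addb/false]_(j < J)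
    cobd u (i : nat, j : nat, s, t) =
  (\big[addb/false]_(i < I) (hz u i 0 s t (+) hz u i J s t)) (+)
  (\big[addb/false]_(j < J) (vt u 0 j s t (+) vt u I j s t)).
  transitivity ((\big[addb/false]_(i < I) \big[addb/false]_(j < J)
      (hz u i j s t (+) hz u i j.+1 s t)) (+)
    (\big[addb/false]_(i < I) \big[addb/false]_(j < J)
      (vt u i j s t (+) vt u i.+1 j s t))).
    rewrite sum_addb; apply: eq_bigr => i _; rewrite sum_addb.
    apply: eq_bigr => j _ /=; rewrite /cobd /=.
    by case: (hz u i j s t); case: (hz u i j.+1 s t); case: (vt u i j s t);
      case: (vt u i.+1 j s t).
  congr addb; first by apply: eq_bigr => i _; exact: telescope_addb (fun j => hz u i j s t) J.
  rewrite exchange_big; apply: eq_bigr => j _.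
  exact: telescope_addb (fun i => vt u i j s t) I.
rewrite !big_bool /= !E.
set A := \big[addb/false]_(i < I) _; set B := \big[addb/false]_(j < J) _.
set C := \big[addb/false]_(i < I) _; set D := \big[addb/false]_(j < J) _.
set A' := \big[addb/false]_(i < I) _; set B' := \big[addb/false]_(j < J) _.
set C' := \big[addb/false]_(i < I) _; set D' := \big[addb/false]_(j < J) _.
have : A (+) C (+) A' (+) C' = false.
  rewrite /A /C /A' /C' !sum_addb /= big1 // => i _.
  have := fun s t => hb i s t (ltn_ord i); have := fun s t => ht i s t (ltn_ord i).
  case: (zm i) => h1 h2; rewrite (h1 true true) (h1 false true) /=.
    by rewrite (h2 true true) (h2 false true) /=; do 4 case: (hz u i _ _ _).
  by rewrite (h2 true true) (h2 true false) /=; do 4 case: (hz u i _ _ _).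
have : B (+) D (+) B' (+) D' = false.
  rewrite /B /D /B' /D' !sum_addb /= big1 // => j _.
  have jJ := ltn_ord j.
  rewrite (vl j true true) // (vl j false true) // (vr j true true) // (vr j false true) //=.
  by do 4 case: (vt u _ j _ _).
by case: A; case: B; case: C; case: D; case: A'; case: B'; case: C'; case: D'.
Qed.

Definition addc (u w : cochain) : cochain :=
  Cochain (fun i j s t => hz u i j s t (+) hz w i j s t)
          (fun i j s t => vt u i j s t (+) vt w i j s t).
Definition mulc (u w : cochain) : cochain :=
  Cochain (fun i j s t => hz u i j s t && hz w i j s t)
          (fun i j s t => vt u i j s t && vt w i j s t).
(** The cup product of the square cut along its main diagonal: bottom then right,
    plus left then top. *)
Definition cup (u w : cochain) (f : face) : bool :=
  (eB u f && eR w f) (+) (eL u f && eT w f).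

Lemma mirrored_addc u w : mirrored u -> mirrored w -> mirrored (addc u w).
Proof.
move=> [a b c d] [a' b' c' d']; split=> i s t iI /=.
- by rewrite {1}a // {1}a' //; case: (zm i).
- by rewrite {1}b // {1}b'.
- by rewrite {1}c // {1}c'.
by rewrite {1}d // {1}d'.
Qed.

Lemma mirrored_mulc u w : mirrored u -> mirrored w -> mirrored (mulc u w).
Proof.
move=> [a b c d] [a' b' c' d']; split=> i s t iI /=.
- by rewrite {1}a // {1}a' //; case: (zm i).
- by rewrite {1}b // {1}b'.
- by rewrite {1}c // {1}c'.
by rewrite {1}d // {1}d'.
Qed.

Lemma cobd_addc u w f : cobd (addc u w) f = cobd u f (+) cobd w f.
Proof.
move: f => [[[i j] s] t]; rewrite /cobd /=.
move: (hz u i j s t) (hz u i j.+1 s t) (vt u i j s t) (vt u i.+1 j s t) (hz w i j s t) (hz w i j.+1 s t) (vt w i j s t) (vt w i.+1 j s t) => a b c d a' b' c' d'.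
by case: a; case: b; case: c; case: d; case: a'; case: b'; case: c'; case: d'.
Qed.

Lemma cup_addcr u w w' f : cup u (addc w w') f = cup u w f (+) cup u w' f.
Proof.
move: f => [[[i j] s] t]; rewrite /cup /=.
move: (hz u i j s t) (vt u i j s t) (hz w i j.+1 s t) (vt w i.+1 j s t) (hz w' i j.+1 s t) (vt w' i.+1 j s t) => a b c d a' b'.
by case: a; case: b; case: c; case: d; case: a'; case: b'.
Qed.

(** Commutativity of the cup product up to coboundary, with the error terms that
    appear when u and w are not closed.  The product u w of the two cochains plays
    the role of the cup-1 product. *)
Lemma cup_commutator u w f :
  cup u w f (+) cup w u f = cobd (mulc u w) f (+)
    ((cobd u f && (eB w f (+) eR w f)) (+) ((eB u f (+) eR u f) && cobd w f)
     (+) (cobd u f && cobd w f)).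
Proof.
move: f => [[[i j] s] t]; rewrite /cup /cobd /=.
move: (hz u i j s t) (hz u i j.+1 s t) (vt u i j s t) (vt u i.+1 j s t) (hz w i j s t) (hz w i j.+1 s t) (vt w i j s t) (vt w i.+1 j s t) => a b c d a' b' c' d'.
by case: a; case: b; case: c; case: d; case: a'; case: b'; case: c'; case: d'.
Qed.

Lemma integral2_addb a b :
  integral2 (fun f => a f (+) b f) = integral2 a (+) integral2 b.
Proof.
rewrite /integral2 sum_addb; apply: eq_bigr => s _.
rewrite sum_addb; apply: eq_bigr => t _.
rewrite sum_addb; apply: eq_bigr => i _.
by rewrite sum_addb.
Qed.

Lemma eq_integral2 a b :
  (forall f, valid f -> a f = b f) -> integral2 a = integral2 b.
Proof.
move=> ab; apply: eq_bigr => s _; apply: eq_bigr => t _.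
by apply: eq_bigr => i _; apply: eq_bigr => j _; apply: ab; rewrite /valid /= !ltn_ord.
Qed.

Lemma integral2_0 a : (forall f, valid f -> a f = false) -> integral2 a = false.
Proof.
move=> a0; rewrite /integral2 big1 // => s _; rewrite big1 // => t _.
by rewrite big1 // => i _; rewrite big1 // => j _; apply: a0; rewrite /valid /= !ltn_ord.
Qed.

Lemma integral2_point (T : face) (c : face -> bool) : valid T ->
  integral2 (fun f => (f == T) && c f) = c T.
Proof.
move: T => [[[i j] s] t] /andP[/= iI jJ]; rewrite /integral2.
rewrite (bigD1 s) //= [X in _ (+) X]big1 ?addbF; last first.
  move=> s' ss'; rewrite big1 // => t' _; rewrite big1 // => i' _.
  rewrite big1 // => j' _; rewrite (_ : _ == _ = false) //.
  by apply/eqP => -[_ _ e _]; rewrite e eqxx in ss'.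
rewrite (bigD1 t) //= [X in _ (+) X]big1 ?addbF; last first.
  move=> t' ss'; rewrite big1 // => i' _.
  rewrite big1 // => j' _; rewrite (_ : _ == _ = false) //.
  by apply/eqP => -[_ _ e]; rewrite e eqxx in ss'.
rewrite (bigD1 (Ordinal iI)) //= [X in _ (+) X]big1 ?addbF; last first.
  move=> i' ii'; rewrite big1 // => j' _; rewrite (_ : _ == _ = false) //.
  by apply/eqP => -[e _]; move/eqP: ii'; apply; apply: val_inj.
rewrite (bigD1 (Ordinal jJ)) //= [X in _ (+) X]big1 ?addbF ?eqxx //.
move=> j' ii'; rewrite (_ : _ == _ = false) //.
by apply/eqP => -[e]; move/eqP: ii'; apply; apply: val_inj.
Qed.

(** A function F on the vertices of the sheets is a 0-cochain: [dif F] is its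
    coboundary, [cupF u F] the product that evaluates F at the end of each edge,
    and [eTR F] the value at the last corner of a face. *)
Definition dif (F : cell_fun) : cochain :=
  Cochain (fun i j s t => F i j s t (+) F i.+1 j s t)
          (fun i j s t => F i j s t (+) F i j.+1 s t).
Definition cupF (u : cochain) (F : cell_fun) : cochain :=
  Cochain (fun i j s t => hz u i j s t && F i.+1 j s t)
          (fun i j s t => vt u i j s t && F i j.+1 s t).
Definition eTR (F : cell_fun) (f : face) : bool :=
  let: (i, j, s, t) := f in F i.+1 j.+1 s t.

(** Each bottom edge constrains F at its right end, where [cupF] evaluates it. *)
Definition mirrored0 (F : cell_fun) : Prop :=
  [/\ forall i s t, i < I ->
        F i.+1 0 s t = if zm i then F i.+1 0 s (~~ t) else F i.+1 0 (~~ s) t,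
      forall i s t, i <= I -> F i J s t = F i J s (~~ t),
      forall j s t, j <= J -> F 0 j s t = F 0 j s (~~ t) &
      forall j s t, j <= J -> F I j s t = F I j s (~~ t)].

Lemma cobd_cupF u F f :
  cobd (cupF u F) f = (cobd u f && eTR F f) (+) cup u (dif F) f.
Proof.
move: f => [[[i j] s] t]; rewrite /cup /cobd /=.
move: (hz u i j s t) (hz u i j.+1 s t) (vt u i j s t) (vt u i.+1 j s t) (F i j s t) (F i.+1 j s t) (F i j.+1 s t) (F i.+1 j.+1 s t) => a b c d a' b' c' d'.
by case: a; case: b; case: c; case: d; case: a'; case: b'; case: c'; case: d'.
Qed.

Inductive stp : face -> face -> Prop :=
| stp_right i j s t : i.+1 < I -> j < J -> stp (i, j, s, t) (i.+1, j, s, t)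
| stp_up i j s t : i < I -> j.+1 < J -> stp (i, j, s, t) (i, j.+1, s, t)
| stp_bottom_z i s t : i < I -> zm i -> stp (i, 0, s, t) (i, 0, s, ~~ t)
| stp_bottom_y i s t : i < I -> ~~ zm i -> stp (i, 0, s, t) (i, 0, ~~ s, t)
| stp_left j s t : j < J -> stp (0, j, s, t) (0, j, s, ~~ t)
| stp_rightmost j s t : j < J -> stp (I.-1, j, s, t) (I.-1, j, s, ~~ t)
| stp_top i s t : i < I -> stp (i, J.-1, s, t) (i, J.-1, s, ~~ t).

Definition vanish (u : cochain) (f : face) : Prop :=
  [/\ eB u f = false, eR u f = false, eL u f = false & eT u f = false].

Definition joins (u : cochain) (T T' : face) (P : face -> Prop) : Prop :=
  [/\ mirrored u, forall f, valid f -> cobd u f = (f == T) (+) (f == T') &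
      forall f, valid f -> ~ P f -> vanish u f].

Lemma stp_valid T T' : stp T T' -> valid T && valid T'.
Proof. by case=> *; rewrite /valid /=; lia. Qed.

Lemma face_eqE i j s t i' j' s' t' :
  ((i, j, s, t) == (i', j', s', t') :> face) =
  [&& i == i', j == j', s == s' & t == t'].
Proof. by rewrite !xpair_eqE -!andbA. Qed.

(** The edge that separates two neighbouring faces, together with its mirror image
    when it lies on the boundary, is the cochain sought. *)
Lemma stp_joins T T' : stp T T' -> exists u, joins u T T' (fun f => f = T \/ f = T').
Proof.
have van u : (forall f, valid f -> cobd u f = (f == T) (+) (f == T')) ->
  (forall f, valid f -> f != T -> f != T' -> vanish u f) -> mirrored u ->
  exists u, joins u T T' (fun f => f = T \/ f = T').
  move=> h1 h2 h3; exists u; split=> // f vf fT; apply: h2 => //.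
    by apply/eqP => e; apply: fT; left.
  by apply/eqP => e; apply: fT; right.
move=> st; case: st van => [i j s t iI jJ|i j s t iI jJ|i s t iI zi|i s t iI zi|j s t jJ|j s t jJ|i s t iI] van.
- apply: (van (Cochain (fun _ _ _ _ => false)
    (fun a b s' t' => [&& a == i.+1, b == j, s' == s & t' == t]))).
  + move=> [[[a b] s'] t'] /andP[/= aI bJ]; rewrite /cobd !face_eqE /=; lia.
  + move=> [[[a b] s'] t'] /andP[/= aI bJ]; rewrite !face_eqE /vanish /=; split; lia.
  + by split=> //= *; (try case: ifP => _); lia.
- apply: (van (Cochain 
    (fun a b s' t' => [&& a == i, b == j.+1, s' == s & t' == t]) (fun _ _ _ _ => false))).
  + move=> [[[a b] s'] t'] /andP[/= aI bJ]; rewrite /cobd !face_eqE /=; lia.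
  + move=> [[[a b] s'] t'] /andP[/= aI bJ]; rewrite !face_eqE /vanish /=; split; lia.
  + by split=> //= *; (try case: ifP => _); lia.
- apply: (van (Cochain 
    (fun a b s' t' => [&& a == i, b == 0 & s' == s]) (fun _ _ _ _ => false))).
  + move=> [[[a b] s'] t'] /andP[/= aI bJ]; rewrite /cobd !face_eqE /=; lia.
  + move=> [[[a b] s'] t'] /andP[/= aI bJ]; rewrite !face_eqE /vanish /=; split; lia.
  + split=> //= a s' t' _; try lia; case: ifP => // za.
    by have -> : a == i = false by apply/eqP => e; rewrite e zi in za.
- apply: (van (Cochain 
    (fun a b s' t' => [&& a == i, b == 0 & t' == t]) (fun _ _ _ _ => false))).
  + move=> [[[a b] s'] t'] /andP[/= aI bJ]; rewrite /cobd !face_eqE /=; lia.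
  + move=> [[[a b] s'] t'] /andP[/= aI bJ]; rewrite !face_eqE /vanish /=; split; lia.
  + split=> //= a s' t' _; try lia; case: ifP => // za.
    by have -> : a == i = false by apply/eqP => e; rewrite -e za in zi.
- apply: (van (Cochain (fun _ _ _ _ => false)
    (fun a b s' t' => [&& a == 0, b == j & s' == s]))).
  + move=> [[[a b] s'] t'] /andP[/= aI bJ]; rewrite /cobd !face_eqE /=; lia.
  + move=> [[[a b] s'] t'] /andP[/= aI bJ]; rewrite !face_eqE /vanish /=; split; lia.
  + by split=> //= *; (try case: ifP => _); lia.
- apply: (van (Cochain (fun _ _ _ _ => false)
    (fun a b s' t' => [&& a == I, b == j & s' == s]))).
  + move=> [[[a b] s'] t'] /andP[/= aI bJ]; rewrite /cobd !face_eqE /=; lia.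
  + move=> [[[a b] s'] t'] /andP[/= aI bJ]; rewrite !face_eqE /vanish /=; split; lia.
  + by split=> //= *; (try case: ifP => _); lia.
- apply: (van (Cochain 
    (fun a b s' t' => [&& a == i, b == J & s' == s]) (fun _ _ _ _ => false))).
  + move=> [[[a b] s'] t'] /andP[/= aI bJ]; rewrite /cobd !face_eqE /=; lia.
  + move=> [[[a b] s'] t'] /andP[/= aI bJ]; rewrite !face_eqE /vanish /=; split; lia.
  + by split=> //= *; (try case: ifP => _); lia.
Qed.

Inductive linked (P : face -> Prop) : face -> face -> Prop :=
| linked_refl T : valid T -> P T -> linked P T T
| linked_step T T' T'' : linked P T T' -> stp T' T'' \/ stp T'' T' -> P T'' ->
    linked P T T''.

Lemma linked_ends P T T' : linked P T T' -> [/\ valid T, valid T', P T & P T'].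
Proof.
elim=> // T1 T2 T3 _ [v1 v2 p1 p2] st p3; split=> //.
by case: st => /stp_valid/andP[].
Qed.

Lemma linked_trans P T T' T'' : linked P T T' -> linked P T' T'' -> linked P T T''.
Proof.
move=> l1 l2; elim: l2 l1 => // T1 T2 T3 _ IH st p3 l1.
exact: linked_step (IH l1) st p3.
Qed.

Lemma linked_sym P T T' : linked P T T' -> linked P T' T.
Proof.
elim=> [T1 v1 p1|T1 T2 T3 l12 l21 st p3]; first exact: linked_refl.
have [v1 v2 p1 p2] := linked_ends l12.
apply: linked_trans l21; apply: linked_step (p2); last exact: (or_comm _ _).1 st.
by apply: linked_refl => //; case: st => /stp_valid/andP[].
Qed.

Lemma linked_sub (P Q : face -> Prop) T T' :
  (forall f, valid f -> P f -> Q f) -> linked P T T' -> linked Q T T'.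
Proof.
move=> PQ; elim=> [T1 v1 p1|T1 T2 T3 l12 l21 st p3].
  by apply: linked_refl => //; exact: PQ.
apply: linked_step l21 (st) _; apply: PQ => //.
by case: st => /stp_valid/andP[].
Qed.

Lemma linked_joins P T T' : linked P T T' -> exists u, joins u T T' P.
Proof.
elim=> [T1 v1 p1|T1 T2 T3 l12 [u [mu cu vu]] st p3].
  exists (Cochain (fun _ _ _ _ => false) (fun _ _ _ _ => false)); split.
  - by split=> // *; case: ifP.
  - by move=> [[[i j] s] t] _; rewrite addbb.
  - by move=> [[[i j] s] t].
have {st} [w [mw cw vw]] : exists w, joins w T2 T3 (fun f => f = T2 \/ f = T3).
  case: st => /stp_joins //; case=> w [mw cw vw]; exists w; split=> // f vf.
    by rewrite cw // addbC.
  by move=> h; apply: vw => //; tauto.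
exists (addc u w); split; first exact: mirrored_addc.
  move=> f vf; rewrite cobd_addc cu // cw //.
  by case: (f == T1); case: (f == T2); case: (f == T3).
move=> f vf nP; have [a b c d] := vu f vf nP.
have [] := vw f vf; first by case=> e; apply: nP; rewrite e //; case: (linked_ends l12).
move: f vf nP a b c d => [[[i j] s] t] /= _ _ a b c d a' b' c' d'.
by rewrite /vanish /= a b c d a' b' c' d'.
Qed.

(** Integration of u along the bottom side and then upwards.  The sheets are
    integrated separately, so the result is single valued on the glued surface
    only under the hypothesis of [prim_mirrored]. *)
Definition prim (u : cochain) : cell_fun := fun i j s t =>
  (\big[addb/false]_(i' < i) hz u i' 0 s t) (+)
  (\big[addb/false]_(j' < j) vt u i j' s t).

Lemma prim_addc u w i j s t :
  prim (addc u w) i j s t = prim u i j s t (+) prim w i j s t.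
Proof. by rewrite /prim /= !big_split /=; do 4 case: (\big[_/_]_(_ < _) _). Qed.

Lemma prim_vt u i j s t : vt (dif (prim u)) i j s t = vt u i j s t.
Proof.
rewrite /= /prim [in X in _ (+) X]big_ord_recr /=.
by case: (vt _ _ _ _ _); do 2 case: (\big[_/_]_(_ < _) _).
Qed.

Lemma prim_hz u i j s t : (forall f, valid f -> cobd u f = false) ->
  i < I -> j <= J -> hz (dif (prim u)) i j s t = hz u i j s t.
Proof.
move=> cl iI; elim: j => [|j IH] jJ.
  rewrite /= /prim !big_ord0 !addbF big_ord_recr /=.
  by case: (hz _ _ _ _ _); case: (\big[_/_]_(_ < _) _).
have {IH} := IH (ltnW jJ); have := prim_vt u i j s t; have := prim_vt u i.+1 j s t.
have := cl (i, j, s, t); rewrite /valid /= iI jJ => /(_ isT); rewrite /cobd /=.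
move: (prim u i j s t) (prim u i.+1 j s t) (prim u i j.+1 s t) (prim u i.+1 j.+1 s t).
move: (hz u i j s t) (hz u i j.+1 s t) (vt u i j s t) (vt u i.+1 j s t).
by do 8 case.
Qed.

Variables (C N : nat) (zc : nat -> bool).
Hypotheses (N0 : 0 < N) (IE : I = C * N) (zmE : forall i, zm i = zc (i %/ N)).

(** On each coarse cell of the bottom side the gluing is the same throughout, so
    the primitive respects it on the whole cell once it does at the left corner.
    The other three sides need no condition because they form one connected strip
    starting at the bottom left corner, with one and the same gluing. *)
Lemma prim_mirrored u : mirrored u -> (forall f, valid f -> cobd u f = false) ->
  (forall c s t, c < C -> prim u (c * N) 0 s t = false) -> mirrored0 (prim u).
Proof.
move=> [hb ht vl vr] cl coarse.
have bottom c k s t : c < C -> k <= N ->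
    prim u (c * N + k) 0 s t = if zc c then prim u (c * N + k) 0 s (~~ t)
                               else prim u (c * N + k) 0 (~~ s) t.
  move=> cC; elim: k => [|k IH] kN; first by rewrite addn0 !coarse //; case: ifP.
  have kI : c * N + k < I.
    by rewrite IE (leq_trans (_ : _ < c.+1 * N)) ?leq_mul2r ?cC ?orbT // mulSn addnC ltn_add2r.
  rewrite addnS; have st s' t' : prim u (c * N + k).+1 0 s' t' =
      prim u (c * N + k) 0 s' t' (+) hz u (c * N + k) 0 s' t'.
    by rewrite -prim_hz //=; case: (prim _ _ _ _ _); case: (prim _ _ _ _ _).
  rewrite !st IH; last exact: ltnW.
  rewrite hb // zmE divnMDl // divn_small // addn0.
  by case: ifP.
have left j s t : j <= J -> prim u 0 j s t = prim u 0 j s (~~ t).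
  move=> jJ; rewrite /prim !big_ord0 /=; apply: eq_bigr => j' _; apply: vl.
  exact: leq_trans (ltn_ord j') jJ.
have top i s t : i <= I -> prim u i J s t = prim u i J s (~~ t).
  elim: i => [|i IH] iI; first exact: left.
  have st s' t' : prim u i.+1 J s' t' = prim u i J s' t' (+) hz u i J s' t'.
    by rewrite -prim_hz //=; case: (prim _ _ _ _ _); case: (prim _ _ _ _ _).
  by rewrite !st IH ?(ltnW iI) // ht.
split=> //.
  move=> i s t iI; have cC : i %/ N < C by rewrite ltn_divLR // -IE.
  have := bottom (i %/ N) (i %% N).+1 s t cC (ltn_pmod _ N0).
  by rewrite addnS -divn_eq zmE.
move=> j s t; move/subKn; move: (J - j) (leq_subr j J) => k.
elim: k j => [|k IH] j kJ; first by rewrite subn0 => <-; exact: top.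
move=> <-; have := prim_vt u I (J - k.+1); rewrite /= => st.
have E : (J - k.+1).+1 = J - k by lia.
have h s' t' : prim u I (J - k.+1) s' t' = prim u I (J - k) s' t' (+) vt u I (J - k.+1) s' t'.
  by rewrite -st -E; case: (prim _ _ _ _ _); case: (prim _ _ _ _ _).
rewrite !h (IH _ (ltnW kJ) (erefl _)) vr //; lia.
Qed.

Lemma cupF_mirrored u F : mirrored u -> mirrored0 F -> mirrored (cupF u F).
Proof.
move=> [a b c d] [a' b' c' d']; split=> i s t iI /=.
- by rewrite {1}a // {1}a' //; case: (zm i).
- by rewrite {1}b // {1}b'.
- by rewrite {1}c // {1}c'.
by rewrite {1}d // {1}d'.
Qed.

(** Stokes' formula for the product of u with the primitive of the closed cochain
    w: the change of the primitive between the ends of the walk of u is the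
    integral of u w. *)
Lemma cup_prim u T T' P w : valid T -> valid T' -> joins u T T' P -> mirrored w ->
  (forall f, valid f -> cobd w f = false) ->
  (forall c s t, c < C -> prim w (c * N) 0 s t = false) ->
  eTR (prim w) T (+) eTR (prim w) T' = integral2 (cup u w).
Proof.
move=> vT vT' [mu cu vu] mw cw pw.
have := stokes (cupF_mirrored mu (prim_mirrored mw cw pw)).
rewrite (eq_integral2 (b := fun f => ((f == T) && eTR (prim w) f) (+)
    ((f == T') && eTR (prim w) f) (+) cup u w f)); last first.
  move=> f vf; rewrite cobd_cupF cu //; congr (_ (+) _).
    by case: (f == T); case: (f == T'); case: (eTR _ _).
  move: f vf => [[[i j] s] t] /andP[/= iI jJ]; rewrite /cup.
  congr ((_ && _) (+) (_ && _)); first exact: prim_vt.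
  exact: prim_hz.
rewrite (integral2_addb _ (cup u w)) integral2_addb !integral2_point // => /eqP.
by move: (eTR _ T) (eTR _ T') (integral2 (cup u w)) => [] [] [].
Qed.

Lemma cup_vanish u w : (forall f, valid f -> vanish u f \/ vanish w f) ->
  integral2 (cup u w) = false.
Proof.
move=> h; apply: integral2_0 => -[[[i j] s] t] /h; rewrite /cup.
by case=> -[h1 h2 h3 h4]; rewrite ?h1 ?h2 ?h3 ?h4 ?andbF.
Qed.

Lemma cup_addcr_int u w w' :
  integral2 (cup u (addc w w')) = integral2 (cup u w) (+) integral2 (cup u w').
Proof.
by rewrite -integral2_addb; apply: eq_integral2 => f _; rewrite cup_addcr.
Qed.

(** In the integral of [cup_commutator] Stokes' formula removes the coboundary, and
    the coboundaries of u and w are concentrated at T, T' and Ta.  As each walk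
    avoids the first face of the other, only Ta contributes: 1 from the product of
    the two coboundaries, one bit for u and one bit for w.  In a sum over the pairs
    of a triple these bits occur twice. *)
Lemma cup_pair u w Ta T T' P Q : valid Ta -> valid T -> valid T' ->
  joins u T Ta P -> joins w T' Ta Q -> ~ Q T -> ~ P T' -> Ta != T -> Ta != T' ->
  integral2 (cup u w) (+) integral2 (cup w u) =
  ~~ ((eB u Ta (+) eR u Ta) (+) (eB w Ta (+) eR w Ta)).
Proof.
move=> va v v' [mu cu vu] [mw cw vw] QT PT' aT aT'.
rewrite -integral2_addb.
rewrite (eq_integral2 (b := fun f => cobd (mulc u w) f (+)
   ((((f == T) && (eB w f (+) eR w f)) (+) ((f == Ta) && (eB w f (+) eR w f))) (+)
   (((f == T') && (eB u f (+) eR u f)) (+) ((f == Ta) && (eB u f (+) eR u f)))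
   (+) (((f == T) && cobd w f) (+) ((f == Ta) && cobd w f))))); last first.
  move=> f vf; rewrite cup_commutator; congr (_ (+) _); rewrite cu // cw //.
  move: (f == T) (f == Ta) (f == T') (eB w f (+) eR w f) (eB u f (+) eR u f).
  by do 5 case.
rewrite (integral2_addb (cobd (mulc u w))) stokes; last exact: mirrored_mulc.
rewrite !integral2_addb.
rewrite !integral2_point // !cw // !eqxx.
have [-> -> _ _] := vw _ v QT; have [-> -> _ _] := vu _ v' PT'.
rewrite (negPf aT') (eq_sym T Ta) (negPf aT).
have /negPf -> : T != T'.
  apply/eqP => e; have := cw T v; rewrite /cobd; have [-> -> -> ->] := vw _ v QT.
  by rewrite e eqxx (eq_sym T' Ta) (negPf aT').
by case: (eB w Ta (+) eR w Ta); case: (eB u Ta (+) eR u Ta).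
Qed.

(** With G_xy the primitive of e_x + f_x + e_y + f_y, integration along e_z and h_z
    gives G_xy(Tv_z) + G_xy(Ta) = X_zx + X_zy and G_xy(Tv_z) = G_xy(Tc), because a
    leg of one triod avoids the legs of a different kind of the others.  The sum
    G_ij + G_jk + G_ki takes equal values at Ta and Tc, so the six numbers X add
    up to 0; but by [cup_pair] they add up to 3 plus twice the three bits. *)
Theorem no_grid_drawing n (Ta Tb Tc : face) (Tv : 'I_n -> face)
    (E F H : 'I_n -> face -> Prop) :
  2 * 2 ^ (C * 4) < n ->
  (forall i, linked (E i) (Tv i) Ta) -> (forall i, linked (F i) (Tv i) Tb) ->
  (forall i, linked (H i) (Tv i) Tc) ->
  (forall i j T, i != j -> valid T -> E i T -> F j T -> False) ->
  (forall i j T, i != j -> valid T -> E i T -> H j T -> False) ->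
  (forall i j T, i != j -> valid T -> F i T -> H j T -> False) -> False.
Proof.
move=> nbig lE lF lH EF EH FH.
have [e eP] := choice (fun i => linked_joins (lE i)).
have [f fP] := choice (fun i => linked_joins (lF i)).
have [h hP] := choice (fun i => linked_joins (lH i)).
(* C corners on each of the four sheets: this count does not depend on N *)
pose bits (i : 'I_n) := [ffun x : 'I_C * bool * bool =>
  prim (addc (e i) (f i)) (x.1.1 * N) 0 x.1.2 x.2].
have [i [j [k [ij jk ki bij bjk]]]] : exists i j k,
   [/\ i != j, j != k, k != i, bits i = bits j & bits j = bits k].
  have : ~~ [forall y, #|[pred i | bits i == y]| <= 2].
    apply/negP => /forallP le2; move: nbig; apply/negP; rewrite -leqNgt.
    rewrite -{1}(card_ord n) -sum1_card (partition_big bits xpredT) //=.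
    apply: (@leq_trans (\sum_(y : {ffun 'I_C * bool * bool -> bool}) 2)).
      apply: leq_sum => y _; rewrite sum1dep_card.
      by rewrite cardsE (leq_trans _ (le2 y)).
    rewrite sum_nat_const mulnC card_ffun card_bool !card_prod card_ord card_bool.
    by rewrite -mulnA.
  move=> /forallPn[y]; rewrite -ltnNge => /card_gt2P[i [j [k [[]]]]].
  rewrite !inE => /eqP bi /eqP bj /eqP bk [ij jk ki].
  by exists i, j, k; rewrite bi bj bk.
have vA : valid Ta by case: (linked_ends (lE i)).
have vV x : valid (Tv x) by case: (linked_ends (lE x)).
have vB : valid Tb by case: (linked_ends (lF i)).
have vC : valid Tc by case: (linked_ends (lH i)).
have EA x : E x Ta by case: (linked_ends (lE x)).
have EV x : E x (Tv x) by case: (linked_ends (lE x)).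
have FV x : F x (Tv x) by case: (linked_ends (lF x)).
pose w x y := addc (addc (e x) (f x)) (addc (e y) (f y)).
have mw x y : mirrored (w x y).
  by apply: mirrored_addc; apply: mirrored_addc; [case: (eP x)|case: (fP x)|case: (eP y)|case: (fP y)].
have cw x y : forall T, valid T -> cobd (w x y) T = false.
  move=> T vT; rewrite !cobd_addc; case: (eP x) => _ -> // _; case: (eP y) => _ -> // _.
  case: (fP x) => _ -> // _; case: (fP y) => _ -> // _.
  by move: (_ == Tv x) (_ == Tv y) (_ == Ta) (_ == Tb); do 4 case.
have pw x y : bits x = bits y ->
    forall c s t, c < C -> prim (w x y) (c * N) 0 s t = false.
  move=> bxy c s t cC; rewrite prim_addc.
  by have /ffunP/(_ (Ordinal cC, s, t)) := bxy; rewrite !ffunE /= => ->; rewrite addbb.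
have ev x T : valid T -> ~ E x T -> vanish (e x) T.
  by move=> vT nT; case: (eP x) => _ _ vv; exact: vv.
have fv x T : valid T -> ~ F x T -> vanish (f x) T.
  by move=> vT nT; case: (fP x) => _ _ vv; exact: vv.
have hv x T : valid T -> ~ H x T -> vanish (h x) T.
  by move=> vT nT; case: (hP x) => _ _ vv; exact: vv.
pose G x y := eTR (prim (w x y)).
pose X x y := integral2 (cup (e x) (e y)).
have Ge z x y : bits x = bits y -> z != x -> z != y ->
    G x y (Tv z) (+) G x y Ta = X z x (+) X z y.
  move=> bxy zx zy; rewrite /G (cup_prim _ _ (eP z)) //; [|exact: cw|exact: pw].
  rewrite !cup_addcr_int.
  have EF0 a : z != a -> integral2 (cup (e z) (f a)) = false.
    move=> za; apply: cup_vanish => T vT.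
    case: (pselect (E z T)) => [ET|nE]; last by left; exact: ev.
    right; apply: fv => // FT; exact: EF za vT ET FT.
  by rewrite (EF0 x zx) (EF0 y zy) !addbF.
have Gh : forall z x y, bits x = bits y -> z != x -> z != y ->
    G x y (Tv z) (+) G x y Tc = false.
  move=> z x y bxy zx zy; rewrite /G (cup_prim _ _ (hP z)) //; [|exact: cw|exact: pw].
  rewrite !cup_addcr_int.
  have HE0 a : z != a -> integral2 (cup (h z) (e a)) = false.
    move=> za; apply: cup_vanish => T vT.
    case: (pselect (H z T)) => [ET|nE]; last by left; exact: hv.
    right; apply: ev => // FT; apply: (EH a z T) => //; by rewrite eq_sym.
  have HF0 a : z != a -> integral2 (cup (h z) (f a)) = false.
    move=> za; apply: cup_vanish => T vT.
    case: (pselect (H z T)) => [ET|nE]; last by left; exact: hv.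
    right; apply: fv => // FT; apply: (FH a z T) => //; by rewrite eq_sym.
  by rewrite !HE0 // !HF0.
(* the three closed cochains add up to 0, hence so do the increments of their primitives *)
have cyc z u T P : valid T -> joins u (Tv z) T P ->
    (G i j (Tv z) (+) G i j T) (+) (G j k (Tv z) (+) G j k T)
    (+) (G k i (Tv z) (+) G k i T) = false.
  move=> vT jn; have bki : bits k = bits i by rewrite bij.
  rewrite /G !(cup_prim _ _ jn) //; try exact: cw; try exact: pw.
  rewrite !cup_addcr_int; move: (integral2 (cup u (e i))) (integral2 (cup u (f i))).
  move: (integral2 (cup u (e j))) (integral2 (cup u (f j))).
  by move: (integral2 (cup u (e k))) (integral2 (cup u (f k))); do 6 case.
have pairE x y : x != y -> X x y (+) X y x =
    ~~ ((eB (e x) Ta (+) eR (e x) Ta) (+) (eB (e y) Ta (+) eR (e y) Ta)).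
  move=> xy; have yx : y != x by rewrite eq_sym.
  apply: (cup_pair _ _ _ (eP x) (eP y)) => //.
  - by move=> EyTx; apply: (EF y x (Tv x)).
  - by move=> ExTy; apply: (EF x y (Tv y)).
  - apply/eqP => aE; apply: (EF y x Ta) => //; rewrite aE; exact: FV.
  - apply/eqP => aE; apply: (EF x y Ta) => //; rewrite aE; exact: FV.
have bki : bits k = bits i by rewrite bij.
have ji : j != i by rewrite eq_sym. have kj : k != j by rewrite eq_sym.
have ik : i != k by rewrite eq_sym.
have := cyc i (e i) Ta (E i) vA (eP i); have := cyc i (h i) Tc (H i) vC (hP i).
have := Ge k i j bij ki kj; have := Ge i j k bjk ij ik; have := Ge j k i bki jk ji.
have := Gh k i j bij ki kj; have := Gh i j k bjk ij ik; have := Gh j k i bki jk ji.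
have := pairE i j ij; have := pairE j k jk; have := pairE k i ki.
move: (eB (e i) Ta (+) _) (eB (e j) Ta (+) _) (eB (e k) Ta (+) _) => ri rj rk.
move: (X i j) (X j i) (X j k) (X k j) (X k i) (X i k) => xij xji xjk xkj xki xik.
move: (G i j Ta) (G j k Ta) (G k i Ta) (G i j Tc) (G j k Tc) (G k i Tc) => a1 a2 a3 c1 c2 c3.
move: (G i j (Tv k)) (G j k (Tv i)) (G k i (Tv j)) (G i j (Tv i)) (G k i (Tv i)) => g1 g2 g3 g4 g5.
move=> p1 p2 p3 h1 h2 h3 e1 e2 e3 ch ce.
have ac : a1 (+) a2 (+) a3 = c1 (+) c2 (+) c3.
  move: ch ce => {h1 h2 h3 e1 e2 e3 p1 p2 p3}.
  by case: g2; case: g4; case: g5; case: a1; case: a2; case: a3; case: c1; case: c2; case: c3.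
have elim3 g a c x : g (+) c = false -> g (+) a = x -> c = a (+) x.
  by case: g; case: a; case: c; case: x.
move: ac; rewrite (elim3 _ _ _ _ h1 e1) (elim3 _ _ _ _ h2 e2) (elim3 _ _ _ _ h3 e3).
have -> : xij = ~~ (ri (+) rj) (+) xji by rewrite -p3 addbK.
have -> : xjk = ~~ (rj (+) rk) (+) xkj by rewrite -p2 addbK.
have -> : xki = ~~ (rk (+) ri) (+) xik by rewrite -p1 addbK.
clear; case: ri; case: rj; case: rk; case: xji; case: xkj; case: xik;
  by case: a1; case: a2; case: a3.
Qed.

End Grid.

(** * The surface as four sheets over a rectangle *)

Section Geometry.
Local Open Scope ring_scope.
Local Open Scope classical_set_scope.
Variables (K : realType) (g : nat).

Notation L := ((3 * g + 1)%:R : K).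

(** The half y >= 0 of the disc with holes, and its mirror image, is mapped to a rectangle in two
    steps.  [bump] is the height of the holes above the x-axis.  [shear] lowers
    each vertical line so that the part of the boundary over a hole becomes flat,
    leaving heights of 2 and more unchanged.  The radial rescaling from the
    Euclidean norm [rad2] to the maximum norm [radm] then carries the half disc of
    radius L to the rectangle of width 2 L and height L; [PX] and [PY] are its
    coordinates, measured from the lower left corner. *)
Definition bump (x : K) : K :=
  \big[Num.max/0]_(i < g) Num.sqrt (1 - (x - (3 * i)%:R) ^+ 2).

Definition shear (p : Defs.space K) : K :=
  Num.min `|p.1.2| (2 * (`|p.1.2| - bump p.1.1) / (2 - bump p.1.1)).

Definition rad2 (p : Defs.space K) : K := Num.sqrt (p.1.1 ^+ 2 + shear p ^+ 2).
Definition radm (p : Defs.space K) : K := Num.max `|p.1.1| `|shear p|.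

Definition PX (p : Defs.space K) : K := p.1.1 * (rad2 p / radm p) + L.
Definition PY (p : Defs.space K) : K := shear p * (rad2 p / radm p).

Lemma bump_ge0 x : 0 <= bump x.
Proof. exact: bigmax_ge_id. Qed.

Lemma bump_le1 x : bump x <= 1.
Proof.
apply: bigmax_le => // i _; rewrite -[leRHS]sqrtr1 ler_wsqrtr //.
by rewrite lerBlDr lerDl sqr_ge0.
Qed.

Lemma bump_ge x (i : 'I_g) : Num.sqrt (1 - (x - (3 * i)%:R) ^+ 2) <= bump x.
Proof. exact: le_bigmax_cond. Qed.

Lemma bump_gt0 x : 0 < bump x -> exists i : 'I_g, (x - (3 * i)%:R) ^+ 2 < 1.
Proof.
move=> b0; apply: contrapT => /forallNP h; move: b0; rewrite ltNge => /negP; apply.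
apply: bigmax_le => // i _; rewrite ler0_sqrtr // subr_le0 leNgt; apply/negP; exact: h.
Qed.

Lemma cont_x : continuous (fun p : Defs.space K => p.1.1).
Proof. by move=> p; apply: continuous_comp; [exact: cvg_fst|exact: cvg_fst]. Qed.
Lemma cont_y : continuous (fun p : Defs.space K => p.1.2).
Proof. by move=> p; apply: continuous_comp; [exact: cvg_fst|exact: cvg_snd]. Qed.
Lemma cont_z : continuous (fun p : Defs.space K => p.2).
Proof. by move=> p; exact: cvg_snd. Qed.

Lemma cvg_sqrtr (T : Type) (F : set_system T) (FF : Filter F) (f : T -> K) (a : K) :
  f @ F --> a -> Num.sqrt (f x) @[x --> F] --> Num.sqrt a.
Proof. by move=> fa; apply: (continuous_cvg _ _ fa); exact: sqrt_continuous. Qed.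

Lemma cont_bump : continuous bump.
Proof.
move=> x; apply: cvg_big => [|i _]; first exact: max_continuous.
apply: cvg_sqrtr; apply: cvgB; first exact: cvg_cst.
by apply: cvgM; (apply: cvgB; [exact: cvg_id|exact: cvg_cst]).
Qed.

Lemma cont_absy : continuous (fun p : Defs.space K => `|p.1.2|).
Proof. by move=> p; apply: cvg_norm; exact: cont_y. Qed.

Lemma cont_shear : continuous shear.
Proof.
move=> p.
have cb : (fun p : Defs.space K => bump p.1.1) x @[x --> p] --> bump p.1.1.
  apply: (@continuous_comp _ _ _ (fun p : Defs.space K => p.1.1) bump); [exact: cont_x|exact: cont_bump].
apply: (@continuous_min _ _ (fun p : Defs.space K => `|p.1.2|) (fun p : Defs.space K => 2 * (`|p.1.2| - bump p.1.1) / (2 - bump p.1.1))).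
  exact: cont_absy.
apply: cvgM.
  apply: cvgM; first exact: cvg_cst.
  by apply: cvgB => //; exact: cont_absy.
apply: cvgV.
  have := bump_le1 p.1.1; have := @ler_norm K; move=> _ h; apply/eqP; lra.
by apply: cvgB => //; exact: cvg_cst.
Qed.

Lemma radm_ge0 p : 0 <= radm p.
Proof. by rewrite le_max normr_ge0. Qed.

Lemma rad2_le p : rad2 p <= 2 * radm p.
Proof.
have m0 := radm_ge0 p.
rewrite /rad2 -[leRHS]ger0_norm ?mulr_ge0 // -sqrtr_sqr ler_wsqrtr //.
have h1 : `|p.1.1| <= radm p by rewrite le_max lexx.
have h2 : `|shear p| <= radm p by rewrite le_max lexx orbT.
rewrite -(real_normK (num_real p.1.1)) -(real_normK (num_real (shear p))).
have := normr_ge0 p.1.1; have := normr_ge0 (shear p); nra.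
Qed.

Lemma radm_le p : radm p <= rad2 p.
Proof.
rewrite /radm ge_max /rad2 -!sqrtr_sqr !ler_wsqrtr //.
  by rewrite lerDr sqr_ge0.
by rewrite lerDl sqr_ge0.
Qed.

Lemma cont_rad2 : continuous rad2.
Proof.
move=> p; apply: cvg_sqrtr; apply: cvgD; first by apply: cvgM; exact: cont_x.
by apply: cvgM; exact: cont_shear.
Qed.

Lemma cont_radm : continuous radm.
Proof.
move=> p; apply: (@continuous_max _ _ (fun p : Defs.space K => `|p.1.1|) (fun p => `|shear p|)).
  by apply: cvg_norm; exact: cont_x.
by apply: cvg_norm; exact: cont_shear.
Qed.

(** The quotient of the two norms is discontinuous at the origin, but it is bounded
    and multiplied by a function that vanishes there. *)
Lemma cont_rescale (f : Defs.space K -> K) : continuous f ->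
  (forall p, `|f p| <= radm p) -> continuous (fun p => f p * (rad2 p / radm p)).
Proof.
move=> cf fm p; have [m0|m0] := eqVneq (radm p) 0; last first.
  apply: cvgM; first exact: cf.
  apply: cvgM; first exact: cont_rad2.
  by apply: cvgV => //; exact: cont_radm.
have r0 : rad2 p = 0.
  by apply/eqP; rewrite eq_le sqrtr_ge0 andbT (le_trans (rad2_le p)) // m0 mulr0.
rewrite /continuous_at r0 m0 mul0r mulr0.
apply/cvgr0Pnorm_lt => e e0.
have := @cont_rad2 p; rewrite /continuous_at r0 => /cvgr0Pnorm_lt /(_ e e0).
apply: filterS => q; apply: le_lt_trans.
rewrite normrM; have [m0'|m0'] := eqVneq (radm q) 0.
  by rewrite m0' invr0 mulr0 normr0 mulr0.
rewrite normrM normfV mulrCA ler_piMr // (ger0_norm (radm_ge0 q)).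
by rewrite ler_pdivrMr ?mul1r // lt0r m0' radm_ge0.
Qed.

Lemma cont_PX : continuous PX.
Proof.
move=> p; apply: cvgD; last exact: cvg_cst.
by apply: (cont_rescale cont_x) => q; rewrite le_max lexx.
Qed.

Lemma cont_PY : continuous PY.
Proof. by apply: (cont_rescale cont_shear) => q; rewrite le_max lexx orbT. Qed.

Lemma hole_le (i : 'I_g) : 0 <= (3 * i)%:R :> K /\ (3 * i)%:R + 4 <= L.
Proof.
split=> //; have -> : (4 : K) = 4%:R by [].
by rewrite -natrD ler_nat; have := ltn_ord i; lia.
Qed.

Lemma L_ge1 : 1 <= L.
Proof. by rewrite ler1n addn1. Qed.

Lemma sqr_lt1_itv (t : K) : t ^+ 2 < 1 -> -1 < t < 1.
Proof. by move=> h; apply/andP; split; nra. Qed.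

Lemma ge1_sqr (t : K) : 1 <= t ^+ 2 -> 1 <= t \/ t <= -1.
Proof. by move=> t1; have [h|h] := leP 0 t; [left|right]; nra. Qed.

Lemma surface_region (p : Defs.space K) : surface g p ->
  p.1.1 ^+ 2 + p.1.2 ^+ 2 <= L ^+ 2 /\
  forall i : 'I_g, 1 <= (p.1.1 - (3 * i)%:R) ^+ 2 + p.1.2 ^+ 2.
Proof.
move: p => [[x y] z] /= zE.
have inside (i : 'I_g) : (x - (3 * i)%:R) ^+ 2 + y ^+ 2 <= 1 -> x ^+ 2 + y ^+ 2 < L ^+ 2.
  have [c0 cL] := hole_le i; move: (_%:R) c0 cL => c c0 cL h.
  have : x - c <= 1 by nra.
  nra.
have A0 : x ^+ 2 + y ^+ 2 <= L ^+ 2.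
  rewrite leNgt; apply/negP => h.
  have : 0 < \prod_(i < g) ((x - (3 * i)%:R) ^+ 2 + y ^+ 2 - 1).
    apply: prodr_gt0 => i _; rewrite subr_gt0 ltNge; apply/negP => /inside; lra.
  move: (\prod_(i < g) _) zE => P; have := sqr_ge0 z; nra.
split=> // i; rewrite leNgt; apply/negP => h.
move: zE; rewrite (bigD1 i) //=.
have : 0 < \prod_(j < g | j != i) ((x - (3 * j)%:R) ^+ 2 + y ^+ 2 - 1).
  apply: prodr_gt0 => j ji; rewrite subr_gt0.
  have : 3 <= (3 * i)%:R - (3 * j)%:R :> K \/ 3 <= (3 * j)%:R - (3 * i)%:R :> K.
    have [ij|ij|/val_inj ij] := ltngtP (j : nat) (i : nat).
    - by left; rewrite lerBrDr -natrD ler_nat; lia.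
    - by right; rewrite lerBrDr -natrD ler_nat; lia.
    - by rewrite ij eqxx in ji.
  have ht : -1 < x - (3 * i)%:R < 1.
    by apply: sqr_lt1_itv; apply: le_lt_trans h; rewrite lerDl sqr_ge0.
  move: ht; move: (3 * i)%:R (3 * j)%:R => c d /andP[h1 h2] [h3|h3].
    by have h4 : 2 < x - d; [lra|have := sqr_ge0 y; nra].
  by have h4 : x - d < - 2; [lra|have := sqr_ge0 y; nra].
have := inside i (ltW h); move: (\prod_(j < g | _) _) => P.
have := sqr_ge0 z; move: h; move: ((x - _) ^+ 2) => H.
move: (z ^+ 2) => Z h Z0 A P0 E.
have : (L ^+ 2 - x ^+ 2 - y ^+ 2) * ((1 - (H + y ^+ 2)) * P) > 0.
  by apply: mulr_gt0; [lra|apply: mulr_gt0; lra].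
nra.
Qed.

Lemma surface_bump (p : Defs.space K) : surface g p -> bump p.1.1 <= `|p.1.2|.
Proof.
move=> /surface_region[_ h]; apply: bigmax_le => // i _.
rewrite -sqrtr_sqr ler_wsqrtr //; have := h i; lra.
Qed.

Lemma shear_bounds (p : Defs.space K) : surface g p -> 0 <= shear p <= `|p.1.2|.
Proof.
move=> /surface_bump h; rewrite le_min ge_min lexx normr_ge0 /= andbT.
apply: divr_ge0; last by have := bump_le1 p.1.1; lra.
by rewrite mulr_ge0 // subr_ge0.
Qed.

Lemma rad2_leL (p : Defs.space K) : surface g p -> rad2 p <= L.
Proof.
move=> Sp; have [h _] := surface_region Sp; have /andP[s0 s1] := shear_bounds Sp.
rewrite -[L]ger0_norm // -sqrtr_sqr ler_wsqrtr //; apply: le_trans h.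
by rewrite lerD2l -(real_normK (num_real p.1.2)) lerXn2r // nnegrE.
Qed.

Lemma rescale_le (p : Defs.space K) (a : K) : `|a| <= radm p ->
  `|a * (rad2 p / radm p)| <= rad2 p.
Proof.
move=> am; rewrite normrM (ger0_norm (_ : 0 <= rad2 p / radm p)); last first.
  by apply: divr_ge0; [exact: sqrtr_ge0|exact: radm_ge0].
have [m0|m0] := eqVneq (radm p) 0.
  by rewrite m0 invr0 !mulr0 sqrtr_ge0.
rewrite mulrCA ler_piMr ?sqrtr_ge0 //.
by rewrite ler_pdivrMr ?mul1r // lt0r m0 radm_ge0.
Qed.

Lemma PX_itv (p : Defs.space K) : surface g p -> 0 <= PX p <= L + L.
Proof.
move=> Sp; have := rad2_leL Sp.
have : `|p.1.1 * (rad2 p / radm p)| <= rad2 p by apply: rescale_le; rewrite le_max lexx.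
by rewrite ler_norml /PX => /andP[h1 h2] h3; apply/andP; split; lra.
Qed.

Lemma PY_itv (p : Defs.space K) : surface g p -> 0 <= PY p <= L.
Proof.
move=> Sp; have /andP[s0 s1] := shear_bounds Sp; apply/andP; split.
  apply: mulr_ge0 => //; apply: divr_ge0; [exact: sqrtr_ge0|exact: radm_ge0].
apply: le_trans (rad2_leL Sp); apply: le_trans (ler_norm _) _.
by apply: rescale_le; rewrite le_max lexx orbT.
Qed.

Lemma shear0 (p : Defs.space K) : surface g p -> `|p.1.2| <= bump p.1.1 -> shear p = 0.
Proof.
move=> Sp h; have hE : `|p.1.2| = bump p.1.1.
  by apply/eqP; rewrite eq_le h surface_bump.
rewrite /shear hE subrr mulr0 mul0r; apply/min_idPr; exact: bump_ge0.
Qed.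

Lemma flat (p : Defs.space K) : shear p = 0 -> PY p = 0 /\ PX p = p.1.1 + L.
Proof.
move=> s0; rewrite /PX /PY s0 mul0r; split=> //; congr (_ + _).
have r2 : rad2 p = `|p.1.1| by rewrite /rad2 s0 expr0n /= addr0 sqrtr_sqr.
have rm : radm p = `|p.1.1| by rewrite /radm s0 normr0; apply/max_idPl.
rewrite r2 rm; have [->|x0] := eqVneq p.1.1 0; first by rewrite mul0r.
by rewrite divff ?mulr1 // normr_eq0.
Qed.

(** The hole i is centred at 3 i, at distance 3 (g + i) + 1 from the left side, and
    has radius 1: it covers the unit cells 3 (g + i) and 3 (g + i) + 1. *)
Definition hole_cell (c : nat) : bool := (c %% 3 != 2)%N && (g <= c %/ 3 < 2 * g)%N.

(** The x-axis meets the surface only outside the holes or on their rims, where the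
    shear does nothing: the sheets y >= 0 and y <= 0 meet over the unit cells of the
    bottom side that no hole covers. *)
Lemma y0_mirror (p : Defs.space K) : surface g p -> p.1.2 = 0 ->
  PY p = 0 /\ exists c : nat, [/\ (c < 2 * (3 * g + 1))%N, ~~ hole_cell c &
    c%:R <= PX p <= c.+1%:R].
Proof.
move=> Sp y0.
have s0 : shear p = 0 by apply: shear0 => //; rewrite y0 normr0 bump_ge0.
have [-> PXE] := flat s0; split=> //; have := PX_itv Sp; rewrite PXE.
have [hL hh] := surface_region Sp.
set X := p.1.1 + L => /andP[X0 XL].
have {}XL : X <= (2 * (3 * g + 1))%:R by rewrite mul2n -addnn natrD.
have /andP[t1 t2] := truncn_itv X0; set c := Num.truncn X in t1 t2.
have L0 : (0 < 3 * g + 1)%N by lia.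
have [cL|cL] := ltnP c (2 * (3 * g + 1)); last first.
  exists (2 * (3 * g + 1)).-1; split; first lia.
    by rewrite /hole_cell; apply/negP; lia.
  rewrite prednK; last lia. rewrite XL andbT (le_trans _ t1) // ler_nat; lia.
case: (boolP (hole_cell c)) => hc; last by exists c; rewrite t1 (ltW t2).
have [c3 /andP[c1 c2]] := andP hc.
pose i := (c %/ 3 - g)%N; have ig : (i < g)%N by rewrite /i; lia.
have := hh (Ordinal ig); rewrite y0 expr0n /= addr0 => hi.
have cE : c%:R = L + (3 * i)%:R - 1 \/ c%:R = L + (3 * i)%:R :> K.
  have [ce|ce] : (c + 1 = 3 * g + 1 + 3 * i \/ c = 3 * g + 1 + 3 * i)%N by rewrite /i; lia.
    by left; rewrite -natrD -ce natrD addrK.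
  by right; rewrite {1}ce natrD.
have [hx|hx] : 1 <= p.1.1 - (3 * i)%:R \/ p.1.1 - (3 * i)%:R <= -1.
    exact: ge1_sqr.
  have ce : c = (3 * g + 1 + 3 * i)%N.
    case: cE => cE; last by apply/eqP; rewrite -(eqr_nat K) cE !natrD.
    by exfalso; move: t2; rewrite -natr1 cE /X => t2; lra.
  exists c.+1; split; [lia| |].
    by rewrite /hole_cell; apply/negP; rewrite ce; lia.
  rewrite -!natr1 ce natrD /X; move: t2; rewrite -natr1 ce natrD /X => t2.
  by apply/andP; split; lra.
have ce : (c + 1 = 3 * g + 1 + 3 * i)%N.
  case: cE => cE; first by apply/eqP; rewrite -(eqr_nat K) natrD cE !natrD; apply/eqP; lra.
  by exfalso; move: t1; rewrite cE /X => t1; lra.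
exists c.-1; split; [lia| |].
  by rewrite /hole_cell; apply/negP; lia.
rewrite prednK; last lia.
have cE' : c%:R = L + (3 * i)%:R - 1 :> K by rewrite -natrD -ce natrD addrK.
have cp : c.-1%:R = c%:R - 1 :> K by rewrite -[in RHS](@prednK c) -?natr1 ?addrK //; lia.
rewrite cp; move: t1 t2; rewrite cE' /X => t1 t2; apply/andP; split; lra.
Qed.

End Geometry.

Section Geometry2.
Local Open Scope ring_scope.
Local Open Scope classical_set_scope.
Variables (K : realType) (g : nat).

Notation L := ((3 * g + 1)%:R : K).
Notation shear := (@shear K g).
Notation rad2 := (@rad2 K g).
Notation radm := (@radm K g).
Notation PX := (@PX K g).
Notation PY := (@PY K g).
Notation bump := (@bump K g).

(** The sheets z >= 0 and z <= 0 meet over the circles: the holes give the hole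
    cells of the bottom side and the outer circle gives the other three sides. *)
Lemma z0_mirror (p : Defs.space K) : surface g p -> p.2 = 0 ->
  [\/ PY p = 0 /\ exists c : nat, [/\ (c < 2 * (3 * g + 1))%N, hole_cell g c &
        c%:R <= PX p <= c.+1%:R], PX p = 0, PX p = L + L | PY p = L].
Proof.
move=> Sp z0.
have [hL hh] := surface_region Sp.
have : p.1.1 ^+ 2 + p.1.2 ^+ 2 = L ^+ 2 \/
    exists i : 'I_g, (p.1.1 - (3 * i)%:R) ^+ 2 + p.1.2 ^+ 2 = 1.
  move: z0 Sp; case: p {hL hh} => [[x y] z] /= -> /esym/eqP.
  rewrite expr0n /= mulf_eq0 => /orP[/eqP o|/prodf_eq0[i _ /eqP hi]]; first by left; lra.
  by right; exists i; lra.
case=> [outer|[i hi]].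
  (* where a hole is below, the outer circle is so high that the shear is the identity there *)
  have shE : shear p = `|p.1.2|.
    apply/min_idPl; have b1 := bump_le1 g p.1.1; have b0 := bump_ge0 g p.1.1.
    rewrite ler_pdivlMr; last lra.
    have [b00|bn] := eqVneq (bump p.1.1) 0; first by rewrite b00; have := normr_ge0 p.1.2; lra.
    have {}bn : 0 < bump p.1.1 by rewrite lt0r bn.
    have [i hi] := bump_gt0 bn.
    have /andP[x1 x2] := sqr_lt1_itv hi; have [c0 c1] := @hole_le K g i.
    have h2 : 2 <= `|p.1.2|.
      have : 2 ^+ 2 <= `|p.1.2| ^+ 2.
        rewrite (real_normK (num_real _)); move: c0 c1 x1 x2 outer.
        move: (3 * i)%:R L => c l c0 c1 x1 x2 outer; nra.
      by rewrite ler_pXn2r ?nnegrE.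
    nra.
  have rL : rad2 p = L.
    by rewrite /rad2 shE real_normK ?num_real // outer sqrtr_sqr ger0_norm.
  have L1 := L_ge1 K g.
  have m0 : radm p != 0.
    apply/eqP => m0; have := rad2_le g p; rewrite rL m0; lra.
  rewrite /PX /PY rL.
  have m00 : 0 < radm p by rewrite lt0r m0 radm_ge0.
  have : radm p = `|p.1.1| \/ radm p = `|shear p|.
    by rewrite /radm; case: (leP `|p.1.1| `|shear p|); [right|left].
  case=> mE.
    have [x0|x0] := leP 0 p.1.1.
      constructor 3; rewrite mE ger0_norm //; congr (_ + _).
      by rewrite mulrCA divff ?mulr1 // -(ger0_norm x0) -mE.
    constructor 2; rewrite mE ltr0_norm // invrN mulrN mulrN mulrCA divff ?mulr1 ?addNr //.
    by rewrite lt_eqF.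
  constructor 4; rewrite mE ger0_norm; last by rewrite shE.
  by rewrite mulrCA divff ?mulr1 // -(ger0_norm (_ : 0 <= shear p)) -?mE // shE.
have s0 : shear p = 0.
  apply: shear0 => //; apply: le_trans (bump_ge p.1.1 i).
  by rewrite -sqrtr_sqr ler_wsqrtr //; lra.
have [-> ->] := flat s0; constructor 1; split=> //.
have : -1 <= p.1.1 - (3 * i)%:R <= 1.
  by rewrite -ler_norml -[leRHS]sqrtr1 -sqrtr_sqr ler_wsqrtr //; have := sqr_ge0 p.1.2; lra.
move=> /andP[x1 x2]; have ig := ltn_ord i.
have [xi|xi] := leP (3 * i)%:R p.1.1.
  exists (3 * g + 1 + 3 * i)%N; split; [lia|by rewrite /hole_cell; apply/andP; lia|].
  by rewrite -natr1 natrD; apply/andP; split; lra.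
exists (3 * g + 3 * i)%N; split; [lia|by rewrite /hole_cell; apply/andP; lia|].
by rewrite -natr1 !natrD; apply/andP; split; lra.
Qed.

Lemma shear_inj (p q : Defs.space K) : p.1.1 = q.1.1 -> shear p = shear q ->
  `|p.1.2| = `|q.1.2|.
Proof.
rewrite /shear => ->; have b1 := bump_le1 g q.1.1; have b0 := bump_ge0 g q.1.1.
move: (bump q.1.1) b1 b0 => b b1 b0.
wlog lt : p q / `|p.1.2| < `|q.1.2|.
  move=> W; have [h|h|//] := ltgtP `|p.1.2| `|q.1.2| => e; first by rewrite (W p q).
  by rewrite (W q p).
move=> e; exfalso.
have : Num.min `|p.1.2| (2 * (`|p.1.2| - b) / (2 - b)) < Num.min `|q.1.2| (2 * (`|q.1.2| - b) / (2 - b)).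
  rewrite lt_min !gt_min lt /=; apply/orP; right.
  rewrite ltr_pM2r ?invr_gt0; lra.
by rewrite e ltxx.
Qed.

Lemma radial_inj (p q : Defs.space K) :
  p.1.1 * (rad2 p / radm p) = q.1.1 * (rad2 q / radm q) ->
  shear p * (rad2 p / radm p) = shear q * (rad2 q / radm q) ->
  p.1.1 = q.1.1 /\ shear p = shear q.
Proof.
have normE (x : Defs.space K) : radm x != 0 ->
    Num.max `|x.1.1 * (rad2 x / radm x)| `|shear x * (rad2 x / radm x)| = rad2 x.
  move=> m0; have k0 : 0 <= rad2 x / radm x.
    by apply: divr_ge0; [exact: sqrtr_ge0|exact: radm_ge0].
  rewrite (normrM x.1.1) (normrM (shear x)) (ger0_norm k0) -maxr_pMl //.
  by rewrite -/(radm x) mulrCA divff // mulr1.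
have m0E (x : Defs.space K) : radm x = 0 -> p.1.1 = p.1.1 /\ x.1.1 = 0 /\ shear x = 0.
  move=> m0; split=> //; split; apply/eqP; rewrite -normr_le0 -m0 le_max lexx ?orbT //.
have r0E (x : Defs.space K) : radm x != 0 -> 0 < rad2 x.
  by move=> m0; apply: lt_le_trans (radm_le g x); rewrite lt0r m0 radm_ge0.
move=> ex ey; have [mp|mp] := eqVneq (radm p) 0; have [mq|mq] := eqVneq (radm q) 0.
- have [_ [-> ->]] := m0E _ mp; by have [_ [-> ->]] := m0E _ mq.
- have := normE _ mq; rewrite -ex -ey mp invr0 !mulr0 normr0 maxxx => /esym r0.
  by have := r0E _ mq; rewrite r0 ltxx.
- have := normE _ mp; rewrite ex ey mq invr0 !mulr0 normr0 maxxx => /esym r0.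
  by have := r0E _ mp; rewrite r0 ltxx.
have rr : rad2 p = rad2 q by rewrite -(normE _ mp) -(normE _ mq) ex ey.
have rp := r0E _ mp; have rq := r0E _ mq.
have sq (x : Defs.space K) : (x.1.1 * (rad2 x / radm x)) ^+ 2 + (shear x * (rad2 x / radm x)) ^+ 2
     = rad2 x ^+ 2 * (rad2 x / radm x) ^+ 2.
  rewrite !exprMn -mulrDl; congr (_ * _).
  by rewrite sqr_sqrtr // addr_ge0 ?sqr_ge0.
have kk : rad2 p / radm p = rad2 q / radm q.
  have := sq p; rewrite ex ey (sq q) rr => /(mulfI (lt0r_neq0 (exprn_gt0 2 rq))) /eqP.
  rewrite eqrXn2 //; first by move/eqP => <-.
    by rewrite divr_ge0 ?radm_ge0 // ltW.
  by rewrite divr_ge0 ?radm_ge0 // ltW.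
have kn : rad2 q / radm q != 0 by rewrite mulf_neq0 ?invr_eq0 // lt0r_neq0.
by split; apply: (mulIf kn); rewrite -{1}kk.
Qed.

(** A point of the surface is determined by its place in the rectangle and by the
    sheets that contain it: [PX] and [PY] give x and |y|, the equation gives
    z ^ 2. *)
Lemma surface_inj (p q : Defs.space K) : surface g p -> surface g q ->
  PX p = PX q -> PY p = PY q ->
  ~ (p.1.2 < 0 /\ 0 < q.1.2 \/ q.1.2 < 0 /\ 0 < p.1.2) ->
  ~ (p.2 < 0 /\ 0 < q.2 \/ q.2 < 0 /\ 0 < p.2) -> p = q.
Proof.
move=> Sp Sq /addIr eX eY ny nz; have [ex es] := radial_inj eX eY.
have absE (a b : K) : `|a| = `|b| -> ~ (a < 0 /\ 0 < b \/ b < 0 /\ 0 < a) -> a = b.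
  move=> ab n; have [a0|a0] := leP 0 a; have [b0|b0] := leP 0 b.
  - by rewrite -(ger0_norm a0) ab ger0_norm.
  - move: ab; rewrite (ger0_norm a0) (ltr0_norm b0) => ab.
    by case: n; right; lra.
  - move: ab; rewrite (ltr0_norm a0) (ger0_norm b0) => ab.
    by case: n; left; lra.
  - by move: ab; rewrite !ltr0_norm // => /oppr_inj.
have ey := absE _ _ (shear_inj ex es) ny.
have ez : p.2 = q.2.
  apply: absE nz; rewrite -!sqrtr_sqr; congr Num.sqrt.
  move: Sp Sq ex ey; case: p {eX eY es ny} => [[x y] z]; case: q => [[x' y'] z'] /=.
  by move=> -> -> -> ->.
by move: ex ey ez; case: p {Sp eX eY es ny nz} => [[x y] z]; case: q {Sq} => [[x' y'] z'] /= -> -> ->.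
Qed.

End Geometry2.

(** * Faces near a point of the surface *)

Lemma divn_cell c N i : (0 < N -> c * N <= i -> i < c.+1 * N -> i %/ N = c)%N.
Proof. by move=> N0 h1 h2; apply/eqP; rewrite eqn_leq leq_divRL // -ltnS ltn_divLR // h2. Qed.

Section Walks.
Local Open Scope nat_scope.
Variables (I J : nat) (zm : nat -> bool) (P : face -> Prop).

Lemma walk_right i k j s t : i + k < I -> j < J ->
  (forall a, i <= a <= i + k -> P (a, j, s, t)) ->
  linked I J zm P (i, j, s, t) (i + k, j, s, t).
Proof.
elim: k => [|k IH] kI jJ Pa.
  by rewrite addn0; apply: linked_refl; [rewrite /valid /=; lia|apply: Pa; lia].
apply: linked_step (IH _ jJ _) _ _; first lia.
- by move=> a ai; apply: Pa; lia.
- by left; rewrite addnS; apply: stp_right; lia.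
by apply: Pa; lia.
Qed.

Lemma walk_up i j k s t : i < I -> j + k < J ->
  (forall b, j <= b <= j + k -> P (i, b, s, t)) ->
  linked I J zm P (i, j, s, t) (i, j + k, s, t).
Proof.
elim: k => [|k IH] iI kJ Pb.
  by rewrite addn0; apply: linked_refl; [rewrite /valid /=; lia|apply: Pb; lia].
apply: linked_step (IH iI _ _) _ _; first lia.
- by move=> a ai; apply: Pb; lia.
- by left; rewrite addnS; apply: stp_up; lia.
by apply: Pb; lia.
Qed.

Lemma walk_sheet i j i' j' s t : i < I -> j < J -> i' < I -> j' < J ->
  (forall a b, minn i i' <= a <= maxn i i' -> minn j j' <= b <= maxn j j' ->
     P (a, b, s, t)) ->
  linked I J zm P (i, j, s, t) (i', j', s, t).
Proof.
move=> iI jJ iI' jJ' Pab.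
have row a a' : a <= a' -> minn i i' <= a -> a' <= maxn i i' -> a' < I ->
    linked I J zm P (a, j, s, t) (a', j, s, t).
  move=> le ha ha' aI; have := @walk_right a (a' - a) j s t.
  by rewrite subnKC //; apply=> // b bi; apply: Pab; lia.
have col b b' : b <= b' -> minn j j' <= b -> b' <= maxn j j' -> b' < J ->
    linked I J zm P (i', b, s, t) (i', b', s, t).
  move=> le hb hb' bJ; have := @walk_up i' b (b' - b) s t.
  by rewrite subnKC //; apply=> // a ai; apply: Pab; lia.
have I0 : 0 < I by lia. have J0 : 0 < J by lia.
apply: (linked_trans (T' := (i', j, s, t))).
  by have [le|le] := leqP i i'; [|apply: linked_sym => //]; apply: row; lia.
by have [le|le] := leqP j j'; [|apply: linked_sym => //]; apply: col; lia.
Qed.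

End Walks.

Section Discretization.
Local Open Scope ring_scope.
Local Open Scope classical_set_scope.
Variables (K : realType) (g : nat).

Notation PX := (@PX K g).
Notation PY := (@PY K g).
Notation Ig N := (2 * (3 * g + 1) * N)%N.
Notation Jg N := ((3 * g + 1) * N)%N.

(** The grid of mesh 1 / N over the rectangle, whose unit cells are the coarse
    cells of width N. *)
Definition gridlink (N : nat) : (face -> Prop) -> face -> face -> Prop :=
  linked (Ig N) (Jg N) (fun i => hole_cell g (i %/ N)).

(** The minimum sends the right end of the interval to the last cell. *)
Definition snap1 (n : nat) (x : K) : nat := minn (Num.truncn x) n.-1.

Definition snap (N : nat) (p : Defs.space K) : face :=
  (snap1 (Ig N) (N%:R * PX p), snap1 (Jg N) (N%:R * PY p), 0 <= p.1.2, 0 <= p.2).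

Definition sign_ok (N : nat) (s : bool) (u : K) : bool :=
  if s then - N%:R^-1 <= u else u <= N%:R^-1.

(** The faces that a walk following a path may use while the path is at p: those
    within 3 mesh sizes, on a sheet from which p is separated by at most 1 / N. *)
Definition nearby (N : nat) (p : Defs.space K) (T : face) : Prop :=
  let: (i, j, s, t) := T in
  [/\ `|i%:R - N%:R * PX p| <= 3, `|j%:R - N%:R * PY p| <= 3,
      sign_ok N s p.1.2 & sign_ok N t p.2].

Lemma snap1_ok n (x : K) : (0 < n)%N -> 0 <= x <= n%:R ->
  (snap1 n x < n)%N /\ `|(snap1 n x)%:R - x| <= 1.
Proof.
move=> n0 /andP[x0 xn]; rewrite /snap1; split; first lia.
have /andP[t1 t2] := truncn_itv x0; rewrite ler_norml.
have [le|le] := leqP (Num.truncn x) n.-1.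
  by rewrite -natr1 in t2; apply/andP; split; lra.
have E : n%:R = n.-1%:R + 1 :> K by rewrite natr1 prednK.
have : n%:R <= (Num.truncn x)%:R :> K by rewrite ler_nat; lia.
move=> h; apply/andP; split; lra.
Qed.

Variables (N : nat) (N0 : (0 < N)%N).

Lemma NK0 : 0 < N%:R :> K. Proof. by rewrite ltr0n. Qed.

Lemma Ig0 : (0 < Ig N)%N. Proof. by rewrite !muln_gt0 addn1 N0. Qed.
Lemma Jg0 : (0 < Jg N)%N. Proof. by rewrite !muln_gt0 addn1 N0. Qed.

Lemma scaledX p : surface g p -> 0 <= N%:R * PX p <= (Ig N)%:R.
Proof.
move=> /PX_itv/andP[h1 h2]; have n0 := NK0; apply/andP; split.
  by rewrite mulr_ge0 // ltW.
by rewrite natrM mulrC ler_pM2r // mul2n -addnn natrD.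
Qed.

Lemma scaledY p : surface g p -> 0 <= N%:R * PY p <= (Jg N)%:R.
Proof.
move=> /PY_itv/andP[h1 h2]; have n0 := NK0; apply/andP; split.
  by rewrite mulr_ge0 // ltW.
by rewrite natrM mulrC ler_pM2r.
Qed.

Lemma snap_coord p : surface g p ->
  [/\ (snap1 (Ig N) (N%:R * PX p) < Ig N)%N, (snap1 (Jg N) (N%:R * PY p) < Jg N)%N,
      `|(snap1 (Ig N) (N%:R * PX p))%:R - N%:R * PX p| <= 1 &
      `|(snap1 (Jg N) (N%:R * PY p))%:R - N%:R * PY p| <= 1].
Proof.
move=> Sp; have [a b] := snap1_ok Ig0 (scaledX Sp).
by have [c d] := snap1_ok Jg0 (scaledY Sp).
Qed.

Lemma snap_valid p : surface g p -> valid (Ig N) (Jg N) (snap N p).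
Proof. by move=> /snap_coord[a b _ _]; rewrite /valid /= a b. Qed.

Lemma sign_ok_refl u : sign_ok N (0 <= u) u.
Proof.
have n0 := NK0; have i0 : 0 < N%:R^-1 :> K by rewrite invr_gt0.
rewrite /sign_ok; case: leP => h; lra.
Qed.

Lemma nearby_snap p : surface g p -> nearby N p (snap N p).
Proof.
move=> /snap_coord[_ _ h1 h2]; split; rewrite ?sign_ok_refl //.
  by apply: le_trans h1 _; lra.
by apply: le_trans h2 _; lra.
Qed.

Lemma cell_face c (p : Defs.space K) : surface g p -> (c < 2 * (3 * g + 1))%N ->
  c%:R <= PX p <= c.+1%:R ->
  exists i : nat, [/\ (i < Ig N)%N, (i %/ N)%N = c & `|i%:R - N%:R * PX p| <= 1].
Proof.
move=> Sp cW /andP[c1 c2]; have n0 := NK0.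
have /andP[x0 xI] := scaledX Sp; have /andP[t1 t2] := truncn_itv x0.
have h1 : (c * N)%:R <= N%:R * PX p by rewrite natrM mulrC ler_pM2l.
have h2 : N%:R * PX p <= (c.+1 * N)%:R by rewrite natrM mulrC ler_pM2r // ; lra.
have h3 : (c * N <= Num.truncn (N%:R * PX p))%N by rewrite truncn_ge_nat.
have cI : (c.+1 * N <= Ig N)%N by rewrite leq_mul2r cW orbT.
have [h4|h4] := ltnP (Num.truncn (N%:R * PX p)) (c.+1 * N).
  exists (Num.truncn (N%:R * PX p)); split; first lia.
    exact: divn_cell.
  rewrite -natr1 in t2; rewrite ler_norml; apply/andP; split; lra.
have {}h4 : (c.+1 * N)%:R <= N%:R * PX p by rewrite -truncn_ge_nat.
have c0 : (0 < c.+1 * N)%N by rewrite muln_gt0.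
exists (c.+1 * N).-1; split; first lia.
  by apply: divn_cell => //; [rewrite mulSn; lia|rewrite prednK].
have E : (c.+1 * N)%:R = (c.+1 * N).-1%:R + 1 :> K by rewrite natr1 prednK // muln_gt0.
rewrite ler_norml; apply/andP; split; lra.
Qed.

Lemma y0_face w : surface g w -> w.1.2 = 0 -> exists i j : nat,
  [/\ (i < Ig N)%N, (j < Jg N)%N, `|i%:R - N%:R * PX w| <= 1,
      `|j%:R - N%:R * PY w| <= 1 &
      forall s t, stp (Ig N) (Jg N) (fun i => hole_cell g (i %/ N))
                    (i, j, s, t) (i, j, ~~ s, t)].
Proof.
move=> Sw w0; have [Y0 [c [cW hc cX]]] := y0_mirror Sw w0.
have [i [iI ic iX]] := cell_face Sw cW cX.
exists i, 0%N; rewrite Y0 mulr0 subrr normr0 ler01; split=> //; first exact: Jg0.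
by move=> s t; apply: stp_bottom_y => //; rewrite ic.
Qed.

Lemma z0_face w : surface g w -> w.2 = 0 -> exists i j : nat,
  [/\ (i < Ig N)%N, (j < Jg N)%N, `|i%:R - N%:R * PX w| <= 1,
      `|j%:R - N%:R * PY w| <= 1 &
      forall s t, stp (Ig N) (Jg N) (fun i => hole_cell g (i %/ N))
                    (i, j, s, t) (i, j, s, ~~ t)].
Proof.
move=> Sw w0; have [aI aJ aX aY] := snap_coord Sw.
have I0 := Ig0; have J0 := Jg0.
have last1 (n : nat) : (0 < n)%N -> `|n.-1%:R - n%:R| <= 1 :> K.
  move=> n0; have -> : n%:R = n.-1%:R + 1 :> K by rewrite natr1 prednK.
  by rewrite opprD addrA subrr add0r normrN normr1.
case: (z0_mirror Sw w0) => [[Y0 [c [cW hc cX]]]|X0|X1|Y1].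
- have [i [iI ic iX]] := cell_face Sw cW cX.
  exists i, 0%N; rewrite Y0 mulr0 subrr normr0 ler01; split=> //.
  by move=> s t; apply: stp_bottom_z => //; rewrite ic.
- exists 0%N, (snap1 (Jg N) (N%:R * PY w)).
  rewrite X0 mulr0 subrr normr0 ler01; split=> //.
  by move=> s t; apply: stp_left.
- exists (Ig N).-1, (snap1 (Jg N) (N%:R * PY w)).
  have -> : N%:R * PX w = (Ig N)%:R.
    by rewrite X1 natrM mul2n -addnn (natrD K (3 * g + 1)%N (3 * g + 1)%N) mulrC.
  split=> //; [lia|exact: last1|by move=> s t; apply: stp_rightmost].
- exists (snap1 (Ig N) (N%:R * PX w)), (Jg N).-1.
  have -> : N%:R * PY w = (Jg N)%:R by rewrite Y1 natrM mulrC.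
  split=> //; [lia|exact: last1|by move=> s t; apply: stp_top].
Qed.

Lemma walk_nearby p i j i' j' s t :
  nearby N p (i, j, s, t) -> nearby N p (i', j', s, t) ->
  (i < Ig N)%N -> (j < Jg N)%N -> (i' < Ig N)%N -> (j' < Jg N)%N ->
  gridlink N (nearby N p) (i, j, s, t) (i', j', s, t).
Proof.
have between (a b c : nat) (x : K) : (minn a b <= c <= maxn a b)%N ->
    `|a%:R - x| <= 3 -> `|b%:R - x| <= 3 -> `|c%:R - x| <= 3.
  rewrite !ler_norml => /andP[h1 h2] /andP[a1 a2] /andP[b1 b2].
  have [|] := leqP a b => ab.
    have : a%:R <= c%:R :> K by rewrite ler_nat; lia.
    have : c%:R <= b%:R :> K by rewrite ler_nat; lia.
    by move=> *; apply/andP; split; lra.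
  have : b%:R <= c%:R :> K by rewrite ler_nat; lia.
  have : c%:R <= a%:R :> K by rewrite ler_nat; lia.
  by move=> *; apply/andP; split; lra.
move=> [x1 y1 sy sz] [x2 y2 _ _] iI jJ iI' jJ'; apply: walk_sheet => // a b ha hb.
split=> //; [exact: between ha x1 x2|exact: between hb y1 y2].
Qed.

Definition close (p q : Defs.space K) : Prop :=
  [/\ `|N%:R * PX q - N%:R * PX p| < 1, `|N%:R * PY q - N%:R * PY p| < 1,
      `|q.1.2 - p.1.2| < N%:R^-1 & `|q.2 - p.2| < N%:R^-1].

Lemma sign_ok_close u v : `|v - u| < N%:R^-1 -> sign_ok N (0 <= v) u.
Proof.
by rewrite ltr_norml /sign_ok => /andP[h1 h2]; case: leP => h; lra.
Qed.

(** A walk between the faces of two close points: along the bottom side or another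
    boundary edge when a sign changes, where a point of the surface with vanishing
    coordinate supplies the place to change the sheet, and otherwise within one
    sheet. *)
Lemma local_link p q : surface g p -> surface g q -> close p q ->
  ((0 <= p.1.2) != (0 <= q.1.2) -> exists w, [/\ surface g w, close p w & w.1.2 = 0]) ->
  ((0 <= p.2) != (0 <= q.2) -> exists w, [/\ surface g w, close p w & w.2 = 0]) ->
  gridlink N (nearby N p) (snap N p) (snap N q).
Proof.
move=> Sp Sq [cX cY cy cz] hy hz.
have I0 := Ig0; have J0 := Jg0.
have sy : sign_ok N (0 <= q.1.2) p.1.2 by exact: sign_ok_close.
have sz : sign_ok N (0 <= q.2) p.2 by exact: sign_ok_close.
have sy0 := sign_ok_refl p.1.2; have sz0 := sign_ok_refl p.2.
have tr (a : nat) (x y : K) : `|a%:R - y| <= 1 -> `|y - x| < 1 -> `|a%:R - x| <= 3.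
  by rewrite !ler_norml ltr_norml => /andP[? ?] /andP[? ?]; apply/andP; split; lra.
have [aI aJ aX aY] := snap_coord Sq.
have [bI bJ bX bY] := snap_coord Sp.
have weak (x : K) : `|x| <= 1 -> `|x| <= 3 by move=> h; apply: le_trans h _; lra.
rewrite /snap.
move: (snap1 _ _) aI aX (snap1 _ _) aJ aY (snap1 _ _) bI bX (snap1 _ _) bJ bY.
move=> a aI aX a' aJ aY b bI bX b' bJ bY.
move: bX bY => /weak bX /weak bY.
have {}aX := tr _ _ _ aX cX; have {}aY := tr _ _ _ aY cY.
have step1 : exists i j, [/\ (i < Ig N)%N, (j < Jg N)%N,
    nearby N p (i, j, 0 <= q.1.2, 0 <= p.2) &
    gridlink N (nearby N p) (b, b', 0 <= p.1.2, 0 <= p.2) (i, j, 0 <= q.1.2, 0 <= p.2)].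
  move: hy; case: eqVneq => [-> _|ne /(_ isT)[w [Sw [wX wY _ _] w0]]].
    by exists b, b'; split=> //; apply: walk_nearby.
  have [i [j [iI jJ iX jY st]]] := y0_face Sw w0.
  have {}iX := tr _ _ _ iX wX; have {}jY := tr _ _ _ jY wY.
  exists i, j; split=> //.
  have E : (0 <= q.1.2) = ~~ (0 <= p.1.2) by move: ne; case: (0 <= p.1.2); case: (0 <= q.1.2).
  apply: (linked_step (T' := (i, j, 0 <= p.1.2, 0 <= p.2))) => //.
    exact: walk_nearby.
  by left; rewrite E; exact: st.
have step2 : exists i j, [/\ (i < Ig N)%N, (j < Jg N)%N,
    nearby N p (i, j, 0 <= q.1.2, 0 <= q.2) &
    gridlink N (nearby N p) (b, b', 0 <= p.1.2, 0 <= p.2) (i, j, 0 <= q.1.2, 0 <= q.2)].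
  have [i [j [iI jJ nij lij]]] := step1.
  move: hz; case: eqVneq => [E _|ne /(_ isT)[w [Sw [wX wY _ _] w0]]].
    by exists i, j; rewrite -E.
  have [i' [j' [iI' jJ' iX jY st]]] := z0_face Sw w0.
  have {}iX := tr _ _ _ iX wX; have {}jY := tr _ _ _ jY wY.
  exists i', j'; split=> //.
  have E : (0 <= q.2) = ~~ (0 <= p.2) by move: ne; case: (0 <= p.2); case: (0 <= q.2).
  apply: (linked_step (T' := (i', j', 0 <= q.1.2, 0 <= p.2))) => //.
    by apply: linked_trans lij _ => //; apply: walk_nearby.
  by left; rewrite E; exact: st.
have [i [j [iI jJ nij lij]]] := step2.
by apply: linked_trans lij _ => //; apply: walk_nearby.
Qed.

End Discretization.

(** * Paths as walks of faces *)

Section Paths.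
Local Open Scope ring_scope.
Local Open Scope classical_set_scope.
Variables (K : realType) (g : nat).

Notation PX := (@PX K g).
Notation PY := (@PY K g).

Definition is_path (c : K -> Defs.space K) : Prop :=
  {within `[0, 1], continuous c} /\ forall t : K, t \in `[0, 1]%R -> surface g (c t).

Definition trace (N : nat) (c : K -> Defs.space K) (T : face) : Prop :=
  exists2 t : K, t \in `[0, 1]%R & nearby g N (c t) T.

Lemma path_cvg (T : topologicalType) (f : Defs.space K -> T) c (t : K) :
  continuous f -> is_path c -> t \in `[0, 1]%R ->
  f (c u) @[u --> within `[0, 1]%classic (nbhs t)] --> f (c t).
Proof.
move=> cf [/subspace_continuousP cc _] t01.
by apply: cvg_comp; last exact: (cf (c t)); exact: (cc t t01).
Qed.

Lemma path_near (f : Defs.space K -> K) c (e t : K) : continuous f -> is_path c -> 0 < e ->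
  t \in `[0, 1]%R ->
  exists2 d : K, 0 < d & forall u, u \in `[0, 1]%R -> `|t - u| < d -> `|f (c u) - f (c t)| < e.
Proof.
move=> cf pc e0 t01; have := path_cvg cf pc t01 => /cvgr_dist_lt /(_ e e0).
rewrite near_withinE => /nbhs_ballP[d /= d0 h]; exists d => // u u01 tu.
by rewrite distrC; apply: h.
Qed.

Lemma path_zero (f : Defs.space K -> K) c (t u : K) : continuous f -> is_path c ->
  t \in `[0, 1]%R -> u \in `[0, 1]%R -> (0 <= f (c t)) != (0 <= f (c u)) ->
  exists w : K, [/\ w \in `[0, 1]%R, `|t - w| <= `|t - u| & f (c w) = 0].
Proof.
move=> cf pc; suff H (a b : K) : a <= b -> a \in `[0, 1]%R -> b \in `[0, 1]%R ->
    (0 <= f (c a)) != (0 <= f (c b)) -> exists w, a <= w <= b /\ f (c w) = 0.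
  move=> t01 u01 ne; have [tu|ut] := leP t u.
    have [w [/andP[w1 w2] w0]] := H t u tu t01 u01 ne.
    exists w; split=> //; first by move: t01 u01; rewrite !in_itv /=; lra.
    by rewrite !ler0_norm; lra.
  rewrite eq_sym in ne; have [w [/andP[w1 w2] w0]] := H u t (ltW ut) u01 t01 ne.
  exists w; split=> //; first by move: t01 u01; rewrite !in_itv /=; lra.
  by rewrite !ger0_norm; lra.
move=> ab a01 b01 ne.
have cw : {within `[a, b], continuous (f \o c)}.
  have c01 : {within `[0, 1], continuous (f \o c)}.
    by apply/subspace_continuousP => x x01; exact: (path_cvg cf pc x01).
  apply: continuous_subspaceW c01.
  by move=> x /=; move: a01 b01; rewrite !in_itv /=; lra.
have [|w w01 w0] := @IVT K (f \o c) a b 0 ab cw.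
  rewrite ge_min le_max /=.
  move: ne; case: (leP 0 (f (c a))) => ha; case: (leP 0 (f (c b))) => hb //= _.
    by rewrite (ltW hb) orbT.
  by rewrite (ltW ha).
by exists w; split=> //; move: w01; rewrite in_itv.
Qed.

Variables (N : nat) (N0 : (0 < N)%N).

(** When a sign changes between two close parameters, the intermediate value
    theorem gives a point in between at which the walk can change the sheet. *)
Lemma path_local c (t : K) : is_path c -> t \in `[0, 1]%R ->
  exists2 d : K, 0 < d & forall u, u \in `[0, 1]%R -> `|t - u| < d ->
    gridlink g N (trace N c) (snap g N (c t)) (snap g N (c u)).
Proof.
move=> pc t01; have n0 : 0 < N%:R :> K by rewrite ltr0n.
have i0 : 0 < N%:R^-1 :> K by rewrite invr_gt0.
have [d1 d10 h1] := path_near (@cont_PX K g) pc i0 t01.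
have [d2 d20 h2] := path_near (@cont_PY K g) pc i0 t01.
have [d3 d30 h3] := path_near (@cont_y K) pc i0 t01.
have [d4 d40 h4] := path_near (@cont_z K) pc i0 t01.
pose d := Num.min (Num.min d1 d2) (Num.min d3 d4).
have cl u : u \in `[0, 1]%R -> `|t - u| < d -> close g N (c t) (c u).
  move=> u01; rewrite !lt_min => /andP[/andP[u1 u2] /andP[u3 u4]]; split.
  - by rewrite -mulrBr normrM gtr0_norm // mulrC -ltr_pdivlMr // mul1r h1.
  - by rewrite -mulrBr normrM gtr0_norm // mulrC -ltr_pdivlMr // mul1r h2.
  - exact: h3.
  - exact: h4.
exists d; first by rewrite !lt_min d10 d20 d30.
move=> u u01 tu; have [_ Sc] := pc.
have I0 := Ig0 g N0; have J0 := Jg0 g N0; rewrite /gridlink.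
refine (@linked_sub _ _ _ I0 J0 (nearby g N (c t)) _ _ _ _ _); first by move=> f _ nf; exists t.
apply: local_link => //; [exact: Sc|exact: Sc|exact: cl| |].
  move=> ne; have [w [w01 wt w0]] := path_zero (@cont_y K) pc t01 u01 ne.
  by exists (c w); split=> //; [exact: Sc|apply: cl => //; exact: le_lt_trans tu].
move=> ne; have [w [w01 wt w0]] := path_zero (@cont_z K) pc t01 u01 ne.
by exists (c w); split=> //; [exact: Sc|apply: cl => //; exact: le_lt_trans tu].
Qed.

(** The parameters whose faces are linked to the first one form an open and closed
    subset of the interval. *)
Lemma path_linked c : is_path c -> gridlink g N (trace N c) (snap g N (c 0)) (snap g N (c 1)).
Proof.
move=> pc; have [_ Sc] := pc.
have I0 := Ig0 g N0; have J0 := Jg0 g N0.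
pose A := `[0, 1]%classic : set K.
pose B := [set t : K | t \in `[0, 1]%R /\ gridlink g N (trace N c) (snap g N (c 0)) (snap g N (c t))].
have a0 : (0 : K) \in `[0, 1]%R by rewrite in_itv /= lexx ler01.
have a1 : (1 : K) \in `[0, 1]%R by rewrite in_itv /= lexx ler01.
suff BA : B = A by have : B 1 by [rewrite BA]; case.
have cA : connected A by apply/connected_intervalP; exact: interval_is_interval.
pose U (D : set K) : set K := \bigcup_(x in [set x : K * K | D x.1 /\ 0 < x.2 /\
   forall u, u \in `[0, 1]%R -> `|x.1 - u| < x.2 ->
    gridlink g N (trace N c) (snap g N (c x.1)) (snap g N (c u))]) ball x.1 x.2.
have Uo D : open (U D) by apply: bigcup_open => x _; exact: ball_open.
have UD (D : set K) t : A t -> D t -> U D t.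
  move=> At Dt; have [d d0 h] := path_local pc At.
  by exists (t, d) => //=; exact: ballxx.
apply: cA.
- exists 0; split=> //; apply: linked_refl; first by apply: snap_valid => //; exact: Sc.
  by exists 0 => //; apply: nearby_snap => //; exact: Sc.
- exists (U B) => //; apply/seteqP; split=> t.
    by move=> Bt; split; [case: Bt|apply: UD => //; case: Bt].
  move=> [At [[x d] /= [[x01 lx] [d0 h]] xt]]; split=> //.
  by apply: linked_trans lx _ => //; exact: h.
exists (~` (U (A `\` B))); first by rewrite closedC.
apply/seteqP; split=> t.
  move=> Bt; split; first by case: Bt.
  move=> [[x d] /= [[x01 nx] [d0 h]] xt]; apply: nx; split=> //.
  have [t01 lt] := Bt; apply: linked_trans lt _ => //; apply: linked_sym => //.
  exact: h.
move=> [At nU]; apply: contrapT => nB; apply: nU; exact: UD.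
Qed.

End Paths.

(** * Disjoint paths have disjoint walks *)

Section Separation.
Local Open Scope ring_scope.
Local Open Scope classical_set_scope.
Variables (K : realType) (g : nat).

Notation PX := (@PX K g).
Notation PY := (@PY K g).

(** Positive exactly when u and v have opposite strict signs, in which case it is
    the smaller absolute value: it separates points on different sheets. *)
Definition sgap (u v : K) : K := Num.max (Num.min u (- v)) (Num.min (- u) v).

Definition gap (x : Defs.space K * Defs.space K) : K :=
  Num.max (Num.max `|PX x.1 - PX x.2| `|PY x.1 - PY x.2|)
          (Num.max (sgap x.1.1.2 x.2.1.2) (sgap x.1.2 x.2.2)).

Lemma cont_max (T : topologicalType) (f h : T -> K) : continuous f -> continuous h ->
  continuous (fun x => Num.max (f x) (h x)).
Proof. by move=> cf ch x; apply: (@continuous_max _ _ f h x); [exact: cf|exact: ch]. Qed.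

Lemma cont_min (T : topologicalType) (f h : T -> K) : continuous f -> continuous h ->
  continuous (fun x => Num.min (f x) (h x)).
Proof. by move=> cf ch x; apply: (@continuous_min _ _ f h x); [exact: cf|exact: ch]. Qed.

Lemma cont_gap : continuous gap.
Proof.
have c1 (f : Defs.space K -> K) : continuous f ->
    continuous (fun x : Defs.space K * Defs.space K => f x.1).
  by move=> cf x; apply: cvg_comp; [exact: cvg_fst|exact: cf].
have c2 (f : Defs.space K -> K) : continuous f ->
    continuous (fun x : Defs.space K * Defs.space K => f x.2).
  by move=> cf x; apply: cvg_comp; [exact: cvg_snd|exact: cf].
have cd (f : Defs.space K -> K) : continuous f ->
    continuous (fun x : Defs.space K * Defs.space K => `|f x.1 - f x.2|).
  by move=> cf x; apply: cvg_norm; apply: cvgB; [exact: c1|exact: c2].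
have cs (f : Defs.space K -> K) : continuous f ->
    continuous (fun x : Defs.space K * Defs.space K => sgap (f x.1) (f x.2)).
  move=> cf; apply: cont_max; apply: cont_min.
  - exact: c1.
  - by move=> x; apply: cvgN; exact: c2.
  - by move=> x; apply: cvgN; exact: c1.
  - exact: c2.
apply: cont_max; apply: cont_max; [exact/cd/cont_PX|exact/cd/cont_PY| |].
  exact: (cs _ (@cont_y K)).
exact: (cs _ (@cont_z K)).
Qed.

Lemma gap_gt0 p q : surface g p -> surface g q -> p <> q -> 0 < gap (p, q).
Proof.
move=> Sp Sq pq; rewrite ltNge; apply/negP; rewrite !ge_max !ge_min /=.
rewrite !normr_le0 !subr_eq0 !oppr_le0 => /andP[/andP[/eqP eX /eqP eY] /andP[hy hz]].
by apply: pq; apply: (surface_inj Sp Sq eX eY); lra.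
Qed.

Lemma gap_nearby N p q T : (0 < N)%N -> nearby g N p T -> nearby g N q T ->
  gap (p, q) <= 6 / N%:R.
Proof.
move=> N0; have n0 : 0 < N%:R :> K by rewrite ltr0n.
have i0 : 0 < N%:R^-1 :> K by rewrite invr_gt0.
move: T => [[[i j] s] t] [x1 y1 s1 t1] [x2 y2 s2 t2].
have close3 (a : nat) (x y : K) : `|a%:R - N%:R * x| <= 3 -> `|a%:R - N%:R * y| <= 3 ->
    `|x - y| <= 6 / N%:R.
  move=> h1 h2; rewrite ler_pdivlMr //.
  have -> : `|x - y| * N%:R = `|N%:R * x - N%:R * y|.
    by rewrite -mulrBr normrM (gtr0_norm n0) mulrC.
  by move: h1 h2; rewrite !ler_norml => /andP[? ?] /andP[? ?]; apply/andP; split; lra.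
have signs b u v : sign_ok N b u -> sign_ok N b v -> sgap u v <= 6 / N%:R.
  rewrite /sign_ok /sgap ge_max !ge_min; case: b => h1 h2; apply/andP; split; apply/orP;
    by [left; lra|right; lra].
rewrite /gap ge_max [X in X && _]ge_max [X in _ && X]ge_max.
by rewrite (close3 _ _ _ x1 x2) (close3 _ _ _ y1 y2) (signs _ _ _ s1 s2) (signs _ _ _ t1 t2).
Qed.

(** [gap] is continuous and positive off the diagonal, hence bounded below on a
    product of two disjoint compact curves, while two points with a common nearby
    face have gap at most 6 / N. *)
Lemma paths_apart c c' : is_path g c -> is_path g c' ->
  (forall t u : K, t \in `[0, 1]%R -> u \in `[0, 1]%R -> c t <> c' u) ->
  exists2 N1 : nat, (0 < N1)%N & forall N T, (N1 <= N)%N ->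
    trace g N c T -> trace g N c' T -> False.
Proof.
move=> [cc Sc] [cc' Sc'] dis.
have a0 : (0 : K) \in `[0, 1]%R by rewrite in_itv /= lexx ler01.
pose A := (c @` `[0, 1]) `*` (c' @` `[0, 1]).
have cA : compact A by apply: compact_setX; apply: continuous_compact => //; exact: segment_compact.
have nA : A !=set0 by exists (c 0, c' 0); split; exists 0.
have cg : {within A, continuous gap} by apply: continuous_subspaceT; exact: cont_gap.
have [[p q]] := compact_EVT_min nA cA cg.
rewrite inE => -[/= [t t01 ct] [u u01 cu]] minA.
have m0 : 0 < gap (p, q).
  by rewrite -ct -cu; apply: gap_gt0; [exact: Sc|exact: Sc'|exact: dis].
exists (Num.truncn (6 / gap (p, q))).+1 => // N T hN [t' t01' n1] [u' u01' n2].
have N0 : (0 < N)%N by exact: leq_trans hN.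
have n0 : 0 < N%:R :> K by rewrite ltr0n.
have := gap_nearby N0 n1 n2; apply/negP; rewrite -ltNge.
have : gap (p, q) <= gap (c t', c' u').
  by apply: minA; rewrite inE; split; [exists t'|exists u'].
apply: lt_le_trans; rewrite ltr_pdivrMr // mulrC -ltr_pdivrMr //.
by apply: lt_le_trans (truncnS_gt _) _; rewrite ler_nat.
Qed.

End Separation.

(** * Many triods on two common feet *)

Section NoDrawing.
Local Open Scope ring_scope.
Local Open Scope classical_set_scope.
Variables (K : realType) (g : nat).

Notation PX := (@PX K g).
Notation PY := (@PY K g).
Notation Ig N := (2 * (3 * g + 1) * N)%N.
Notation Jg N := ((3 * g + 1) * N)%N.

Lemma snap1_div n k (x : K) : (0 < n)%N -> (0 < k)%N -> 0 <= x <= n%:R ->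
  (snap1 (n * k) (k%:R * x) %/ k)%N = snap1 n x.
Proof.
move=> n0 k0 /andP[x0 xn]; rewrite /snap1.
have kx0 : 0 <= k%:R * x by rewrite mulr_ge0.
have k0' : 0 < k%:R :> K by rewrite ltr0n.
have nk0 : (0 < n * k)%N by rewrite muln_gt0 n0.
have /andP[t1 t2] := truncn_itv x0.
have h1 : (minn (Num.truncn x) n.-1 * k <= Num.truncn (k%:R * x))%N.
  rewrite truncn_ge_nat // natrM mulrC ler_pM2l //; apply: le_trans t1; rewrite ler_nat; lia.
have h2 : (minn (Num.truncn x) n.-1 * k <= (n * k).-1)%N.
  by rewrite -ltnS prednK // ltn_mul2r k0 /=; lia.
apply: divn_cell => //; first by rewrite leq_min h1.
rewrite gtn_min; have [le|le] := leqP (Num.truncn x) n.-1; apply/orP; [left|right].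
  rewrite truncn_lt_nat // natrM mulrC ltr_pM2r //.
by rewrite (prednK n0) (prednK nk0).
Qed.

Definition block (k : nat) (T0 T : face) : Prop :=
  let: (i, j, s, t) := T in let: (i0, j0, s0, t0) := T0 in
  [/\ (i %/ k = i0)%N, (j %/ k = j0)%N, s = s0 & t = t0].

Lemma block_nearby N0 k (p : Defs.space K) (T0 T : face) : (0 < N0)%N -> (1 < k)%N -> block k T0 T ->
  nearby g (N0 * k) p T -> nearby g N0 p T0.
Proof.
move=> N00 k1; move: T T0 => [[[i j] s] t] [[[i0 j0] s0] t0] [hi hj -> ->] [x y sy sz].
have k0 : (0 < k)%N by lia.
have k2 : 2 <= k%:R :> K by rewrite ler_nat.
have n0 : 0 < N0%:R :> K by rewrite ltr0n.
have coord (a b : nat) (z : K) : (a %/ k = b)%N -> `|a%:R - (N0 * k)%:R * z| <= 3 ->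
    `|b%:R - N0%:R * z| <= 3.
  move=> ab; have h1 : (b * k <= a)%N by rewrite -ab leq_trunc_div.
  have h2 : (a < b.+1 * k)%N by rewrite -ltn_divLR // ab.
  move: h1 h2; rewrite -(ler_nat K) -(ltr_nat K) !natrM -natr1 !ler_norml.
  rewrite (mulrAC _ k%:R z); move: (N0%:R * z) (b%:R : K) (a%:R : K) => Z B A.
  by move=> h1 h2 /andP[h3 h4]; apply/andP; split; nra.
have ni : (N0 * k)%:R^-1 <= N0%:R^-1 :> K.
  by rewrite lef_pV2 ?posrE ?ltr0n ?muln_gt0 ?N00 // ler_nat leq_pmulr.
have sg (b : bool) (u : K) : sign_ok (N0 * k) b u -> sign_ok N0 b u.
  by rewrite /sign_ok; case: b => h; lra.
by split; [exact: coord x|exact: coord y|exact: sg|exact: sg].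
Qed.

Lemma snap_block N0 k (p : Defs.space K) : (0 < N0)%N -> (0 < k)%N -> surface g p ->
  block k (snap g N0 p) (snap g (N0 * k) p).
Proof.
move=> N00 k0 Sp; rewrite /block /snap; split=> //.
  rewrite !mulnA natrM mulrAC mulrC; apply: snap1_div => //; first exact: Ig0.
  exact: scaledX.
rewrite !mulnA natrM mulrAC mulrC; apply: snap1_div => //; first exact: Jg0.
exact: scaledY.
Qed.

(** The third feet c_i need only lie in a common face T0 of some grid that the
    other legs avoid: over any refinement the third legs are prolonged inside T0 to
    a common last face, which makes them end at one foot as in
    [no_grid_drawing]. *)
Theorem no_drawing n (a b : Defs.space K) (v c : 'I_n -> Defs.space K)
    (e f h : 'I_n -> K -> Defs.space K) N0 T0 :
  (2 * 2 ^ (2 * (3 * g + 1) * 4) < n)%N -> (0 < N0)%N ->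
  (forall i, [/\ is_path g (e i), e i 0 = v i & e i 1 = a]) ->
  (forall i, [/\ is_path g (f i), f i 0 = v i & f i 1 = b]) ->
  (forall i, [/\ is_path g (h i), h i 0 = v i & h i 1 = c i]) ->
  (forall i, snap g N0 (c i) = T0) ->
  (forall i, ~ trace g N0 (e i) T0) -> (forall i, ~ trace g N0 (f i) T0) ->
  (forall i j (t u : K), i != j -> t \in `[0, 1]%R -> u \in `[0, 1]%R -> e i t <> f j u) ->
  (forall i j (t u : K), i != j -> t \in `[0, 1]%R -> u \in `[0, 1]%R -> e i t <> h j u) ->
  (forall i j (t u : K), i != j -> t \in `[0, 1]%R -> u \in `[0, 1]%R -> f i t <> h j u) ->
  False.
Proof.
move=> nbig N00 eP fP hP cT eT fT EF EH FH.
have apart (p q : 'I_n -> K -> Defs.space K) : (forall i, is_path g (p i)) ->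
    (forall i, is_path g (q i)) ->
    (forall i j (t u : K), i != j -> t \in `[0, 1]%R -> u \in `[0, 1]%R -> p i t <> q j u) ->
    exists N1, forall N i j T, (N1 <= N)%N -> i != j ->
      trace g N (p i) T -> trace g N (q j) T -> False.
  move=> pp pq dis.
  have ex (x : 'I_n * 'I_n) : exists N1, x.1 != x.2 -> forall N T, (N1 <= N)%N ->
      trace g N (p x.1) T -> trace g N (q x.2) T -> False.
    have [eq|ne] := eqVneq x.1 x.2; first by exists 0%N.
    have [|N1 _ H] := @paths_apart K g (p x.1) (q x.2) (pp _) (pq _).
      by move=> t u; exact: dis.
    by exists N1 => _; exact: H.
  have [N1 hN1] := choice ex.
  exists (\max_x N1 x)%N => N i j T le ij; apply: (hN1 (i, j) ij).
  by apply: leq_trans le; exact: leq_bigmax.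
have pe i : is_path g (e i) by case: (eP i).
have pf i : is_path g (f i) by case: (fP i).
have ph i : is_path g (h i) by case: (hP i).
have [N1 H1] := apart _ _ pe pf EF.
have [N2 H2] := apart _ _ pe ph EH.
have [N3 H3] := apart _ _ pf ph FH.
pose k := (N1 + N2 + N3 + 2)%N; pose N := (N0 * k)%N.
have k1 : (1 < k)%N by rewrite /k; lia.
have kN : (k <= N)%N by rewrite /N leq_pmull.
have Npos : (0 < N)%N by lia.
have I0 := Ig0 g Npos; have J0 := Jg0 g Npos.
have i0 : 'I_n by apply: (Ordinal (_ : 0 < n)%N); lia.
have a1 : (1 : K) \in `[0, 1]%R by rewrite in_itv /= lexx ler01.
have Sc i : surface g (c i) by case: (hP i) => -[_ S] _ <-; exact: S.
move: T0 cT eT fT => [[[x0 y0] s0] t0] cT eT fT.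
pose T0 : face := (x0, y0, s0, t0).
have sb i : block k T0 (snap g N (c i)).
  by rewrite /T0 -(cT i); apply: snap_block => //; lia.
(* the corner face of T0, at which all prolonged legs end *)
pose Tc : face := (x0 * k, y0 * k, s0, t0)%N.
have vT0 : valid (Ig N0) (Jg N0) T0 by rewrite /T0 -(cT i0); exact: snap_valid.
have toTc i : gridlink g N (block k T0) (snap g N (c i)) Tc.
  have := sb i; have := snap_valid Npos (Sc i).
  case: (snap g N (c i)) => [[[i1 j1] s] t] /andP[/= iI jJ] [hi hj -> ->].
  move: vT0 => /andP[/= x0I y0J].
  have xk : (x0 * k < Ig N)%N by rewrite /N mulnA ltn_mul2r x0I andbT; lia.
  have yk : (y0 * k < Jg N)%N by rewrite /N mulnA ltn_mul2r y0J andbT; lia.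
  apply: walk_sheet => // p q hp hq; split=> //.
    apply: divn_cell; [lia| |].
      by have := leq_trunc_div i1 k; rewrite hi; lia.
    have : (i1 < x0.+1 * k)%N by rewrite -ltn_divLR ?hi //; lia.
    have : (x0 * k < x0.+1 * k)%N by rewrite ltn_mul2r; lia.
    lia.
  apply: divn_cell; [lia| |].
    by have := leq_trunc_div j1 k; rewrite hj; lia.
  have : (j1 < y0.+1 * k)%N by rewrite -ltn_divLR ?hj //; lia.
  have : (y0 * k < y0.+1 * k)%N by rewrite ltn_mul2r; lia.
  lia.
have tb (p : K -> Defs.space K) T : ~ trace g N0 p T0 -> trace g N p T -> block k T0 T -> False.
  by move=> nT [t t01 nt] bT; apply: nT; exists t => //; exact: block_nearby bT nt.
apply: (@no_grid_drawing _ _ (fun i => hole_cell g (i %/ N)) I0 J0 (2 * (3 * g + 1)) N (hole_cell g)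
   Npos _ _ n (snap g N a) (snap g N b) Tc (fun i => snap g N (v i))
   (fun i => trace g N (e i)) (fun i => trace g N (f i))
   (fun i T => trace g N (h i) T \/ block k T0 T)) => //.
- by move=> i; have [pi <- <-] := eP i; exact: path_linked.
- by move=> i; have [pi <- <-] := fP i; exact: path_linked.
- move=> i; have [pi <- hi] := hP i.
  apply: (linked_trans (T' := snap g N (h i 1))).
    apply: linked_sub (path_linked Npos pi) => //.
    by move=> T _ tT; left.
  by rewrite hi; apply: linked_sub (toTc i) => // T _ bT; right.
- by move=> i j T ij _; apply: H1 => //; rewrite /k in kN; lia.
- move=> i j T ij _ tT [tT'|bT]; first by apply: H2 ij tT tT'; rewrite /k in kN; lia.
  exact: tb (eT i) tT bT.
- move=> i j T ij _ tT [tT'|bT]; first by apply: H3 ij tT tT'; rewrite /k in kN; lia.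
  exact: tb (fT i) tT bT.
Qed.

End NoDrawing.

(** * Configurations that no surface carries *)

Section Graphs.
Local Open Scope ring_scope.
Local Open Scope classical_set_scope.

Variables (K : realType) (g : nat) (G : sgraph).

Definition cat_path (p q : K -> Defs.space K) (t : K) : Defs.space K :=
  if t <= 2^-1 then p (2 * t) else q (2 * t - 1).

Lemma reparam (A : set K) (p : K -> Defs.space K) (f : K -> K) :
  continuous f -> (forall x, A x -> f x \in `[0, 1]%R) ->
  {within `[0, 1], continuous p} -> {within A, continuous (fun t => p (f t))}.
Proof.
move=> cf fA /subspace_continuousP cp; apply/subspace_continuousP => x Ax.
apply: (@cvg_comp _ _ _ f p _ (within `[0, 1] (nbhs (f x)))); last exact: cp (fA _ Ax).
move=> U nU; rewrite /within /=; have := cf x _ nU.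
by apply: (@filterS _ (nbhs x)) => y fy Ay; apply: fy; exact: fA.
Qed.

Lemma cat_pathP (p q : K -> Defs.space K) : is_path g p -> is_path g q -> p 1 = q 0 ->
  [/\ is_path g (cat_path p q), cat_path p q 0 = p 0, cat_path p q 1 = q 1 &
   forall t : K, t \in `[0, 1]%R -> exists2 u : K, u \in `[0, 1]%R &
     cat_path p q t = p u \/ cat_path p q t = q u].
Proof.
move=> [pc pS] [qc qS] pq.
have half (t : K) : t \in `[0, 1]%R -> t <= 2^-1 -> 2 * t \in `[0, 1]%R.
  by rewrite !in_itv /= => h1 h2; lra.
have half' (t : K) : t \in `[0, 1]%R -> 2^-1 <= t -> 2 * t - 1 \in `[0, 1]%R.
  by rewrite !in_itv /= => h1 h2; lra.
have img (t : K) : t \in `[0, 1]%R -> exists2 u : K, u \in `[0, 1]%R &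
     cat_path p q t = p u \/ cat_path p q t = q u.
  move=> t01; rewrite /cat_path; case: leP => h.
    by exists (2 * t); [exact: half|left].
  by exists (2 * t - 1); [exact: half' (ltW h)|right].
split=> //.
- split; last by move=> t /img[u u01 [->|->]]; [exact: pS|exact: qS].
  have E : (`[0, 1] : set K) = `[0, 2^-1] `|` `[2^-1, 1].
    rewrite predeqE => t; rewrite /setU /mkset /= !in_itv /=; split=> h.
      by case: (leP t 2^-1) => h'; [left|right]; lra.
    by case: h => h; lra.
  rewrite E; apply: withinU_continuous; [exact: itv_closed|exact: itv_closed| |].
    have c1 : {within `[0, 2^-1], continuous (fun t : K => p (2 * t))}.
      apply: reparam pc; first by move=> x; apply: cvgM; [exact: cvg_cst|exact: cvg_id].
      by move=> x /= x01; apply: half; move: x01; rewrite ?in_itv /=; lra.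
    apply: (@subspace_eq_continuous _ _ _ (fun t : K => p (2 * t)) (cat_path p q) _ c1) => x.
    rewrite inE /= in_itv /= => x01.
    by rewrite /cat_path ifT //; lra.
  have c2 : {within `[2^-1, 1], continuous (fun t : K => q (2 * t - 1))}.
    apply: reparam qc.
      move=> x; apply: cvgB; last exact: cvg_cst.
      by apply: cvgM; [exact: cvg_cst|exact: cvg_id].
    by move=> x /= x01; apply: half'; move: x01; rewrite ?in_itv /=; lra.
  apply: (@subspace_eq_continuous _ _ _ (fun t : K => q (2 * t - 1)) (cat_path p q) _ c2) => x.
  rewrite inE /= in_itv /= => x01.
  rewrite /cat_path; case: leP => // h; have -> : x = 2^-1 by lra.
  have -> : 2 * 2^-1 = 1 :> K by lra. 
  by rewrite pq subrr.
- by rewrite /cat_path ifT ?mulr0 //; lra.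
rewrite /cat_path ifF; last lra. by congr q; lra.
Qed.

Lemma const_path (x : Defs.space K) : surface g x -> is_path g (fun=> x).
Proof. by move=> Sx; split=> //; apply: continuous_subspaceT => y; exact: cvg_cst. Qed.

Variables (pt : G -> Defs.space K) (arc : G -> G -> set (Defs.space K)).
Hypothesis pt_surf : forall u, surface g (pt u).
Hypothesis arcP : forall u v, adj u v ->
  [/\ is_arc (arc u v) (pt u) (pt v), arc u v `<=` surface g & arc u v = arc v u].
Hypothesis arc_vertex : forall u v w, adj u v -> arc u v (pt w) -> w = u \/ w = v.
Hypothesis arc_disj : forall u v x y, adj u v -> adj x y -> [set u; v] <> [set x; y] ->
  arc u v `&` arc x y `<=` pt @` ([set u; v] `&` [set x; y]).

Lemma arc_path u v : adj u v -> exists p : K -> Defs.space K,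
  [/\ is_path g p, p 0 = pt u, p 1 = pt v & forall t : K, t \in `[0, 1]%R -> arc u v (p t)].
Proof.
move=> uv; have [[f [cf _ f0 f1 aE]] aS _] := arcP uv.
have fa (t : K) : t \in `[0, 1]%R -> arc u v (f t) by rewrite aE => t01; exists t.
by exists f; split=> //; split=> // t /fa/aS.
Qed.

Lemma arcs_disjoint u v x y p : adj u v -> adj x y -> u <> x -> u <> y -> v <> x -> v <> y ->
  arc u v p -> arc x y p -> False.
Proof.
move=> uv xy ux uy vx vy ap ap'.
have [] := arc_disj uv xy _ (conj ap ap').
  move=> E; have : [set x; y] u by rewrite -E; left.
  by case.
by move=> w [[->|->] [|]].
Qed.

Lemma edge_paths : exists P : G -> G -> K -> Defs.space K, forall u v, adj u v ->
  [/\ is_path g (P u v), P u v 0 = pt u, P u v 1 = pt v &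
     forall t : K, t \in `[0, 1]%R -> arc u v (P u v t)].
Proof.
have ex (x : G * G) : exists p : K -> Defs.space K, adj x.1 x.2 ->
    [/\ is_path g p, p 0 = pt x.1, p 1 = pt x.2 &
     forall t : K, t \in `[0, 1]%R -> arc x.1 x.2 (p t)].
  have [ad|nad] := pselect (adj x.1 x.2); last by exists (fun=> pt x.1).
  by have [p hp] := arc_path ad; exists p.
have [P hP] := choice ex.
by exists (fun u v => P (u, v)) => u v; exact: (hP (u, v)).
Qed.

Lemma snap_avoids (x : Defs.space K) (p : K -> Defs.space K) : surface g x -> is_path g p ->
  (forall t : K, t \in `[0, 1]%R -> p t <> x) ->
  exists2 N1 : nat, (0 < N1)%N & forall N, (N1 <= N)%N -> ~ trace g N p (snap g N x).
Proof.
move=> Sx pp px; have [|N1 N10 H] := paths_apart pp (const_path Sx).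
  by move=> t u t01 _; exact: px.
exists N1 => // N le tp; apply: (H N _ le tp); exists 0.
  by rewrite in_itv /= lexx ler01.
by apply: nearby_snap => //; exact: leq_trans le.
Qed.

(** A finite number of curves that avoid the point c also avoid the face of c in a
    fine grid, so [no_drawing] applies with all third feet equal. *)
Lemma no_tripods (a b c : G) (v : nat -> G) (h : nat -> K -> Defs.space K)
    (A : nat -> set (Defs.space K)) :
  injective v -> a <> b -> (forall i, v i <> a /\ v i <> b) ->
  (forall i, adj (v i) a /\ adj (v i) b) ->
  (forall i, [/\ is_path g (h i), h i 0 = pt (v i), h i 1 = pt c &
     forall t : K, t \in `[0, 1]%R -> A i (h i t)]) ->
  (forall i j x, i <> j -> arc (v i) a x -> A j x -> False) ->
  (forall i j x, i <> j -> arc (v i) b x -> A j x -> False) -> False.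
Proof.
move=> vi ab vab va hP dA dB.
have [P hPe] := edge_paths.
pose n := (2 * 2 ^ (2 * (3 * g + 1) * 4)).+1.
have a1 : (1 : K) \in `[0, 1]%R by rewrite in_itv /= lexx ler01.
have avoid i : exists N1 : nat, forall N, (N1 <= N)%N ->
   ~ trace g N (P (v i) a) (snap g N (pt c)) /\ ~ trace g N (P (v i) b) (snap g N (pt c)).
  have [ia ib] := va i; have [pa _ _ aa] := hPe _ _ ia; have [pb _ _ bb] := hPe _ _ ib.
  (* c lies on every third leg, so the legs of index i avoid it by disjointness from the leg i + 1 *)
have [_ _ hc Ac] := hP i.+1.
  have [|N1 _ H1] := snap_avoids (pt_surf c) pa.
    move=> t t01 E; apply: (dA i i.+1 (pt c)); [lia|by rewrite -E; exact: aa|].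
    by rewrite -hc; exact: Ac.
  have [|N2 _ H2] := snap_avoids (pt_surf c) pb.
    move=> t t01 E; apply: (dB i i.+1 (pt c)); [lia|by rewrite -E; exact: bb|].
    by rewrite -hc; exact: Ac.
  by exists (N1 + N2)%N => N le; split; [apply: H1|apply: H2]; lia.
have [N1 hN1] := choice avoid.
pose N0 := (\max_(i < n) N1 i).+1.
have av (i : 'I_n) : (N1 i <= N0)%N by apply: leq_trans (leqnSn _); exact: (leq_bigmax i).
apply: (@no_drawing K g n (pt a) (pt b) (fun i => pt (v i)) (fun=> pt c)
   (fun i => P (v i) a) (fun i => P (v i) b) (fun i => h i) N0 (snap g N0 (pt c))) => //.
- by move=> i; have [ia ib] := va i; have [pa p0 p1 _] := hPe _ _ ia.
- by move=> i; have [ia ib] := va i; have [pa p0 p1 _] := hPe _ _ ib.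
- by move=> i; have [pa p0 p1 _] := hP i.
- by move=> i; have [] := hN1 i N0 (av i).
- by move=> i; have [] := hN1 i N0 (av i).
- move=> i j t u ij t01 u01 E.
  have [ia ib] := va i; have [ja jb] := va j; have [via vib] := vab i.
  have [vja vjb] := vab j; have [_ _ _ aa] := hPe _ _ ia; have [_ _ _ bb] := hPe _ _ jb.
  have vv : v i <> v j by move=> /vi/val_inj e; rewrite e eqxx in ij.
  apply: (arcs_disjoint ia jb _ _ _ _ (aa t t01)) => //; first exact/nesym.
  by rewrite E; exact: bb.
- move=> i j t u ij t01 u01 E.
  have [ia ib] := va i; have [_ _ _ aa] := hPe _ _ ia; have [_ _ _ Aj] := hP j.
  apply: (dA i j _ _ (aa t t01)); last by rewrite E; exact: Aj.
  by move=> /val_inj e; rewrite e eqxx in ij.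
move=> i j t u ij t01 u01 E.
have [ia ib] := va i; have [_ _ _ aa] := hPe _ _ ib; have [_ _ _ Aj] := hP j.
apply: (dB i j _ _ (aa t t01)); last by rewrite E; exact: Aj.
by move=> /val_inj e; rewrite e eqxx in ij.
Qed.

Lemma no_tripods_direct (a b c : G) (v : nat -> G) :
  injective v -> a <> b -> a <> c -> b <> c ->
  (forall i, [/\ adj (v i) a, adj (v i) b & adj (v i) c]) -> False.
Proof.
move=> vi ab ac bc va.
have ne i x : adj (v i) x -> v i <> x by move=> + e; rewrite e; exact: adj_irrefl.
have [P hPe] := edge_paths.
have dis i j x y : i <> j -> x <> y -> adj (v i) x -> adj (v i) y -> adj (v j) x -> adj (v j) y ->
   forall z, arc (v i) x z -> arc (v j) y z -> False.
  move=> ij xy ix iy jx jy z; apply: arcs_disjoint => //.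
  - by move/vi.
  - exact: ne.
  - exact/nesym/ne.
apply: (@no_tripods a b c v (fun i => P (v i) c) (fun i => arc (v i) c)) => //.
- by move=> i; have [ia ib _] := va i; split; exact: ne.
- by move=> i; have [] := va i.
- by move=> i; have [_ _ ic] := va i; exact: hPe.
- move=> i j x ij; have [ia ib ic] := va i; have [ja jb jc] := va j.
  exact: (dis i j a c).
move=> i j x ij; have [ia ib ic] := va i; have [ja jb jc] := va j.
exact: (dis i j b c).
Qed.

Lemma no_tripods_subdivided (a b c : G) (v w : nat -> G) :
  injective v -> injective w -> (forall i j, v i <> w j) -> a <> b -> a <> c -> b <> c ->
  (forall i, w i <> a /\ w i <> b) -> (forall i, v i <> c) ->
  (forall i, [/\ adj (v i) a, adj (v i) b, adj (v i) (w i) & adj (w i) c]) -> False.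
Proof.
move=> vi wi vw ab ac bc wab vc va.
have ne i x : adj (v i) x -> v i <> x by move=> + e; rewrite e; exact: adj_irrefl.
have [P hPe] := edge_paths.
have cat i := cat_pathP (p := P (v i) (w i)) (q := P (w i) c).
have dis i j x z : i <> j -> adj (v i) x -> adj (v j) x -> w j <> x -> x <> c ->
   arc (v i) x z -> (arc (v j) (w j) `|` arc (w j) c) z -> False.
  move=> ij ix jx wx xc az [az'|az']; have [_ _ jw wc] := va j.
    apply: (arcs_disjoint ix jw _ _ _ _ az az') => //; first by move/vi.
      exact/nesym/ne.
    exact/nesym.
  by apply: (arcs_disjoint ix wc _ _ _ _ az az') => //; exact/nesym.
apply: (@no_tripods a b c v (fun i => cat_path (P (v i) (w i)) (P (w i) c))
   (fun i => arc (v i) (w i) `|` arc (w i) c)) => //.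
- by move=> i; have [ia ib _] := va i; split; exact: ne.
- by move=> i; have [] := va i.
- move=> i; have [_ _ iw wc] := va i.
  have [p1 p10 p11 p1a] := hPe _ _ iw; have [p2 p20 p21 p2a] := hPe _ _ wc.
  have [|cp c0 c1 ci] := cat i p1 p2; first by rewrite p11 p20.
  split=> //; [by rewrite c0|by rewrite c1|].
  by move=> t /ci[u u01 [->|->]]; [left; exact: p1a|right; exact: p2a].
- move=> i j x ij; have [ia ib _ _] := va i; have [ja jb _ _] := va j; have [wa wb] := wab j.
  exact: dis.
move=> i j x ij; have [ia ib _ _] := va i; have [ja jb _ _] := va j; have [wa wb] := wab j.
exact: dis.
Qed.

(** Moore's argument: the foot c u lies in a face of some grid that the two other
    legs of u avoid.  There are countably many choices of a grid and a face, and
    by [no_drawing] each of them serves only finitely many triods. *)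
Lemma triods_countable (a b : G) (X : set G) (c : G -> G) :
  a <> b -> (forall u, X u -> [/\ adj u a, adj u b & adj u (c u)]) ->
  (forall u, X u -> [/\ c u <> a, c u <> b & ~ X (c u)]) ->
  (forall u v, X u -> X v -> c u = c v -> u = v) -> countable X.
Proof.
move=> ab Xa Xc ci.
have ne u x : adj u x -> u <> x by move=> + e; rewrite e; exact: adj_irrefl.
have [P hPe] := edge_paths.
have a1 : (1 : K) \in `[0, 1]%R by rewrite in_itv /= lexx ler01.
have dis u v x y z : u <> v -> x <> y -> u <> y -> v <> x -> adj u x -> adj v y ->
   arc u x z -> arc v y z -> False.
  by move=> uv xy uy vx ux vy; apply: arcs_disjoint => //; exact/nesym.
have end_avoid u : X u -> exists N1 : nat, (0 < N1)%N /\
   ~ trace g N1 (P u a) (snap g N1 (pt (c u))) /\ ~ trace g N1 (P u b) (snap g N1 (pt (c u))).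
  move=> Xu; have [ua ub uc] := Xa _ Xu; have [ca cb nc] := Xc _ Xu.
  have [pa _ _ aa] := hPe _ _ ua; have [pb _ _ bb] := hPe _ _ ub.
  have [|N1 N10 H1] := snap_avoids (pt_surf (c u)) pa.
    move=> t t01 E; have := aa t t01; rewrite E => /(arc_vertex ua)[] // e.
    by apply: nc; rewrite e.
  have [|N2 _ H2] := snap_avoids (pt_surf (c u)) pb.
    move=> t t01 E; have := bb t t01; rewrite E => /(arc_vertex ub)[] // e.
    by apply: nc; rewrite e.
  by exists (N1 + N2)%N; split; [lia|split; [apply: H1|apply: H2]; lia].
have ex u : exists N1 : nat, X u -> (0 < N1)%N /\
   ~ trace g N1 (P u a) (snap g N1 (pt (c u))) /\ ~ trace g N1 (P u b) (snap g N1 (pt (c u))).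
  have [Xu|nX] := pselect (X u); last by exists 0%N.
  by have [N1 H] := end_avoid u Xu; exists N1.
have [N1 hN1] := choice ex.
pose code u : nat * face := (N1 u, snap g (N1 u) (pt (c u))).
have -> : X = \bigcup_(y in [set: nat * face]) (X `&` [set u | code u = y]).
  apply/seteqP; split=> [u Xu|u [y _ []]] //; by exists (code u).
apply: bigcup_countable => [|y _]; first exact: countableP.
apply: finite_set_countable; apply: contrapT => /infinite_seq[v [vi Xv]].
case: y Xv => N0 T0 Xv.
pose n := (2 * 2 ^ (2 * (3 * g + 1) * 4)).+1.
have Xi i : X (v i) by case: (Xv i).
have N1E i : N1 (v i) = N0 by case: (Xv i) => _ [].
have snE i : snap g N0 (pt (c (v i))) = T0 by case: (Xv i) => _ [<- <-].
apply: (@no_drawing K g n (pt a) (pt b) (fun i => pt (v i)) (fun i => pt (c (v i)))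
   (fun i => P (v i) a) (fun i => P (v i) b) (fun i => P (v i) (c (v i))) N0 T0) => //.
- by have [] := hN1 _ (Xi 0%N); rewrite N1E.
- by move=> i; have [ia ib ic] := Xa _ (Xi i); have [pa p0 p1 _] := hPe _ _ ia.
- by move=> i; have [ia ib ic] := Xa _ (Xi i); have [pa p0 p1 _] := hPe _ _ ib.
- by move=> i; have [ia ib ic] := Xa _ (Xi i); have [pa p0 p1 _] := hPe _ _ ic.
- by move=> i; have [_ []] := hN1 _ (Xi i); rewrite N1E snE.
- by move=> i; have [_ []] := hN1 _ (Xi i); rewrite N1E snE.
- move=> i j t u ij t01 u01 E.
  have [ia ib ic] := Xa _ (Xi i); have [ja jb jc] := Xa _ (Xi j).
  have [_ _ _ aa] := hPe _ _ ia; have [_ _ _ bb] := hPe _ _ jb.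
  apply: (dis _ _ _ _ _ _ _ _ _ ia jb (aa t t01)) => //; [|exact: ne|exact: ne|].
    by move=> /vi/val_inj e; rewrite e eqxx in ij.
  by rewrite E; exact: bb.
- move=> i j t u ij t01 u01 E.
  have [ia ib ic] := Xa _ (Xi i); have [ja jb jc] := Xa _ (Xi j).
  have [ca cb nc] := Xc _ (Xi j).
  have [_ _ _ aa] := hPe _ _ ia; have [_ _ _ bb] := hPe _ _ jc.
  apply: (dis _ _ _ _ _ _ _ _ _ ia jc (aa t t01)) => //; [|exact/nesym| |exact: ne|].
  + by move=> /vi/val_inj e; rewrite e eqxx in ij.
  + by move=> e; apply: nc; rewrite -e.
  by rewrite E; exact: bb.
move=> i j t u ij t01 u01 E.
have [ia ib ic] := Xa _ (Xi i); have [ja jb jc] := Xa _ (Xi j).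
have [ca cb nc] := Xc _ (Xi j).
have [_ _ _ aa] := hPe _ _ ib; have [_ _ _ bb] := hPe _ _ jc.
apply: (dis _ _ _ _ _ _ _ _ _ ib jc (aa t t01)) => //; [|exact/nesym| |exact: ne|].
- by move=> /vi/val_inj e; rewrite e eqxx in ij.
- by move=> e; apply: nc; rewrite -e.
by rewrite E; exact: bb.
Qed.

End Graphs.

(** * As many reals as points of space *)

Section RealCodes.
Local Open Scope ring_scope.
Local Open Scope classical_set_scope.
Variable K : realType.

Definition ternary (A : nat -> bool) (n : nat) : K :=
  \sum_(i < n) (A i)%:R * 2 / 3 ^+ i.+1.

Definition cantor_code (A : nat -> bool) : K := sup (range (ternary A)).

Lemma ternaryS A n : ternary A n.+1 = ternary A n + (A n)%:R * 2 / 3 ^+ n.+1.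
Proof. by rewrite /ternary big_ord_recr. Qed.

Lemma ternary_tail A n k : ternary A n <= ternary A (n + k) <= ternary A n + (3 ^- n - 3 ^- (n + k)).
Proof.
elim: k => [|k /andP[h1 h2]]; first by rewrite addn0 subrr addr0 lexx.
rewrite addnS ternaryS exprS !invfM.
have : 0 < 3 ^- (n + k) :> K by rewrite invr_gt0 exprn_gt0.
move: (3 ^- (n + k)) h2 => e h2 e0.
by case: (A (n + k)%N) => /=; apply/andP; split; lra.
Qed.

Lemma ternary_le_code A n : ternary A n <= cantor_code A <= ternary A n + 3 ^- n.
Proof.
have ub m : ternary A m <= ternary A n + 3 ^- n.
  have e0 j : 0 < 3 ^- j :> K by rewrite invr_gt0 exprn_gt0.
  have [mn|nm] := leqP m n.
    have /andP[h _] := ternary_tail A m (n - m); rewrite subnKC // in h.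
    by have := e0 n; lra.
  have /andP[_ h] := ternary_tail A n (m - n); rewrite subnKC // in h; last exact: ltnW.
  by have := e0 m; lra.
apply/andP; split.
  apply: sup_upper_bound; last by exists n.
  by split; [exists (ternary A 0), 0%N|exists (ternary A n + 3 ^- n) => _ [m _ <-]].
apply: sup_le_ub; first by exists (ternary A 0), 0%N.
by move=> _ [m _ <-].
Qed.

Lemma cantor_code_inj (A B : nat -> bool) : cantor_code A = cantor_code B -> A =1 B.
Proof.
move=> AB n; elim/ltn_ind: n => n IH.
have same : ternary A n = ternary B n.
  by apply: eq_bigr => i _; rewrite IH.
have /andP[a1 a2] := ternary_le_code A n.+1; have /andP[b1 b2] := ternary_le_code B n.+1.
move: a1 a2 b1 b2; rewrite AB !ternaryS same.
have : 0 < 3 ^- n.+1 :> K by rewrite invr_gt0 exprn_gt0.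
by case: (A n); case: (B n) => //= h a1 a2 b1 b2; exfalso; lra.
Qed.

(** Dedekind cuts, indexed by the enumeration of the rationals. *)
Definition cut (x : K) (n : nat) : bool :=
  if unpickle n is Some q then ratr q < x else false.

Lemma cut_inj (x y : K) : cut x =1 cut y -> x = y.
Proof.
wlog xy : x y / x < y.
  move=> W h; have [xy|yx|//] := ltgtP x y; first exact: W.
  by apply/esym/W.
move=> h; exfalso.
have [q] := rat_in_itvoo xy; rewrite in_itv /= => /andP[xq qy].
have := h (pickle q); rewrite /cut pickleK qy => /esym; rewrite ltNge (ltW xq) //.
Qed.

(** The cuts of the three coordinates are interleaved into one sequence of bits,
    read as the ternary digits 0 and 2 of a point of the Cantor set. *)
Lemma space_injects : exists f : Defs.space K -> K, injective f.
Proof.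
pose mix (p : Defs.space K) (n : nat) : bool :=
  cut (nth 0 [:: p.1.1; p.1.2; p.2] (n %% 3)) (n %/ 3).
exists (fun p => cantor_code (mix p)) => p q /cantor_code_inj E.
have coord i : (i < 3)%N -> nth 0 [:: p.1.1; p.1.2; p.2] i = nth 0 [:: q.1.1; q.1.2; q.2] i.
  move=> i3; apply: cut_inj => n; have := E (n * 3 + i)%N.
  by rewrite /mix divnMDl // divn_small // addn0 modnMDl modn_small.
have := coord 0%N isT; have := coord 1%N isT; have := coord 2%N isT.
by case: p {E coord} => [[x y] z]; case: q => [[x' y'] z'] /= -> -> ->.
Qed.

End RealCodes.

(** * Straight drawings on the sphere *)

Section Sphere.
Local Open Scope ring_scope.
Local Open Scope classical_set_scope.
Variable K : realType.

(** Inverse stereographic projection in homogeneous coordinates, which also covers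
    the pole (w = 0) and makes curves through the pole visibly continuous. *)
Definition hom_point (x y w : K) : Defs.space K :=
  (2 * x * w / (x ^+ 2 + y ^+ 2 + w ^+ 2), 2 * y * w / (x ^+ 2 + y ^+ 2 + w ^+ 2),
   (x ^+ 2 + y ^+ 2 - w ^+ 2) / (x ^+ 2 + y ^+ 2 + w ^+ 2)).

Definition stereo (p : option (K * K)) : Defs.space K :=
  if p is Some a then hom_point a.1 a.2 1 else (0, 0, 1).

Lemma hom_den (x y w : K) : y != 0 \/ w != 0 -> 0 < x ^+ 2 + y ^+ 2 + w ^+ 2.
Proof.
have := sqr_ge0 x; have := sqr_ge0 y; have := sqr_ge0 w => hw hy hx.
case=> n0.
  have : 0 < y ^+ 2 by rewrite lt0r sqrf_eq0 n0. lra.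
have : 0 < w ^+ 2 by rewrite lt0r sqrf_eq0 n0. lra.
Qed.

Lemma stereo_sphere p : surface 0 (stereo p).
Proof.
case: p => [[x y]|] /=; rewrite big_ord0 mulr1; last by rewrite !expr0n expr1n !subr0.
have := @hom_den x y 1 (or_intror (oner_neq0 _)).
rewrite muln0 add0n expr1n => h; field; exact: lt0r_neq0.
Qed.

Lemma stereo_hom x y w : w != 0 -> stereo (Some (x, y)) = hom_point (x * w) (y * w) w.
Proof.
move=> w0; rewrite /= /hom_point /=.
have h1 := @hom_den x y 1 (or_intror (oner_neq0 _)).
have -> : (x * w) ^+ 2 + (y * w) ^+ 2 + w ^+ 2 = w ^+ 2 * (x ^+ 2 + y ^+ 2 + 1 ^+ 2) by ring.
have -> : (x * w) ^+ 2 + (y * w) ^+ 2 - w ^+ 2 = w ^+ 2 * (x ^+ 2 + y ^+ 2 - 1 ^+ 2) by ring.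
move: (x ^+ 2 + y ^+ 2 + 1 ^+ 2) h1 => D /lt0r_neq0 D0.
by congr (_, _, _); field; rewrite ?w0 ?D0.
Qed.

Lemma stereo_inj : injective stereo.
Proof.
have np a : stereo (Some a) <> (0, 0, 1).
  case: a => x y [_ _ /=]; have h1 := @hom_den x y 1 (or_intror (oner_neq0 _)).
  move=> /(congr1 (fun z => z * (x ^+ 2 + y ^+ 2 + 1 ^+ 2))).
  rewrite divfK ?lt0r_neq0 // mul1r; lra.
case=> [a|] [b|] // E; last 2 first.
- by case: (np a).
- by case: (np b).
case: a b E => x y [x' y'] [/= ].
have h1 := @hom_den x y 1 (or_intror (oner_neq0 _)).
have h2 := @hom_den x' y' 1 (or_intror (oner_neq0 _)).
move: h1 h2; rewrite !expr1n !mulr1.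
set D := x ^+ 2 + y ^+ 2 + 1; set D' := x' ^+ 2 + y' ^+ 2 + 1 => h1 h2 ex ey ez.
have DD : D = D'.
  move/eqP: ez; rewrite eqr_div ?lt0r_neq0 // => /eqP.
  rewrite (_ : x ^+ 2 + y ^+ 2 - 1 = D - 2); last by rewrite /D; ring.
  rewrite (_ : x' ^+ 2 + y' ^+ 2 - 1 = D' - 2); last by rewrite /D'; ring.
  move=> e; lra.
rewrite DD in ex ey; have Di : D'^-1 != 0 by rewrite invr_eq0 lt0r_neq0.
move: ex ey => /(mulIf Di) ex /(mulIf Di) ey.
by congr (Some (_, _)); lra.
Qed.

Definition seg (a b : K * K) : set (option (K * K)) :=
  [set z | exists2 r : K, 0 <= r <= 1 &
    z = Some (a.1 + r * (b.1 - a.1), a.2 + r * (b.2 - a.2))].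

Definition ray (a : K * K) (d : K) : set (option (K * K)) :=
  [set z | z = None \/ exists2 r : K, 0 <= r & z = Some (a.1, a.2 + d * r)].

(** Rays are vertical, so all of them leave the pole, the image of the point at
    infinity [None]. *)
Inductive straight : set (option (K * K)) -> option (K * K) -> option (K * K) -> Prop :=
| straight_seg a b : a <> b -> straight (seg a b) (Some a) (Some b)
| straight_in a d : d ^+ 2 = 1 -> straight (ray a d) None (Some a)
| straight_out a d : d ^+ 2 = 1 -> straight (ray a d) (Some a) None.

Lemma is_arc_sym (A : set (Defs.space K)) p q : is_arc A p q -> is_arc A q p.
Proof.
move=> [f [cf fi f0 f1 AE]].
have inv (t : K) : t \in `[0, 1]%R -> 1 - t \in `[0, 1]%R by rewrite !in_itv /=; lra.
have cs : continuous (fun t : K => 1 - t).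
  by move=> t; apply: cvgB; [exact: cvg_cst|exact: cvg_id].
exists (fun t => f (1 - t)); split.
- apply/subspace_continuousP => x x01; move/subspace_continuousP: cf => cf.
  apply: (@cvg_comp _ _ _ (fun t : K => 1 - t) f _ (within `[0, 1] (nbhs (1 - x)))); last exact: cf (inv _ x01).
  move=> U nU; rewrite /within /=; have := cs x _ nU.
  by apply: (@filterS _ (nbhs x)) => y fy Ay; apply: fy; exact: inv.
- move=> t u; rewrite !inE => t01 u01 /fi; rewrite !inE => /(_ (inv _ t01) (inv _ u01)); lra.
- by rewrite subr0.
- by rewrite subrr.
rewrite AE; apply/seteqP; split=> _ [t t01 <-]; exists (1 - t) => //; try exact: inv.
by rewrite subKr.
Qed.

Lemma cont_arc (f : K -> Defs.space K) p q : continuous f ->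
  {in `[0, 1]%R &, injective f} -> f 0 = p -> f 1 = q -> is_arc (f @` `[0, 1]) p q.
Proof.
move=> cf fi f0 f1; exists f; split=> //; first exact: continuous_subspaceT.
Qed.

Lemma cvg_pair_nbhs (T : Type) (U V : topologicalType) (F : set_system T) (FF : Filter F)
    (f : T -> U) (h : T -> V) (a : U) (b : V) :
  f @ F --> a -> h @ F --> b -> (fun t => (f t, h t)) @ F --> (a, b).
Proof. by move=> fa hb; exact: (cvg_pair fa hb). Qed.

Lemma cont_hom (x y w : K -> K) : continuous x -> continuous y -> continuous w ->
  (forall t, y t != 0 \/ w t != 0) -> continuous (fun t => hom_point (x t) (y t) (w t)).
Proof.
move=> cx cy cw h t.
have sq (f : K -> K) : continuous f -> f u ^+ 2 @[u --> t] --> f t ^+ 2.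
  by move=> cf; apply: cvgM; exact: cf.
have cD : (x u ^+ 2 + y u ^+ 2 + w u ^+ 2)^-1 @[u --> t] --> (x t ^+ 2 + y t ^+ 2 + w t ^+ 2)^-1.
  apply: cvgV; first by rewrite lt0r_neq0 // hom_den.
  by apply: cvgD; [apply: cvgD|]; exact: sq.
have c2 (f : K -> K) : continuous f -> 2 * f u @[u --> t] --> 2 * f t.
  by move=> cf; apply: cvgM; [exact: cvg_cst|exact: cf].
apply: cvg_pair_nbhs; first apply: cvg_pair_nbhs.
- by apply: cvgM => //; apply: cvgM; [exact: c2|exact: cw].
- by apply: cvgM => //; apply: cvgM; [exact: c2|exact: cw].
by apply: cvgM => //; apply: cvgB; [apply: cvgD|]; exact: sq.
Qed.

Lemma cont_affine (a b : K) : continuous (fun t : K => a + t * b).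
Proof.
move=> t; apply: cvgD; first exact: cvg_cst.
by apply: cvgM; [exact: cvg_id|exact: cvg_cst].
Qed.

Lemma seg_arc a b : a <> b -> is_arc (stereo @` seg a b) (stereo (Some a)) (stereo (Some b)).
Proof.
case: a b => a1 a2 [b1 b2] ab.
pose f (r : K) := hom_point (a1 + r * (b1 - a1)) (a2 + r * (b2 - a2)) 1.
have fE r : f r = stereo (Some (a1 + r * (b1 - a1), a2 + r * (b2 - a2))) by [].
have -> : stereo @` seg (a1, a2) (b1, b2) = f @` `[0, 1].
  apply/seteqP; split=> [_ [_ [r r01 ->] <-]|_ [r r01 <-]].
    by exists r; rewrite //= in_itv.
  exists (Some (a1 + r * (b1 - a1), a2 + r * (b2 - a2))) => //.
  by exists r => //; move: r01; rewrite /= in_itv.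
apply: (@cont_arc f).
- apply: cont_hom; [exact: cont_affine|exact: cont_affine|by move=> t; exact: cvg_cst|].
  by move=> t; right; exact: oner_neq0.
- move=> r r' _ _; rewrite !fE => /stereo_inj[/addrI e1 /addrI e2].
  have [d|d] := eqVneq (b1 - a1) 0; last exact: (mulIf d).
  have [d'|d'] := eqVneq (b2 - a2) 0; last exact: (mulIf d').
  by exfalso; apply: ab; congr (_, _); apply/esym/subr0_eq.
- by rewrite fE !mul0r !addr0.
by rewrite fE !mul1r; congr (stereo (Some (_, _))); ring.
Qed.

Lemma ray_arc a d : d ^+ 2 = 1 -> is_arc (stereo @` ray a d) (stereo None) (stereo (Some a)).
Proof.
case: a => a1 a2 d1; have d0 : d != 0.
  by apply/eqP => d0; move: d1; rewrite d0 expr0n /= => /esym/eqP; rewrite oner_eq0.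
(* the parameter t is the inverse of a coordinate along the ray, so that t = 0 is the pole *)
pose f (t : K) := hom_point (0 + t * a1) (d + t * (a2 - d)) (0 + t * 1).
have f0 : f 0 = stereo None.
  rewrite /f !mul0r !addr0 /hom_point /= !mulr0 !mul0r d1.
  by rewrite expr0n /= add0r subr0 addr0 divff ?oner_neq0.
have fE t : t != 0 -> f t = stereo (Some (a1, a2 + d * (t^-1 - 1))).
  move=> t0; rewrite (stereo_hom _ _ t0) /f; congr hom_point; [by ring|by field|by ring].
have -> : stereo @` ray (a1, a2) d = f @` `[0, 1].
  apply/seteqP; split=> [_ [_ [->|[r r0 ->]] <-]|_ [t t01 <-]].
  - by exists 0; rewrite //= in_itv /= lexx ler01.
  - have r1 : 0 < 1 + r by lra.
    exists (1 + r)^-1.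
      by rewrite /= in_itv /= invr_ge0 (ltW r1) invf_le1 //; lra.
    rewrite fE ?invr_eq0 ?lt0r_neq0 // invrK.
    by congr (stereo (Some (_, _))); rewrite /=; ring.
  - have [->|t0] := eqVneq t 0; first by exists None => //; left.
    exists (Some (a1, a2 + d * (t^-1 - 1))); last by rewrite fE.
    right; exists (t^-1 - 1) => //.
    move: t01; rewrite /= in_itv /= => /andP[h1 h2].
    by rewrite subr_ge0 invf_ge1 // lt0r t0.
apply: (@cont_arc f) => //.
- apply: cont_hom; try exact: cont_affine.
  move=> t; have [->|t0] := eqVneq t 0; first by left; rewrite mul0r addr0.
  by right; rewrite mulr1 add0r.
- move=> t u _ _; have [->|t0] := eqVneq t 0; have [->|u0] := eqVneq u 0 => //.
  + by rewrite f0 fE // => /stereo_inj.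
  + by rewrite f0 fE // => /stereo_inj.
  rewrite !fE // => /stereo_inj[/addrI /(mulfI d0) /addIr]; exact: invr_inj.
by rewrite fE ?oner_neq0 // invr1 subrr mulr0 addr0.
Qed.

Lemma sphere_drawing (G : sgraph) (pos : G -> option (K * K))
    (P : G -> G -> set (option (K * K))) :
  injective pos ->
  (forall u v, adj u v -> straight (P u v) (pos u) (pos v) /\ P u v = P v u) ->
  (forall u v w, adj u v -> P u v (pos w) -> w = u \/ w = v) ->
  (forall u v x y z, adj u v -> adj x y -> [set u; v] <> [set x; y] ->
     P u v z -> P x y z -> exists w, [/\ [set u; v] w, [set x; y] w & z = pos w]) ->
  embeddable K G 0.
Proof.
move=> pi Ps Pv Pd; exists (fun u => stereo (pos u)), (fun u v => stereo @` P u v).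
split.
- by split=> [u v /stereo_inj/pi //|u]; exact: stereo_sphere.
- move=> u v /Ps[st PE]; split; last by rewrite PE.
  2: by move=> _ [z _ <-]; exact: stereo_sphere.
  case: st => [a b ab|a d d1|a d d1]; [exact: seg_arc|exact: ray_arc|].
  by apply: is_arc_sym; exact: ray_arc.
- by move=> u v w uv [z Pz /stereo_inj zE]; apply: (Pv u v w uv); rewrite -zE.
- move=> u v x y uv xy ne p [[z Pz <-] [z' Pz' /stereo_inj zE]].
  rewrite zE in Pz'; have [w [w1 w2 ->]] := Pd _ _ _ _ _ uv xy ne Pz Pz'.
  by exists w.
Qed.

End Sphere.

(** * Drawing a matching joined to one or two poles *)

Section Drawings.
Local Open Scope ring_scope.
Local Open Scope classical_set_scope.
Variables (K : realType) (G : sgraph).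

(** The partner function of the matching, extended by the identity to unmatched
    vertices. *)
Lemma partner (C : set G) :
  (forall u x y, ~ C u -> ~ C x -> ~ C y -> adj u x -> adj u y -> x = y) ->
  exists p : G -> G, [/\ forall u, ~ C u -> ~ C (p u), forall u, ~ C u -> p (p u) = u &
    forall u v, ~ C u -> ~ C v -> adj u v -> p u = v].
Proof.
move=> deg1.
have ex u : exists v, (~ C v /\ adj u v) \/ ((forall v, ~ C v -> ~ adj u v) /\ v = u).
  have [[v h]|n] := pselect (exists v, ~ C v /\ adj u v); first by exists v; left.
  by exists u; right; split=> // v nv uv; apply: n; exists v.
have [p hp] := choice ex.
have pE u v : ~ C u -> ~ C v -> adj u v -> p u = v.
  move=> nu nv uv; have [[np up]|[n _]] := hp u; last by case: (n v).
  exact: (deg1 u).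
exists p; split=> // u nu; have [[np up]|[n E]] := hp u.
- by [].
- by rewrite E.
- by apply: pE => //; exact: adj_sym.
- by rewrite !E.
Qed.

Lemma unordered_pair (u v x y : G) :
  u = x /\ v = y \/ u = y /\ v = x -> [set u; v] = [set x; y].
Proof. by case=> -[-> ->] //; rewrite setUC. Qed.

Definition unit_sign (a : K) : Prop := a = 1 \/ a = -1.

Lemma flip01 (r : K) : 0 <= r <= 1 -> 0 <= 1 - r <= 1. Proof. lra. Qed.

Lemma one_neq_opp1 : (1 : K) = -1 -> False. Proof. lra. Qed.

Lemma unit_sign_mid a b (r : K) : unit_sign a -> unit_sign b -> 0 <= r <= 1 ->
  -1 <= a + r * (b - a) <= 1.
Proof. by case=> ->; case=> ->; lra. Qed.

Lemma unit_sign_ray a b (r q : K) : unit_sign a -> unit_sign b -> 0 <= r -> 0 <= q ->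
  a + a * r = b + b * q -> a = b.
Proof. by case=> ->; case=> -> // *; exfalso; lra. Qed.

Lemma unit_sign_tip a (y r : K) : unit_sign a -> -1 <= y <= 1 -> 0 <= r ->
  y = a + a * r -> y = a.
Proof. by case=> ->; lra. Qed.

(** The vertex s is put at infinity.  A matched pair occupies the points of height
    1 and -1 on a vertical line of its own, joined by a segment; the rays to s
    continue that line outwards.  The abscissa of the line is the smaller of the two
    codes. *)
Theorem embed_pencil (s : G) (k : G -> K) : injective k ->
  (forall u x y, u <> s -> x <> s -> y <> s -> adj u x -> adj u y -> x = y) ->
  embeddable K G 0.
Proof.
move=> ki deg1.
have [p [ps pp pE]] := @partner [set s] deg1.
pose base u := Num.min (k u) (k (p u)).
pose lv u : K := if k u <= k (p u) then 1 else -1.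
pose pl u := (base u, lv u).
have lv1 u : unit_sign (lv u) by rewrite /lv; case: ifP; [left|right].
have baseE u v : u <> s -> v <> s -> base u = base v -> v = u \/ v = p u.
  move=> us vs; rewrite /base.
  case: (leP (k u) (k (p u))) => _; case: (leP (k v) (k (p v))) => _ /ki e.
  - by left.
  - by right; rewrite e pp.
  - by right.
  - by left; rewrite -(pp u us) e pp.
have lvE u : u <> s -> lv u = lv (p u) -> p u = u.
  move=> us; rewrite /lv (pp u us); case: (ltgtP (k u) (k (p u))) => [_ e|_ e|/ki<- //]; exfalso; exact: one_neq_opp1.
have plE u v : u <> s -> v <> s -> base u = base v -> lv u = lv v -> v = u.
  move=> us vs /(baseE _ _ us vs)[//|->] /(lvE _ us)->. by [].
pose pos u := if `[< u = s >] then None else Some (pl u).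
pose P u v := if `[< u = s >] then ray (pl v) (lv v) else
              if `[< v = s >] then ray (pl u) (lv u) else seg (pl u) (pl v).
have poss : pos s = None by rewrite /pos asboolT.
have posE u : u <> s -> pos u = Some (pl u) by move=> us; rewrite /pos asboolF.
have edge u v : adj u v ->
    (exists w, [/\ w <> s, [set u; v] = [set s; w] & P u v = ray (pl w) (lv w)]) \/
    [/\ u <> s, v <> s, v = p u, p u <> u & P u v = seg (pl u) (pl v)].
  move=> uv; have uv' : u <> v by move=> e; move: uv; rewrite e; exact: adj_irrefl.
  rewrite /P; have [us|us] := pselect (u = s).
    by left; exists v; split; [move=> e; apply: uv'; rewrite us e|rewrite us|rewrite asboolT].
  rewrite (asboolF us); have [vs|vs] := pselect (v = s).
    by left; exists u; split => //; [rewrite vs setUC|rewrite asboolT].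
  right; rewrite (asboolF vs); have puv := pE _ _ us vs uv; split=> //.
  by rewrite puv; exact: nesym.
have segP u z : u <> s -> seg (pl u) (pl (p u)) z ->
    exists2 y : K, -1 <= y <= 1 & z = Some (base u, y).
  move=> us [r r01 ->] /=; exists (lv u + r * (lv (p u) - lv u)).
    exact: unit_sign_mid.
  by congr (Some (_, _)); rewrite /base (pp u us) [Num.min (k (p u)) _]minC; ring.
apply: (@sphere_drawing K G pos P).
- move=> u v; have [us|us] := pselect (u = s); have [vs|vs] := pselect (v = s).
  + by rewrite us vs.
  + by rewrite us poss posE.
  + by rewrite vs poss posE.
  by rewrite !posE // => -[e1 e2]; exact/esym/plE.
- move=> u v uv; have uv' : u <> v by move=> e; move: uv; rewrite e; exact: adj_irrefl.
  have sq w : lv w ^+ 2 = 1 by case: (lv1 w) => ->; rewrite ?sqrrN expr1n.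
  rewrite /P; have [us|us] := pselect (u = s); have [vs|vs] := pselect (v = s).
  + by case: uv'; rewrite us vs.
  + by rewrite us (asboolT (erefl s)) (asboolF vs) poss posE //; split=> //; exact: straight_in.
  + by rewrite vs (asboolT (erefl s)) (asboolF us) poss posE //; split=> //; exact: straight_out.
  rewrite (asboolF us) (asboolF vs) !posE //; split.
    by apply: straight_seg => -[e1 e2]; apply: uv'; exact/esym/plE.
  apply/seteqP; split=> z [r r01 ->]; exists (1 - r); try exact: flip01;
    by congr (Some (_, _)); ring.
- move=> u v w uv Pw; have [[x [xs E PE]]|[us vs vE pu PE]] := edge u v uv; rewrite PE in Pw.
    suff : [set u; v] w by case; [left|right].
    rewrite E; have [->|ws] := pselect (w = s); [by left|right].
    move: Pw; rewrite posE // => -[//|[r r0 [be le]]]; apply: plE => //.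
    apply: (unit_sign_ray (lv1 x) (lv1 w) r0 (lexx 0)); rewrite mulr0 addr0; exact/esym.
  have [ws|ws] := pselect (w = s).
    by move: Pw; rewrite ws poss => -[].
  rewrite posE // vE in Pw *; have [y _ [be _]] := segP _ _ us Pw.
  by apply: baseE.
move=> u v x y z uv xy ne Pz Pz'.
have [[a [as_ E PE]]|[us vs vE pu PE]] := edge u v uv; rewrite PE in Pz;
have [[b [bs E' PE']]|[xs ys yE px PE']] := edge x y xy; rewrite PE' in Pz'.
- case: Pz => [->|[r r0 zE]]; first by exists s; rewrite E E' poss; split=> //; left.
  exfalso; case: Pz' => [|[r' r'0]]; first by rewrite zE.
  rewrite zE => -[be le]; apply: ne; rewrite E E'; congr [set _; _].
  apply/esym/plE => //; exact: unit_sign_ray le.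
- rewrite yE in Pz'; have [y0 yb zE] := segP _ _ xs Pz'.
  case: Pz => [|[r r0]]; rewrite zE // => -[be le].
  exists a; rewrite E posE //; split; [by right| |].
    by have [->|->] := baseE _ _ xs as_ be; rewrite yE; [left|right].
  by rewrite be (unit_sign_tip (lv1 a) yb r0 le).
- rewrite vE in Pz; have [y0 yb zE] := segP _ _ us Pz.
  case: Pz' => [|[r r0]]; rewrite zE // => -[be le].
  exists b; rewrite E' posE //; split; [|by right|].
    by have [->|->] := baseE _ _ us bs be; rewrite vE; [left|right].
  by rewrite be (unit_sign_tip (lv1 b) yb r0 le).
exfalso; rewrite vE in Pz; rewrite yE in Pz'.
have [y0 _ zE] := segP _ _ us Pz; have [y1 _] := segP _ _ xs Pz'.
rewrite zE => -[be _]; apply: ne; rewrite vE yE; apply: unordered_pair.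
by have [->|->] := baseE _ _ us xs be; [left|right; rewrite pp].
Qed.

Lemma seg_sym (a b : K * K) : seg a b = seg b a.
Proof.
by apply/seteqP; split=> z [r r01 ->]; exists (1 - r); try exact: flip01;
  congr (Some (_, _)); ring.
Qed.

Lemma ray_ends (x y q r : K) : 0 <= r -> q <= 1 -> (x, 1 + 1 * r) = (y, q) ->
  [/\ r = 0, q = 1 & x = y].
Proof. by move=> r0 q1 [-> e]; split=> //; lra. Qed.

Lemma spokes_meet (x y q r : K) : (q * x, q) = (r * y, r) -> q = 0 \/ x = y.
Proof.
case=> + qr; rewrite qr; have [->|r0] := eqVneq r 0; first by left.
by move=> /(mulfI r0); right.
Qed.

Lemma nat_in_unit (m n : nat) : (2 * m)%:R <= n%:R :> K -> n%:R <= (2 * m + 1)%:R :> K ->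
  n = (2 * m)%N \/ n = (2 * m + 1)%N.
Proof. by rewrite !ler_nat; lia. Qed.

Lemma unit_intervals_meet (m n : nat) (y : K) : (2 * m)%:R <= y <= (2 * m + 1)%:R ->
  (2 * n)%:R <= y <= (2 * n + 1)%:R -> m = n.
Proof.
move=> /andP[a1 a2] /andP[b1 b2].
have : (2 * m)%:R <= (2 * n + 1)%:R :> K by exact: le_trans b2.
have : (2 * n)%:R <= (2 * m + 1)%:R :> K by exact: le_trans a2.
by rewrite !ler_nat; lia.
Qed.

Lemma nonpos_not_above (r q : K) : 0 <= r -> 0 <= q -> 0 + -1 * r = 1 + 1 * q -> False.
Proof. by move=> *; lra. Qed.

Lemma zero_not_above (r : K) : 0 <= r -> 0 = 1 + 1 * r -> False.
Proof. by move=> *; lra. Qed.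

Lemma nonpos_not_one (r : K) : 0 <= r -> 0 + -1 * r = 1 -> False.
Proof. by move=> *; lra. Qed.

Lemma nonpos_nonneg (r q : K) : 0 <= r -> 0 <= q -> 0 + -1 * r = q -> q = 0.
Proof. by move=> *; lra. Qed.

Lemma seg_unit (m : nat) (i j : nat) (r : K) : i = 0%N /\ j = 1%N \/ i = 1%N /\ j = 0%N ->
  0 <= r <= 1 ->
  (2 * m)%:R <= (2 * m + i)%:R + r * ((2 * m + j)%:R - (2 * m + i)%:R) <= (2 * m + 1)%:R.
Proof. by case=> -[-> ->] r01; rewrite !natrD; lra. Qed.

(** The vertex s is put at infinity, t at the origin, and the others on the line
    y = 1 with vertical rays to s and segments to t.  A matched pair is joined
    along that line, so it must have no other vertex in between: the two
    vertices get the abscissas 2 m and 2 m + 1, which is where countability is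
    used. *)
Theorem embed_book (s t : G) (k : G -> nat) : s <> t -> injective k ->
  (forall u x y, u <> s -> u <> t -> x <> s -> x <> t -> y <> s -> y <> t ->
     adj u x -> adj u y -> x = y) ->
  embeddable K G 0.
Proof.
move=> st ki deg1.
have [|p [ps pp pE]] := @partner [set u | u = s \/ u = t].
  by move=> u x y /not_orP[? ?] /not_orP[? ?] /not_orP[? ?]; exact: deg1.
pose core u := u = s \/ u = t.
pose base u := minn (k u) (k (p u)).
pose lv u := if (k u <= k (p u))%N then 0%N else 1%N.
pose xc u := (2 * base u + lv u)%N.
pose pl u : K * K := ((xc u)%:R, 1).
have lv2 u : lv u = 0%N \/ lv u = 1%N by rewrite /lv; case: ifP; [left|right].
have baseE u v : ~ core u -> ~ core v -> base u = base v -> v = u \/ v = p u.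
  move=> us vs; rewrite /base /minn; case: ifP => _; case: ifP => _ /ki e.
  - by left.
  - by right; rewrite e pp.
  - by right.
  - by left; rewrite -(pp u us) e pp.
have basep u : ~ core u -> base (p u) = base u by move=> us; rewrite /base (pp u us) minnC.
have lvE u : ~ core u -> lv u = lv (p u) -> p u = u.
  move=> us; rewrite /lv (pp u us).
  by case: (ltngtP (k u) (k (p u))) => // /ki <-.
have lvp u : ~ core u -> p u <> u -> lv u = 0%N /\ lv (p u) = 1%N \/ lv u = 1%N /\ lv (p u) = 0%N.
  move=> us pu; have ne : lv u <> lv (p u) by move/(lvE _ us).
  by case: (lv2 u) ne => ->; case: (lv2 (p u)) => ->; [|left|right|].
have xcE u v : ~ core u -> ~ core v -> xc u = xc v -> v = u.
  move=> us vs e; have be : base u = base v.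
    by move: e; rewrite /xc; case: (lv2 u) => ->; case: (lv2 v) => ->; lia.
  have le : lv u = lv v by move: e; rewrite /xc be; lia.
  by have [//|vE] := baseE _ _ us vs be; rewrite vE lvE // -vE.
have xcR u v : ~ core u -> ~ core v -> (xc u)%:R = (xc v)%:R :> K -> v = u.
  by move=> us vs /eqP; rewrite eqr_nat => /eqP; exact: xcE.
have xcm u w : ~ core u -> ~ core w -> p u <> u ->
    (2 * base u)%:R <= ((xc w)%:R : K) <= (2 * base u + 1)%:R -> w = u \/ w = p u.
  move=> us ws pu /andP[h1 h2]; have npu := ps _ us.
  have := nat_in_unit h1 h2; have := lvp _ us pu.
  case=> -[l1 l2] [] e.
  - by left; apply: xcE => //; rewrite e /xc l1 addn0.
  - by right; apply: xcE => //; rewrite e /xc basep // l2.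
  - by right; apply: xcE => //; rewrite e /xc basep // l2 addn0.
  - by left; apply: xcE => //; rewrite e /xc l1.
pose place u : K * K := if `[< u = t >] then (0, 0) else pl u.
pose pos u := if `[< u = s >] then None else Some (place u).
pose P u v := if `[< u = s >] then ray (place v) (if `[< v = t >] then -1 else 1) else
              if `[< v = s >] then ray (place u) (if `[< u = t >] then -1 else 1) else
              seg (place u) (place v).
have ts : t <> s by exact: nesym.
have plt : place t = (0, 0) by rewrite /place asboolT.
have plu u : ~ core u -> place u = pl u by move=> /not_orP[_ ut]; rewrite /place asboolF.
have poss : pos s = None by rewrite /pos asboolT.
have posE u : u <> s -> pos u = Some (place u) by move=> us; rewrite /pos asboolF.
have post : pos t = Some (0, 0) by rewrite posE // plt.
have posu u : ~ core u -> pos u = Some ((xc u)%:R, 1).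
  by move=> us; rewrite posE ?plu //; move=> e; apply: us; left.
pose rung (m : nat) : set (option (K * K)) := [set z | exists2 y : K,
   (2 * m)%:R <= y <= (2 * m + 1)%:R & z = Some (y, 1)].
pose kind (n : nat) (E : set G) (Z : set (option (K * K))) : Prop :=
  [\/ [/\ n = 0%N, E = [set s; t] & Z = ray (0, 0) (-1)],
      [/\ n = 1%N & exists w, [/\ ~ core w, E = [set s; w] & Z = ray (pl w) 1]],
      [/\ n = 2%N & exists w, [/\ ~ core w, E = [set t; w] & Z = seg (0, 0) (pl w)]] |
      [/\ n = 3%N & exists u, [/\ ~ core u, p u <> u, E = [set u; p u] & Z `<=` rung (base u)]]].
have edge u v : adj u v -> exists n, kind n [set u; v] (P u v).
  move=> uv; have uv' : u <> v by move=> e; move: uv; rewrite e; exact: adj_irrefl.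
  rewrite /P; have [us|us] := pselect (u = s).
    rewrite (asboolT us); have [vt|vt] := pselect (v = t).
      by exists 0%N; constructor 1; rewrite us vt plt asboolT.
    have nv : ~ core v by case=> // e; apply: uv'; rewrite us e.
    by exists 1%N; constructor 2; split=> //; exists v; rewrite us plu // asboolF.
  rewrite (asboolF us); have [vs|vs] := pselect (v = s).
    rewrite (asboolT vs); have [ut|ut] := pselect (u = t).
      by exists 0%N; constructor 1; rewrite vs ut plt asboolT // setUC.
    have nu : ~ core u by case.
    by exists 1%N; constructor 2; split=> //; exists u; rewrite vs plu // asboolF // setUC.
  rewrite (asboolF vs); have [ut|ut] := pselect (u = t).
    have nv : ~ core v by case=> // e; apply: uv'; rewrite ut e.
    by exists 2%N; constructor 3; split=> //; exists v; rewrite ut plt plu.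
  have nu : ~ core u by case.
  have [vt|vt] := pselect (v = t).
    by exists 2%N; constructor 3; split=> //; exists u; rewrite vt plt plu // setUC seg_sym.
  have nv : ~ core v by case.
  exists 3%N; constructor 4; split=> //; exists u; have puv := pE _ _ nu nv uv.
  have pu : p u <> u by rewrite puv; exact: nesym.
  split=> //; first by rewrite puv.
  move=> z [r r01 ->]; rewrite (plu _ nu) (plu _ nv); exists ((xc u)%:R + r * ((xc v)%:R - (xc u)%:R)).
    rewrite /xc -puv basep //; exact: seg_unit (lvp _ nu pu) r01.
  by congr (Some (_, _)) => /=; rewrite subrr mulr0 addr0.
have vertex n E Z w : kind n E Z -> Z (pos w) -> E w.
  have [ws|ws] := pselect (w = s).
    rewrite ws poss; case=> [[_ -> ->]|[_ [v [nv -> ->]]]|[_ [v [nv -> ->]]]|[_ [v [nv pv -> Zr]]]].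
    - by left.
    - by left.
    - by case.
    - by move=> /Zr[].
  have [wt|wt] := pselect (w = t).
    rewrite wt post; case=> [[_ -> ->]|[_ [v [nv -> ->]]]|[_ [v [nv -> ->]]]|[_ [v [nv pv -> Zr]]]].
    - by right.
    - case=> // -[r r0 [_ e]]; exfalso; exact: zero_not_above r0 e.
    - by left.
    - by move=> /Zr[y _ [_ e]]; exfalso; move/esym/eqP: e; rewrite oner_eq0.
  have nw : ~ core w by case.
  rewrite (posu _ nw); case=> [[_ -> ->]|[_ [v [nv -> ->]]]|[_ [v [nv -> ->]]]|[_ [v [nv pv -> Zr]]]].
  - by case=> // -[r r0 [_ e]]; exfalso; apply: nonpos_not_one r0 _; exact/esym.
  - by case=> // -[r r0 [e _]]; right; exact: xcR.
  - case=> r r01 /=; rewrite !subr0 !add0r mulr1 => -[e re].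
    by right; apply: xcR => //; move: e; rewrite -re mul1r.
  - by move=> /Zr[y yb [e]]; rewrite -e in yb; exact: xcm.
pose meets E1 E2 z := exists w, [/\ E1 w, E2 w & z = pos w].
have meetC E1 E2 z : meets E1 E2 z -> meets E2 E1 z by case=> w [a b c]; exists w.
have main n1 n2 E1 E2 Z1 Z2 z : (n1 <= n2)%N -> kind n1 E1 Z1 -> kind n2 E2 Z2 ->
    E1 <> E2 -> Z1 z -> Z2 z -> meets E1 E2 z.
  move=> le k1 k2 ne; have v1 w := vertex _ _ _ w k1; have v2 w := vertex _ _ _ w k2.
  suff : Z1 z -> Z2 z -> exists w, z = pos w.
    by move=> H h1 h2; have [w zw] := H h1 h2; exists w; split=> //; [apply: v1|apply: v2]; rewrite -zw.
  move: {v1 v2} k1 le ne => [[-> E1E ->]|[-> [a [na E1E ->]]]|[-> [a [na E1E ->]]]|[-> [a [na pa E1E Zr1]]]];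
  move: k2 => [[-> E2E ->]|[-> [b [nb E2E ->]]]|[-> [b [nb E2E ->]]]|[-> [b [nb pb E2E Zr2]]]] // _ ne.
  - by case: ne; rewrite E1E E2E.
  - case=> [-> _|[r r0 ->]]; first by exists s.
    by case=> // -[q q0 [_ e]]; exfalso; exact: (nonpos_not_above r0 q0).
  - case=> [-> [q _] //|[r r0 ->]] [q q01] /=; rewrite !subr0 !add0r mulr1 => -[e0 e].
    have q0 : q = 0 by apply: (nonpos_nonneg r0 _); [case/andP: q01|rewrite add0r].
    by exists t; rewrite post e q0.
  - case=> [-> /Zr2[] //|[r r0 ->]] /Zr2[y _ [_ e]]; exfalso; exact: (nonpos_not_one r0).
  - case=> [-> _|[r r0 ->]]; first by exists s.
    case=> // -[q q0 [e _]]; case: ne; rewrite E1E E2E; congr [set _; _].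
    by apply/esym; exact: xcR.
  - case=> [-> [] //|[r r0 ->]] [q /andP[q0 q1]] /=; rewrite !subr0 !add0r mulr1 => /Some_inj e.
    have [r00 _ _] := ray_ends r0 q1 e.
    by exists a; rewrite (posu _ na) r00 mulr0 addr0.
  - case=> [-> /Zr2[] //|[r r0 ->]] /Zr2[y _ [_ e]].
    have [r00 _ _] : [/\ r = 0, (1 : K) = 1 & y = y].
      by apply: (ray_ends r0 (lexx 1)); rewrite -[RHS]/(y, 1); congr (_, _).
    by exists a; rewrite (posu _ na) r00 mulr0 addr0.
  - case=> r r01 -> [q q01] /=; rewrite !subr0 !add0r !mulr1 => /Some_inj e.
    have [r0|x] := spokes_meet e; first by exists t; rewrite post r0 mul0r.
    by case: ne; rewrite E1E E2E (xcR _ _ na nb x).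
  - case=> r r01 -> /Zr2[y _] /=; rewrite !subr0 !add0r mulr1 => -[_ e].
    by exists a; rewrite (posu _ na) e mul1r.
  move=> /Zr1[y yb ->] /Zr2[y' yb' [e]]; rewrite -e in yb'.
  have be := unit_intervals_meet yb yb'.
  case: ne; rewrite E1E E2E; apply: unordered_pair.
  by have [->|->] := baseE _ _ na nb be; [left|right; rewrite pp].
apply: (@sphere_drawing K G pos P).
- move=> u v; have [us|us] := pselect (u = s); have [vs|vs] := pselect (v = s).
  + by rewrite us vs.
  + by rewrite us poss posE.
  + by rewrite vs poss posE.
  have [ut|ut] := pselect (u = t); have [vt|vt] := pselect (v = t).
  + by rewrite ut vt.
  + by rewrite ut post posu => [[_ /eqP]|[]//]; rewrite eq_sym oner_eq0.
  + by rewrite vt post posu => [[_ /eqP]|[]//]; rewrite oner_eq0.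
  have nu : ~ core u by case. have nv : ~ core v by case.
  by rewrite !posu // => -[e]; apply/esym; exact: xcR.
- move=> u v uv; have uv' : u <> v by move=> e; move: uv; rewrite e; exact: adj_irrefl.
  have sq w : (if `[< w = t >] then -1 else 1 : K) ^+ 2 = 1.
    by case: ifP; rewrite ?sqrrN expr1n.
  rewrite /P; have [us|us] := pselect (u = s); have [vs|vs] := pselect (v = s).
  + by case: uv'; rewrite us vs.
  + by rewrite us (asboolT (erefl s)) (asboolF vs) poss posE //; split=> //; exact: straight_in.
  + by rewrite vs (asboolT (erefl s)) (asboolF us) poss posE //; split=> //; exact: straight_out.
  rewrite (asboolF us) (asboolF vs) !posE //; split; last exact: seg_sym.
  apply: straight_seg; rewrite /place; case: asboolP => ut; case: asboolP => vt.
  + by case: uv'; rewrite ut vt.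
  + by case=> _ /eqP; rewrite eq_sym oner_eq0.
  + by case=> _ /eqP; rewrite oner_eq0.
  have nu : ~ core u by case. have nv : ~ core v by case.
  by case=> e; apply: uv'; apply/esym; exact: xcR.
- by move=> u v w /edge[n kn] /(vertex _ _ _ _ kn).
move=> u v x y z /edge[n1 k1] /edge[n2 k2] ne Pz Pz'.
have [le|le] := leqP n1 n2; first exact: (main _ _ _ _ _ _ _ le k1 k2).
by apply: meetC; apply: (main _ _ _ _ _ _ _ (ltnW le) k2 k1) => //; exact/nesym.
Qed.

End Drawings.

(** * Ideals as sets *)

Section Ideals.
Local Open Scope ring_scope.
Local Open Scope classical_set_scope.
Variable R : comNzRingType.
Implicit Types I J A B W : set R.

Lemma ideal0 I : is_ideal I -> I 0. Proof. by case. Qed.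
Lemma idealD I a b : is_ideal I -> I a -> I b -> I (a + b). Proof. by case=> _ h _; exact: h. Qed.
Lemma idealMl I a b : is_ideal I -> I b -> I (a * b). Proof. by case=> _ _ h; exact: h. Qed.
Lemma idealMr I a b : is_ideal I -> I a -> I (a * b). Proof. by rewrite mulrC; exact: idealMl. Qed.
Lemma idealN I a : is_ideal I -> I a -> I (- a). Proof. by rewrite -mulN1r; exact: idealMl. Qed.
Lemma idealB I a b : is_ideal I -> I a -> I b -> I (a - b).
Proof. by move=> hI Ia Ib; apply: idealD => //; exact: idealN. Qed.

Definition span (x : R) : set R := [set y | exists r, y = r * x].
Definition scaled (I : set R) (x : R) : set R := [set y | exists2 r, I r & y = r * x].
Definition plus (I J : set R) : set R := [set y | exists a b, [/\ I a, J b & y = a + b]].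
Definition prodz (I J : set R) : Prop := forall a b, I a -> J b -> a * b = 0.
(** The product of two ideals, as the least ideal that contains all products. *)
Definition prodI (I J : set R) : set R :=
  [set x | forall A, is_ideal A -> (forall a b, I a -> J b -> A (a * b)) -> A x].
Definition annih (x : R) : set R := [set r | r * x = 0].

Lemma span_ideal x : is_ideal (span x).
Proof.
split; first by exists 0; rewrite mul0r.
  by move=> _ _ [r ->] [s ->]; exists (r + s); rewrite mulrDl.
by move=> r _ [s ->]; exists (r * s); rewrite mulrA.
Qed.

Lemma span_self x : span x x. Proof. by exists 1; rewrite mul1r. Qed.

Lemma span_sub I x : is_ideal I -> I x -> span x `<=` I.
Proof. by move=> hI Ix _ [r ->]; exact: idealMl. Qed.

Lemma scaled_ideal I x : is_ideal I -> is_ideal (scaled I x).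
Proof.
move=> hI; split; first by exists 0; [exact: ideal0|rewrite mul0r].
  by move=> _ _ [r Ir ->] [s Is ->]; exists (r + s); [exact: idealD|rewrite mulrDl].
by move=> r _ [s Is ->]; exists (r * s); [exact: idealMl|rewrite mulrA].
Qed.

Lemma plus_ideal I J : is_ideal I -> is_ideal J -> is_ideal (plus I J).
Proof.
move=> hI hJ; split; first by exists 0, 0; rewrite addr0; split=> //; exact: ideal0.
  move=> _ _ [a [b [Ia Jb ->]]] [a' [b' [Ia' Jb' ->]]]; exists (a + a'), (b + b').
  by split; [exact: idealD|exact: idealD|rewrite addrACA].
move=> r _ [a [b [Ia Jb ->]]]; exists (r * a), (r * b).
by split; [exact: idealMl|exact: idealMl|rewrite mulrDr].
Qed.

Lemma plus_subl I J : is_ideal J -> I `<=` plus I J.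
Proof. by move=> hJ x Ix; exists x, 0; rewrite addr0; split=> //; exact: ideal0. Qed.

Lemma plus_subr I J : is_ideal I -> J `<=` plus I J.
Proof. by move=> hI x Jx; exists 0, x; rewrite add0r; split=> //; exact: ideal0. Qed.

Lemma plus_sub I J A : is_ideal A -> I `<=` A -> J `<=` A -> plus I J `<=` A.
Proof. by move=> hA IA JA _ [a [b [Ia Jb ->]]]; apply: idealD => //; [exact: IA|exact: JA]. Qed.

Lemma prodI_ideal I J : is_ideal (prodI I J).
Proof.
split; first by move=> A hA _; exact: ideal0.
  by move=> a b ha hb A hA h; apply: idealD => //; [exact: ha|exact: hb].
by move=> r a ha A hA h; apply: idealMl => //; exact: ha.
Qed.

Lemma prodI_mul I J a b : I a -> J b -> prodI I J (a * b).
Proof. by move=> Ia Jb A _; exact. Qed.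

Lemma prodI_min I J A : is_ideal A -> (forall a b, I a -> J b -> A (a * b)) -> prodI I J `<=` A.
Proof. by move=> hA h x; exact. Qed.

Lemma prodI_subr I J : is_ideal J -> prodI I J `<=` J.
Proof. by move=> hJ; apply: prodI_min => // a b _; exact: idealMl. Qed.

Lemma prodI_subl I J : is_ideal I -> prodI I J `<=` I.
Proof. by move=> hI; apply: prodI_min => // a b Ia _; exact: idealMr. Qed.

Lemma annih_ideal x : is_ideal (annih x).
Proof.
split; rewrite /annih /mkset; first by rewrite mul0r.
  by move=> a b ha hb; rewrite mulrDl ha hb addr0.
by move=> r a ha; rewrite -mulrA ha mulr0.
Qed.

Lemma zero_ideal : is_ideal [set 0 : R].
Proof. by split=> // [a b -> ->|r a ->]; rewrite ?addr0 ?mulr0. Qed.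

Lemma full_ideal : is_ideal [set: R]. Proof. by []. Qed.

Lemma ideal_neq0 I : is_ideal I -> I <> [set 0] -> exists2 x, I x & x != 0.
Proof.
move=> hI I0; apply: contrapT => n; apply: I0; apply/seteqP; split=> x; last first.
  by move=> ->; exact: ideal0.
by move=> Ix; apply: contrapT => x0; apply: n; exists x => //; exact/eqP.
Qed.

Definition many (W : set R) : Prop := infinite_set [set I | is_ideal I /\ I `<=` W].

(** What a drawing on a surface leaves of the product of ideals: when J has
    infinitely many subideals, three nonzero subideals of I and the subideals
    of J would form a complete bipartite graph between 3 and infinitely many
    vertices. *)
Definition thin_annihilators : Prop := forall I J A B C : set R,
  is_ideal I -> is_ideal J -> prodz I J -> many J ->
  is_ideal A -> is_ideal B -> is_ideal C -> A `<=` I -> B `<=` I -> C `<=` I ->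
  A <> [set 0] -> B <> [set 0] -> C <> [set 0] -> A <> B -> A <> C -> B <> C -> False.

Definition nilpotent_or_invertible : Prop :=
  forall r : R, (exists n, r ^+ n = 0) \/ exists s, s * r = 1.

Lemma many_sub W W' : W `<=` W' -> many W -> many W'.
Proof. by move=> WW'; apply: sub_infinite_set => I [hI IW]; split=> // x /IW /WW'. Qed.

Lemma many_neq0 W : many W -> W <> [set 0].
Proof.
move=> + W0; apply; rewrite W0; apply: (sub_finite_set _ (finite_set1 [set 0 : R])).
move=> I [hI I0]; apply/seteqP; split=> // x ->; exact: ideal0.
Qed.

Hypothesis art : artinian R.

Lemma ideal_min (F : set (set R)) : (forall I, F I -> is_ideal I) -> F !=set0 ->
  exists2 I, F I & forall J, F J -> J `<=` I -> J = I.
Proof.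
move=> Fi [I0 FI0]; apply: contrapT => nomin.
have smaller (I : set R) : exists J, F I -> [/\ F J, J `<=` I & J <> I].
  have [FI|nI] := pselect (F I); last by exists I.
  apply: contrapT => n; apply: nomin; exists I => // J FJ JI.
  by apply: contrapT => JnI; apply: n; exists J.
have [f fP] := choice smaller.
pose s := fix s n := if n is n'.+1 then f (s n') else I0.
have Fs n : F (s n) by elim: n => //= n /fP[].
have [n hn] := art (fun n => Fi _ (Fs n)) (fun n => let: And3 _ h _ := fP _ (Fs n) in h).
by have [_ _] := fP _ (Fs n); apply; exact: (hn n.+1).
Qed.

(** The chain of the powers of r becomes stationary, and r ^ n in (r ^ 2n) makes
    r ^ n b idempotent. *)
Lemma power_idempotent (r : R) : exists n b, [/\ (r ^+ n * b) * (r ^+ n * b) = r ^+ n * b &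
  r ^+ n * (r ^+ n * b) = r ^+ n] /\ (0 < n)%N.
Proof.
have [|n hn] := art (fun n => span_ideal (r ^+ n)).
  by move=> n _ [a ->]; exists (a * r); rewrite exprS mulrA.
have : span (r ^+ (n.+1 + n.+1)) (r ^+ n.+1).
  rewrite (hn (n.+1 + n.+1)%N); last lia.
  by rewrite -(hn n.+1) //; exact: span_self.
move=> [b hb]; exists n.+1, b; split=> //.
have E : r ^+ n.+1 * (r ^+ n.+1 * b) = r ^+ n.+1.
  by rewrite {3}hb exprD; ring.
by split=> //; rewrite {1}[_ * b]mulrC -mulrA E mulrC.
Qed.

End Ideals.

(** * Reduction to a local ring *)

Section LocalReduction.
Local Open Scope ring_scope.
Local Open Scope classical_set_scope.
Variable R : comNzRingType.
Hypothesis art : artinian R.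
Hypothesis star : thin_annihilators R.

Lemma many_split (e f h : R) : e = f + h -> f * h = 0 -> f * f = f -> h * h = h ->
  many (span e) -> many (span f) \/ many (span h).
Proof.
move=> eE fh ff hh me; apply: contrapT => /not_orP[/contrapT fin1 /contrapT fin2]; apply: me.
apply: (sub_finite_set _ (finite_image (fun p => plus p.1 p.2) (finite_setX fin1 fin2))).
move=> I [hI Ie]; exists (scaled I f, scaled I h) => /=.
  by split; split; [exact: scaled_ideal|move=> _ [r Ir ->]; exists r|exact: scaled_ideal|move=> _ [r Ir ->]; exists r].
apply/seteqP; split=> [_ [_ [_ [[r Ir ->] [s Is ->] ->]]]|x Ix].
  by apply: idealD => //; exact: idealMr.
have xe : x = x * f + x * h.
  by have [r ->] := Ie x Ix; rewrite eE -!mulrA !(mulrDl f h) ff hh (mulrC h) fh add0r addr0 mulrDr.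
by exists (x * f), (x * h); split=> //; [exists x|exists x].
Qed.

Lemma idem_compl (e : R) : e * e = e -> e * (1 - e) = 0 /\ (1 - e) * (1 - e) = 1 - e.
Proof.
move=> ee; have e0 : e * (1 - e) = 0 by rewrite mulrBr mulr1 ee subrr.
by split=> //; rewrite mulrBl e0 mul1r subr0.
Qed.

(** Choose an idempotent e with e R minimal among those with infinitely many
    ideals inside.  In e R every element is nilpotent or a generator, since it
    would otherwise split e into smaller idempotents.  If e is not 1, let S be a
    minimal nonzero ideal inside e R and B = (1 - e) R.  The ideals S, B and
    S + B are killed by the annihilator of S in e R, which contains every proper
    ideal of e R and so has infinitely many subideals. *)
Lemma nilpotent_or_unit : many [set: R] -> nilpotent_or_invertible R.
Proof.
move=> mR; rewrite /nilpotent_or_invertible.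
pose F := [set I : set R | exists e, [/\ e * e = e, I = span e & many I]].
have [||I0 [e [ee -> me]] emin] := @ideal_min R art F.
- by move=> _ [e [_ -> _]]; exact: span_ideal.
- exists (span 1), 1; rewrite mulr1; split=> //.
  by apply: many_sub mR => x _; exists x; rewrite mulr1.
have es x : span e x -> x * e = x by move=> [r ->]; rewrite -mulrA ee.
have loc r : span e r -> (exists n, r ^+ n = 0) \/ span r e.
  move=> er; have [n [b [[ff rf] n0]]] := power_idempotent art r.
  have re k : (0 < k)%N -> span e (r ^+ k).
    by case: k => // k _; rewrite exprS; apply: idealMr => //; exact: span_ideal.
  set f := r ^+ n * b in ff rf.
  have ef : span e f by apply: idealMr (re n n0); exact: span_ideal.
  have fe : f * e = f by exact: es.
  have [ef0 _] := idem_compl ff.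
  have eE : e = f + (e - f) by rewrite addrC subrK.
  have [mf|mh] : many (span f) \/ many (span (e - f)).
    apply: (many_split eE) => //; first by rewrite mulrBr fe ff subrr.
    by rewrite mulrBl !mulrBr ee fe ff (mulrC e) fe; ring.
  - right; have fI : span f = span e.
      by apply: emin; [exists f|apply: span_sub => //; exact: span_ideal].
    have : span f e by rewrite fI; exact: span_self.
    move=> [s ->]; apply: idealMl; first exact: span_ideal.
    by rewrite /f -(prednK n0) exprSr; exists (r ^+ n.-1 * b); ring.
  left; exists n.
  have fI : span (e - f) = span e.
    apply: emin; last first.
      by apply: span_sub; [exact: span_ideal|apply: idealB => //; [exact: span_ideal|exact: span_self]].
    exists (e - f); split=> //.
    by rewrite mulrBl !mulrBr ee fe ff (mulrC e) fe; ring.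
  have : span (e - f) e by rewrite fI; exact: span_self.
  move=> [s sE]; have f0 : f = 0.
    by rewrite -fe sE mulrCA mulrBr fe ff subrr mulr0.
  by rewrite -rf f0 mulr0.
have [e1|e1] := eqVneq e 1.
  move=> r; have [|[n rn]|[s sE]] := loc r; first by exists r; rewrite e1 mulr1.
    by left; exists n.
  by right; exists s; rewrite -sE.
exfalso.
(* otherwise a minimal ideal S of eR and the complementary factor annihilate too much *)
pose FS := [set I : set R | [/\ is_ideal I, I `<=` span e & I <> [set 0]]].
have [||S [hS Se S0] Smin] := @ideal_min R art FS.
- by move=> I [].
- by exists (span e); split=> //; [exact: span_ideal|exact: many_neq0].
have nilS r : span e r -> (exists n, r ^+ n = 0) -> forall s, S s -> r * s = 0.
  move=> er [n rn]; have [sc|sc] := pselect (scaled S r = [set 0]).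
    by move=> s Ss; have : scaled S r (r * s) by [exists s; rewrite // mulrC]; rewrite sc.
  have scS : scaled S r = S.
    apply: Smin; last by move=> _ [s Ss ->]; exact: idealMr.
    by split=> //; [exact: scaled_ideal|move=> _ [s Ss ->]; apply: idealMl => //; exact: span_ideal].
  exfalso; apply: S0; apply/seteqP; split=> x; last by move=> ->; exact: ideal0.
  move=> Sx; have : forall k, exists2 y, S y & x = y * r ^+ k.
    elim=> [|k [y Sy ->]]; first by exists x; rewrite // expr0 mulr1.
    move: Sy; rewrite -{1}scS => -[z Sz ->]; exists z => //; by rewrite exprS mulrA.
  by move=> /(_ n)[y _ ->]; rewrite rn mulr0.
pose J := [set r | span e r /\ forall s, S s -> r * s = 0].
have hJ : is_ideal J.
  have he := span_ideal e; split.
  - by split=> [|s _]; [exact: ideal0|rewrite mul0r].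
  - move=> a b [ea ha] [eb hb]; split=> [|s Ss]; first exact: idealD.
    by rewrite mulrDl ha // hb // addr0.
  move=> r a [ea ha]; split=> [|s Ss]; first exact: idealMl.
  by rewrite -mulrA ha // mulr0.
have mJ : many J.
  move=> fJ; apply: me; apply: (sub_finite_set _ (_ : finite_set ([set span e] `|` [set I | is_ideal I /\ I `<=` J]))).
    move=> I [hI Ie]; have [Ieq|In] := pselect (I = span e); [by left|right; split=> // r Ir].
    split; first exact: Ie.
    apply: nilS; first exact: Ie.
    have [//|re] := loc r (Ie r Ir); exfalso; apply: In; apply/seteqP; split=> //.
    apply: span_sub => //; have [s ->] := re; exact: idealMl.
  by rewrite finite_setU; split=> //; exact: finite_set1.
pose B := span (1 - e).
have [ee0 _] := idem_compl ee.
have hB : is_ideal B := span_ideal _.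
have eB x : span e x -> B x -> x = 0.
  by move=> [r ->] [s E]; rewrite -ee mulrA E -mulrA (mulrC _ e) ee0 mulr0.
have n1 : 1 - e != 0 by rewrite subr_eq0 eq_sym.
have B0 : B <> [set 0].
  by move=> E; have : B (1 - e) by [exact: span_self]; rewrite E => /eqP; rewrite (negPf n1).
have SB : S <> B.
  move=> E; have [x Sx x0] := ideal_neq0 hS S0; move/eqP: x0; apply; apply: eB; first exact: Se.
  by rewrite -E.
have hSB := plus_ideal hS hB.
apply: (star hSB hJ _ mJ hS hB hSB (plus_subl hB) (plus_subr hS) _ S0 B0 _ SB) => //.
- move=> _ j [a [_ [Sa [r ->] ->]]] [[q ->] hj]; rewrite mulrDl (mulrC a) hj // add0r.
  by rewrite -(mulrA r) (mulrCA (1 - e)) (mulrC (1 - e)) ee0 !mulr0.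
- move=> E; apply: S0; apply/seteqP; split=> x; last by move=> ->; exact: ideal0.
  by rewrite -E; exact: plus_subl.
- move=> E; move/eqP: n1; apply; apply: eB; last exact: span_self.
  by apply: Se; rewrite E; apply: plus_subr => //; exact: span_self.
move=> E; have [x Sx x0] := ideal_neq0 hS S0; move/eqP: x0; apply; apply: eB; first exact: Se.
by rewrite E; exact: plus_subl.
Qed.

End LocalReduction.

(** * The radical of the local ring *)

Section LocalRing.
Local Open Scope ring_scope.
Local Open Scope classical_set_scope.
Variable R : comNzRingType.
Hypothesis art : artinian R.
Hypothesis nu : nilpotent_or_invertible R.

Definition nilp : set R := [set r | exists n, r ^+ n = 0].
Notation M := nilp.

Lemma nilp_no1 : ~ M 1.
Proof. by move=> [n]; rewrite expr1n => /eqP; rewrite oner_eq0. Qed.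

Lemma unit_of r : ~ M r -> exists s, s * r = 1.
Proof. by case: (nu r). Qed.

Lemma nilpMl a r : M a -> M (r * a).
Proof. by move=> [n an]; exists n; rewrite exprMn an mulr0. Qed.

Lemma unit_not_nilp r s : s * r = 1 -> ~ M r.
Proof. by move=> sr Mr; apply: nilp_no1; rewrite -sr; exact: nilpMl. Qed.

Lemma one_sub_unit r : M r -> exists s, s * (1 - r) = 1.
Proof.
move=> [n rn]; exists (\sum_(i < n) r ^+ i).
transitivity (- ((r - 1) * \sum_(i < n) r ^+ i)); first by ring.
by rewrite -subrX1 rn sub0r opprK.
Qed.

Lemma nilp_ideal : is_ideal M.
Proof.
split; first by exists 1%N; rewrite expr1.
  move=> a b Ma Mb; have [//|[s sab]] := nu (a + b).
  have [t tE] := one_sub_unit (nilpMl s Ma).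
  exfalso; apply: (@unit_not_nilp b (t * s)) => //.
  by rewrite -tE -sab; ring.
by move=> r a; exact: nilpMl.
Qed.

Lemma fixed_by_nilp m x : M m -> x = m * x -> x = 0.
Proof.
move=> /one_sub_unit[s sE] xE.
by rewrite -[x]mul1r -sE -mulrA mulrBl mul1r -xE subrr mulr0.
Qed.

Definition radical_power (k : nat) : set R := iter k (prodI M) [set: R].

Lemma radical_power_ideal k : is_ideal (radical_power k).
Proof. by case: k => [|k]; [exact: full_ideal|exact: prodI_ideal]. Qed.

Lemma radical_power_sub k : radical_power k.+1 `<=` radical_power k.
Proof. exact: (@prodI_subr _ M (radical_power k) (radical_power_ideal k)). Qed.

Lemma radical_power_mul a b : radical_power (a + b) `<=` prodI (radical_power a) (radical_power b).
Proof.
elim: a => [|a IH]; first by move=> x xb; rewrite -[x]mul1r; exact: prodI_mul.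
apply: prodI_min => [|m x Mm xab]; first exact: prodI_ideal.
pose A := [set x | prodI (radical_power a.+1) (radical_power b) (m * x)].
have hA : is_ideal A.
  have hP := prodI_ideal (radical_power a.+1) (radical_power b); split; rewrite /A /mkset.
  - by rewrite mulr0; exact: ideal0.
  - by move=> y z hy hz; rewrite mulrDr; exact: (idealD hP).
  by move=> r y hy; rewrite mulrCA; exact: (idealMl _ hP).
apply: (IH _ xab A hA) => p q pa qb.
by rewrite /A /mkset mulrA; apply: prodI_mul => //; exact: prodI_mul.
Qed.

(** If the stable power P of M were not 0, let J be a minimal ideal with J P not 0
    and x in J with x P not 0.  Then x P = J contains x, so x is a multiple of
    itself by a nilpotent and vanishes. *)
Lemma nilpotent_radical : exists n, radical_power n = [set 0].
Proof.
have [n hn] := art radical_power_ideal radical_power_sub.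
exists n; apply: contrapT => I0.
have II : radical_power n `<=` prodI (radical_power n) (radical_power n).
  by move=> x; rewrite -{1}(hn (n + n)%N) ?leq_addl //; exact: radical_power_mul.
have IM : radical_power n `<=` M.
  by rewrite -(hn n.+1 (leqnSn n)); exact: (@prodI_subl _ M (radical_power n) nilp_ideal).
pose F := [set J : set R | is_ideal J /\ ~ prodz J (radical_power n)].
have [||J [hJ JI] Jmin] := @ideal_min R art F.
- by move=> J [].
- exists (radical_power n); split; [exact: radical_power_ideal|move=> z; apply: I0].
  apply/seteqP; split=> x; last by move=> ->; exact: (ideal0 (radical_power_ideal n)).
  by move=> /II; exact: (prodI_min (zero_ideal R) z).
apply: JI => x i Jx Ii; apply: contrapT => xi.
have scJ : scaled (radical_power n) x = J.
  apply: Jmin; last by move=> _ [r _ ->]; exact: idealMl.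
  split=> [|z]; first exact: (scaled_ideal _ (radical_power_ideal n)).
  apply: xi; rewrite mulrC.
  suff : prodI (radical_power n) (radical_power n) `<=` annih x by move=> /(_ _ (II _ Ii)).
  apply: prodI_min => [|a b ha hb]; first exact: annih_ideal.
  by rewrite /annih /mkset mulrAC z //; exists a.
have : scaled (radical_power n) x x by rewrite scJ.
by move=> [r Ir xE]; apply: xi; rewrite (fixed_by_nilp (IM _ Ir) xE) mul0r.
Qed.

Lemma nakayama (W X : set R) : is_ideal W -> is_ideal X ->
  W `<=` plus X (prodI M W) -> W `<=` X.
Proof.
move=> hW hX WX; have [n n0] := nilpotent_radical.
suff H k : W `<=` plus X (prodI (radical_power k) W).
  move=> w /(H n)[x [y [Xx + ->]]]; rewrite n0 => py.
  suff -> : y = 0 by rewrite addr0.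
  by apply: (py _ (zero_ideal R)) => a b -> _; rewrite mul0r.
elim: k => [|k IH] w Ww.
  by apply: plus_subr => //; rewrite -[w]mul1r; exact: prodI_mul.
have hT := plus_ideal hX (prodI_ideal (radical_power k.+1) W).
have [x [y [Xx Py ->]]] := IH w Ww; apply: idealD => //.
  by apply: plus_subl Xx; exact: prodI_ideal.
apply: (Py _ hT) => p w' pk /WX[x' [y' [Xx' Py' ->]]]; rewrite mulrDr; apply: idealD => //.
  by apply: plus_subl; [exact: prodI_ideal|exact: idealMl].
apply: plus_subr => //.
pose A := [set z | prodI (radical_power k.+1) W (p * z)].
have hA : is_ideal A.
  have hP := prodI_ideal (radical_power k.+1) W; split; rewrite /A /mkset.
  - by rewrite mulr0; exact: ideal0.
  - by move=> a b ha hb; rewrite mulrDr; exact: (idealD hP).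
  by move=> r a ha; rewrite mulrCA; exact: (idealMl _ hP).
apply: (Py' _ hA) => m z Mm Wz; rewrite /A /mkset mulrA; apply: prodI_mul => //.
by rewrite mulrC; exact: prodI_mul.
Qed.

(** Over the residue field: in the plane the vectors orthogonal to (c1, c2) form a
    line, so two of them are dependent. *)
Lemma rank_two (c1 c2 p1 q1 p2 q2 : R) : ~ (M c1 /\ M c2) ->
  M (p1 * c1 + q1 * c2) -> M (p2 * c1 + q2 * c2) ->
  exists s t, [/\ ~ (M s /\ M t), M (s * p1 + t * p2) & M (s * q1 + t * q2)].
Proof.
have hM := nilp_ideal.
wlog c1u : c1 c2 p1 q1 p2 q2 / ~ M c1.
  move=> W nc h1 h2; have [M1|n1] := pselect (M c1); last exact: (W c1 c2).
  have [||||s [t [st a b]]] := W c2 c1 q1 p1 q2 p2; last by exists s, t.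
  - by move=> M2; exact: nc.
  - by move=> [a b]; exact: nc.
  - by rewrite addrC.
  - by rewrite addrC.
move=> _ h1 h2; have [d dc] := unit_of c1u.
have pE p q : M (p * c1 + q * c2) -> M (p + q * (d * c2)).
  move=> h; have -> : p + q * (d * c2) = d * (p * c1 + q * c2).
    by rewrite mulrDr [d * (p * c1)]mulrCA dc mulr1; ring.
  exact: idealMl.
have := pE _ _ h1; have := pE _ _ h2; move: (d * c2) => e g2 g1.
have [[Mq1 Mq2]|nq] := pselect (M q1 /\ M q2).
  exists 1, 0; rewrite !mul1r !mul0r !addr0; split=> //; first by case=> /nilp_no1.
  by rewrite -[p1](addrK (q1 * e)); apply: idealB => //; exact: idealMr.
exists q2, (- q1); split.
- move=> [a b]; apply: nq; split=> //; rewrite -[q1]opprK; exact: idealN.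
- have -> : q2 * p1 + - q1 * p2 = q2 * (p1 + q1 * e) - q1 * (p2 + q2 * e) by ring.
  by apply: idealB => //; exact: idealMl.
by have -> : q2 * q1 + - q1 * q2 = 0 by [ring]; exact: ideal0.
Qed.

End LocalRing.

(** * A minimal ideal with infinitely many subideals *)

Section MinimalIdeal.
Local Open Scope ring_scope.
Local Open Scope classical_set_scope.
Variable R : comNzRingType.
Hypothesis art : artinian R.
Hypothesis nu : nilpotent_or_invertible R.
Notation M := (@nilp R).

Variable W : set R.
Hypothesis hW : is_ideal W.
Hypothesis mW : many W.
Hypothesis Wmin : forall U, is_ideal U -> U `<=` W -> many U -> U = W.

Notation V := (prodI M W).
Let hM : is_ideal M := nilp_ideal nu.
Let hV : is_ideal V := prodI_ideal M W.
Let VW : V `<=` W := prodI_subr hW.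

Lemma proper_few U : is_ideal U -> U `<=` W -> U <> W ->
  finite_set [set I | is_ideal I /\ I `<=` U].
Proof. by move=> hU UW nUW; apply: contrapT => mU; apply: nUW; exact: Wmin. Qed.

Lemma nilp_scale m w : M m -> W w -> V (m * w).
Proof. exact: prodI_mul. Qed.

(** The proper subideals of R x lie in M x, which is a proper subideal of W by
    nilpotency and thus has finitely many subideals. *)
Lemma not_principal x : W <> span x.
Proof.
move=> WE; have Wx : W x by rewrite WE; exact: span_self.
have hMx := @scaled_ideal R M x hM.
have MxW : scaled M x `<=` W by move=> _ [r _ ->]; exact: idealMl.
have MxnW : scaled M x <> W.
  move=> E; move: (Wx); rewrite -E => -[m Mm xE].
  have x0 := fixed_by_nilp Mm xE; apply: (many_neq0 mW); rewrite WE x0.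
  by apply/seteqP; split=> [_ [r ->]|_ ->]; [rewrite mulr0|exists 0; rewrite mulr0].
apply: mW; apply: (sub_finite_set _ (_ : finite_set ([set W] `|` [set I | is_ideal I /\ I `<=` scaled M x]))).
  move=> I [hI IW]; have [IE|InW] := pselect (I = W); [by left|right; split=> // y Iy].
  have := IW y Iy; rewrite WE => -[r yE]; exists r => //.
  have [//|[s sr]] := nu r; exfalso; apply: InW; apply/seteqP; split=> //.
  by rewrite WE; apply: span_sub => //; rewrite -[x]mul1r -sr -mulrA -yE; exact: idealMl.
by rewrite finite_setU; split; [exact: finite_set1|exact: proper_few].
Qed.

Lemma W_sub_M : W `<=` M.
Proof.
move=> w Ww; have [//|[s sw]] := nu w; exfalso; apply: (@not_principal 1).
have W1 : W 1 by rewrite -sw; exact: idealMl.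
apply/seteqP; split=> x _; first by exists x; rewrite mulr1.
by rewrite -[x]mulr1; exact: idealMl.
Qed.

Lemma exists_generator : exists2 x, W x & ~ V x.
Proof.
apply: contrapT => n; apply: (many_neq0 mW); apply/seteqP; split=> x; last first.
  by move=> ->; exact: ideal0.
apply: (nakayama art nu hW (zero_ideal R)) => w Ww; apply: plus_subr; first exact: zero_ideal.
by apply: contrapT => nV; apply: n; exists w.
Qed.

Lemma span_plus_V_proper x : W x -> plus (span x) V <> W.
Proof.
move=> Wx E; apply: (@not_principal x); apply/seteqP; split; last exact: span_sub.
by apply: (nakayama art nu hW (span_ideal x)); rewrite E.
Qed.

(** Linear independence over the residue field, modulo T. *)
Definition independent (T : set R) (x y : R) : Prop :=
  forall a b, T (a * x + b * y) -> M a /\ M b.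

Lemma independent_of (T : set R) x y : is_ideal T -> (forall m, M m -> T (m * y)) ->
  ~ T x -> ~ plus (span x) T y -> independent T x y.
Proof.
move=> hT My nx ny a b h.
have Mb : M b.
  have [//|[s sb]] := nu b; exfalso; apply: ny.
  exists (- s * a * x), (s * (a * x + b * y)); split; [by exists (- s * a)|exact: idealMl|].
  by rewrite mulrDr [s * (b * y)]mulrA sb mul1r; ring.
split=> //; have [//|[s sa]] := nu a; exfalso; apply: nx.
rewrite -[x]mul1r -sa -mulrA; apply: idealMl => //.
by rewrite -[a * x](addrK (b * y)); apply: idealB => //; exact: My.
Qed.

(** A maximal ideal between V and W that avoids x has codimension one in W. *)
Lemma hyperplane x : W x -> ~ V x -> exists C, [/\ is_ideal C, V `<=` C, C `<=` W, ~ C x &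
  forall w, W w -> plus C (span x) w].
Proof.
move=> Wx nVx.
(* the empty set is admitted because the union of the empty chain is empty *)
pose P (A : set R) := A = set0 \/ [/\ is_ideal A, V `<=` A, A `<=` W & ~ A x].
have [F FP tot|C [PC Cmax]] := @Zorn_bigcup R P.
  have [[A0 [FA0 A00]]|none] := pselect (exists A, F A /\ A <> set0); last first.
    left; apply/seteqP; split=> // y [A FA Ay]; exfalso; apply: none; exists A; split=> // E.
    by rewrite E in Ay.
  have good A a : F A -> A a -> [/\ is_ideal A, V `<=` A, A `<=` W & ~ A x].
    by move=> FA Aa; case: (FP A FA) => // E; rewrite E in Aa.
  have [a0 Aa0] : exists a, A0 a by apply: contrapT => n; apply: A00; apply/seteqP; split=> // y Ay; apply: n; exists y.
  have [hA0 VA0 A0W nA0] := good _ _ FA0 Aa0.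
  right; split.
  - split.
    + by exists A0 => //; exact: ideal0.
    + move=> a b [A FA Aa] [B FB Bb]; have [hA _ _ _] := good _ _ FA Aa.
      have [hB _ _ _] := good _ _ FB Bb.
      have [AB|BA] := tot A B FA FB.
        by exists B => //; apply: idealD => //; exact: AB.
      by exists A => //; apply: idealD => //; exact: BA.
    move=> r a [A FA Aa]; have [hA _ _ _] := good _ _ FA Aa.
    by exists A => //; exact: idealMl.
  - by move=> v Vv; exists A0 => //; exact: VA0.
  - by move=> a [A FA Aa]; have [_ _ AW _] := good _ _ FA Aa; exact: AW.
  by move=> [A FA Ax]; have [_ _ _ nA] := good _ _ FA Ax.
have {PC}[hC VC CW nCx] : [/\ is_ideal C, V `<=` C, C `<=` W & ~ C x].
  case: PC => // C0; exfalso; apply: (Cmax V); last by right; split.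
  by rewrite C0; split=> // h; have := h 0 (ideal0 hV).
exists C; split=> // y Wy; have [Cy|nCy] := pselect (C y).
  by apply: plus_subl => //; exact: span_ideal.
have hCy := plus_ideal hC (span_ideal y).
have : plus C (span y) x.
  apply: contrapT => nx; apply: (Cmax (plus C (span y))).
    split; first by apply: plus_subl; exact: span_ideal.
    by move=> h; apply: nCy; apply: h; apply: plus_subr => //; exact: span_self.
  right; split=> //; first by move=> v /VC; apply: plus_subl; exact: span_ideal.
  by apply: plus_sub => //; exact: span_sub.
move=> [c [_ [Cc [r ->] xE]]].
have [Mr|[s sr]] := nu r.
  by exfalso; apply: nCx; rewrite xE; apply: idealD => //; apply: VC; exact: nilp_scale.
exists (- (s * c)), (s * x); split; [by apply: idealN => //; exact: idealMl|by exists s|].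
by rewrite xE mulrDr mulrA sr mul1r addKr.
Qed.

Definition coset (r : R) : set R := [set z | M (z - r)].

Lemma coset_eqP r s : coset r = coset s <-> M (r - s).
Proof.
split=> [E|h]; first by have : coset r r by [rewrite /coset /mkset subrr; exact: ideal0]; rewrite E.
apply/seteqP; split=> z; rewrite /coset /mkset => hz.
  by have -> : z - s = (z - r) + (r - s) by [ring]; exact: idealD.
by have -> : z - r = (z - s) - (r - s) by [ring]; exact: idealB.
Qed.

(** Suppose that the residue field is finite.  A hyperplane C of W has finitely
    many subideals, so C / V is finite, and W / V is finite too.  Thus I + V takes
    finitely many values for ideals I inside W.  If I + V is proper it has
    finitely many subideals, and if I + V = W then I = W by Nakayama: W would have
    finitely many subideals. *)
Lemma residue_field_infinite : infinite_set (range coset).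
Proof.
move=> /finite_reps[D1 [finD1 _ D1P]].
have [x Wx nVx] := exists_generator.
have [C [hC VC CW nCx Cx]] := hyperplane Wx nVx.
have CnW : C <> W by move=> E; rewrite E in nCx.
have [D2 [finD2 D2C D2P]] : exists D2, [/\ finite_set D2, D2 `<=` C &
    forall c, C c -> exists2 d, D2 d & plus (span d) V = plus (span c) V].
  apply: finite_reps; apply: (sub_finite_set _ (proper_few hC CW CnW)).
  move=> _ [c Cc <-]; split; first by apply: plus_ideal => //; exact: span_ideal.
  by apply: plus_sub => //; exact: span_sub.
pose D3 := (fun q : (R * R) * R => q.1.1 * q.2 + q.1.2 * x) @` ((D1 `*` D1) `*` D2).
have finD3 : finite_set D3 by apply: finite_image; do 2! apply: finite_setX => //.
have D3P w : W w -> exists2 d, D3 d & V (w - d).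
  move=> /Cx[c [_ [Cc [r ->] ->]]].
  have [d D2d dE] := D2P c Cc.
  have : plus (span d) V c by rewrite dE; apply: plus_subl => //; exact: span_self.
  move=> [_ [v [[r1 ->] Vv ->]]].
  have [s D1s /coset_eqP sr] := D1P r1 I; have [t D1t /coset_eqP tr] := D1P r I.
  exists (s * d + t * x); first by exists (s, t, d).
  have -> : r1 * d + v + r * x - (s * d + t * x) = v - (s - r1) * d - (t - r) * x by ring.
  apply: (idealB hV); last exact: nilp_scale.
  by apply: (idealB hV) => //; apply: nilp_scale => //; apply: CW; exact: D2C.
pose Q := [set I | [/\ is_ideal I, V `<=` I & I `<=` W]].
have finQ : finite_set Q.
  apply: (sub_finite_set _ (finite_image (fun B => [set w | exists2 d, B d & V (w - d)]) (finite_powerset finD3))).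
  move=> I [hI VI IW]; exists (I `&` D3); first by move=> ? [].
  apply/seteqP; split=> w.
    move=> [d [Id _] Vwd]; rewrite -(subrK d w); apply: idealD => //; exact: VI.
  move=> Iw; have [d D3d Vwd] := D3P w (IW w Iw); exists d => //; split=> //.
  by rewrite -[d](subKr w); apply: idealB => //; exact: VI.
apply: mW; apply: (sub_finite_set _ (_ : finite_set ([set W] `|`
   \bigcup_(Q' in Q `&` [set Q' | Q' <> W]) [set I | is_ideal I /\ I `<=` Q']))).
  move=> I [hI IW]; have [IE|InW] := pselect (I = W); [by left|right].
  exists (plus I V); last by split=> //; exact: plus_subl.
  split; first by split; [exact: plus_ideal|exact: plus_subr|exact: plus_sub].
  move=> E; apply: InW; apply/seteqP; split=> //.
  by apply: (nakayama art nu hW hI); rewrite E.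
rewrite finite_setU; split; first exact: finite_set1.
apply: bigcup_finite; first exact: finite_setIl.
by move=> Q' [[hQ _ QW] QnW]; exact: proper_few.
Qed.

Lemma residues : exists l : nat -> R, forall i j, i <> j -> ~ M (l i - l j).
Proof.
have [f [fi fr]] := infinite_seq residue_field_infinite.
have ex n : exists r, coset r = f n by case: (fr n) => r _; exists r.
have [l hl] := choice ex.
by exists l => i j ij /coset_eqP E; apply: ij; apply: fi; rewrite -!hl.
Qed.

(** The lines R (x + l y) + T for l in different residue classes are distinct. *)
Lemma pencil_many (U T : set R) x y : is_ideal U -> is_ideal T -> T `<=` U -> U x -> U y ->
  independent T x y -> many U.
Proof.
move=> hU hT TU Ux Uy ind fin; have [l hl] := residues.
pose A (i : nat) : set R := plus (span (x + l i * y)) T.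
have Ai i j : A i = A j -> i = j.
  move=> E; apply: contrapT => ij; apply: (hl i j ij).
  have : A j (x + l i * y) by rewrite -E; apply: plus_subl => //; exact: span_self.
  move=> [_ [t [[r ->] Tt e]]].
  have : T ((1 - r) * x + (l i - r * l j) * y).
    by have -> : (1 - r) * x + (l i - r * l j) * y = x + l i * y - r * (x + l j * y) by [ring]; rewrite e addrC addKr.
  move=> /ind[M1 M2]; have -> : l i - l j = (l i - r * l j) - (1 - r) * l j by ring.
  by apply: idealB => //; exact: idealMr.
move: fin; apply: (infinite_of_seq Ai) => n; split.
  by apply: plus_ideal => //; exact: span_ideal.
by apply: plus_sub => //; apply: span_sub => //; apply: idealD => //; exact: idealMl.
Qed.

End MinimalIdeal.

(** * Two generators and a dual basis *)

Section DualBasis.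
Local Open Scope ring_scope.
Local Open Scope classical_set_scope.
Variable R : comNzRingType.
Hypothesis art : artinian R.
Hypothesis nu : nilpotent_or_invertible R.
Notation M := (@nilp R).

Variable W : set R.
Hypothesis hW : is_ideal W.
Hypothesis mW : many W.
Hypothesis Wmin : forall U, is_ideal U -> U `<=` W -> many U -> U = W.

Notation V := (prodI M W).
Let hM : is_ideal M := nilp_ideal nu.
Let hV : is_ideal V := prodI_ideal M W.
Let VW : V `<=` W := prodI_subr hW.

Lemma V_independent x y : W x -> W y -> ~ V x -> ~ plus (span x) V y -> independent V x y.
Proof.
by move=> Wx Wy; apply: independent_of => // m Mm; exact: nilp_scale.
Qed.

(** By [pencil_many] the ideal (x, y) + V has infinitely many subideals, so it is
    W by minimality. *)
Lemma two_generators x y : W x -> W y -> ~ V x -> ~ plus (span x) V y ->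
  forall w, W w -> exists a b v, V v /\ w = a * x + b * y + v.
Proof.
move=> Wx Wy nx ny w Ww; have hx := span_ideal x; have hy := span_ideal y.
have hxy := plus_ideal hx hy.
pose U := plus (plus (span x) (span y)) V.
have hU : is_ideal U by exact: plus_ideal.
have UW : U = W.
  apply: Wmin => //.
    by apply: plus_sub => //; apply: plus_sub => //; exact: span_sub.
  apply: (pencil_many art nu hW mW Wmin hU hV _ _ _ (V_independent Wx Wy nx ny)).
  - exact: plus_subr.
  - by apply: plus_subl => //; apply: plus_subl => //; exact: span_self.
  by apply: plus_subl => //; apply: plus_subr => //; exact: span_self.
have : U w by rewrite UW.
move=> [_ [v [[_ [_ [[a ->] [b ->] ->]]] Vv ->]]].
by exists a, b, v.
Qed.

Lemma second_generator x : W x -> exists2 y, W y & ~ plus (span x) V y.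
Proof.
move=> Wx; apply: contrapT => n; apply: (@span_plus_V_proper _ art nu W hW mW Wmin x Wx).
apply/seteqP; split; first by apply: plus_sub => //; exact: span_sub.
by move=> w Ww; apply: contrapT => nw; apply: n; exists w.
Qed.

(** Two elements of U independent modulo M U would give U infinitely many
    subideals, so U / M U has dimension at most one. *)
Lemma proper_principal U : is_ideal U -> U `<=` W -> U <> W -> exists u, U = span u.
Proof.
move=> hU UW UnW; have hMU := prodI_ideal M U.
have MUU : prodI M U `<=` U := prodI_subr hU.
have [[u [Uu nu']]|none] := pselect (exists u, U u /\ ~ prodI M U u).
  exists u; apply/seteqP; split; last exact: span_sub.
  apply: (nakayama art nu hU (span_ideal u)) => v Uv; apply: contrapT => nv.
  apply: UnW; apply: Wmin => //.
  apply: (pencil_many art nu hW mW Wmin hU hMU MUU Uu Uv).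
  by apply: independent_of => // m Mm; exact: prodI_mul.
exists 0; apply/seteqP; split.
  apply: (nakayama art nu hU (span_ideal 0)) => v Uv; apply: plus_subr; first exact: span_ideal.
  by apply: contrapT => nv; apply: none; exists v.
by apply: span_sub => //; exact: ideal0.
Qed.

(** R x + V is a proper subideal of W, hence principal, and x generates it modulo
    M; so V lies in R x. *)
Lemma V_from_generator x v : W x -> ~ V x -> V v -> exists2 m, M m & v = m * x.
Proof.
move=> Wx nx Vv; have hx := span_ideal x.
have hA := plus_ideal hx hV.
have [||x' AE] := proper_principal hA.
- by apply: plus_sub => //; exact: span_sub.
- exact: span_plus_V_proper.
have Ax' : plus (span x) V x' by rewrite AE; exact: span_self.
have Wx' : W x' by apply: (plus_sub hW _ _ Ax') => //; exact: span_sub.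
have : plus (span x) V x by apply: plus_subl => //; exact: span_self.
rewrite {1}AE => -[r xE].
have [Mr|[s sr]] := nu r.
  by exfalso; apply: nx; rewrite xE; exact: nilp_scale.
have : plus (span x) V v by exact: plus_subr.
rewrite AE => -[p vE]; have vx : v = (p * s) * x.
  by rewrite vE {1}xE -mulrA (mulrA s) sr mul1r.
exists (p * s) => //; have [//|[q qE]] := nu (p * s); exfalso; apply: nx.
by rewrite -[x]mul1r -qE -mulrA -vx; exact: (idealMl _ hV).
Qed.

Lemma V_principal : exists u, V = span u.
Proof.
apply: proper_principal => // VE; have [x Wx] := exists_generator art nu hW mW.
by rewrite VE.
Qed.

Variable u : R.
Hypothesis Vu : V = span u.

Let Vself : V u. Proof. by rewrite Vu; exact: span_self. Qed.

(** Multiplication by M pairs W / V with V = R u; correcting an arbitrary second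
    generator and its multiplier makes the pairing diagonal. *)
Lemma dual_basis x : W x -> ~ V x -> exists y z1 z2,
  [/\ W y, ~ plus (span x) V y, M z1 & M z2] /\
  [/\ z1 * x = u, z1 * y = 0, z2 * x = 0 & z2 * y = u].
Proof.
move=> Wx nx; have [y0 Wy0 ny0] := second_generator Wx.
have [z1 Mz1 z1x] := V_from_generator Wx nx Vself.
have : V (z1 * y0) by exact: nilp_scale.
rewrite {1}Vu => -[al z1y0].
pose y := y0 - al * x.
have Wy : W y by apply: idealB => //; exact: idealMl.
have ny : ~ plus (span x) V y.
  move=> [_ [v [[r ->] Vv e]]]; apply: ny0; exists ((r + al) * x), v; split=> //; first by exists (r + al).
  by rewrite mulrDl addrAC -e /y subrK.
have nVy : ~ V y by move=> Vy; apply: ny; apply: plus_subr => //; exact: span_ideal.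
have z1y : z1 * y = 0 by rewrite /y mulrBr z1y0 mulrCA -z1x subrr.
have [z' Mz' z'y] := V_from_generator Wy nVy Vself.
have : V (z' * x) by exact: nilp_scale.
rewrite {1}Vu => -[be z'x].
exists y, z1, (z' - be * z1); split; split=> //.
- by apply: idealB => //; exact: idealMl.
- by rewrite mulrBl z'x -mulrA -z1x subrr.
by rewrite mulrBl -mulrA z1y mulr0 subr0.
Qed.

(** u = z1 x, so m u = z1 (m x) is a multiple of z1 u; and z1 u = z1 (z2 y) = 0. *)
Lemma V_killed m : M m -> m * u = 0.
Proof.
move=> Mm; have [x Wx nx] := exists_generator art nu hW mW.
have [y [z1 [z2 [[Wy ny Mz1 Mz2] [z1x z1y z2x z2y]]]]] := dual_basis Wx nx.
have : V (m * x) by exact: nilp_scale.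
rewrite Vu => -[a mx].
have z1u : z1 * u = 0 by rewrite -z2y mulrCA z1y mulr0.
by rewrite -{1}z1x mulrCA mx mulrCA z1u mulr0.
Qed.

Lemma dual_decomposition x y z1 z2 m : W x -> W y -> z1 * x = u -> z1 * y = 0 ->
  z2 * x = 0 -> z2 * y = u -> M m ->
  exists a b, (m - a * z1 - b * z2) * x = 0 /\ (m - a * z1 - b * z2) * y = 0.
Proof.
move=> Wx Wy z1x z1y z2x z2y Mm.
have : V (m * x) by exact: nilp_scale.
have : V (m * y) by exact: nilp_scale.
rewrite Vu => -[b my] [a mx]; exists a, b; split.
  by rewrite !mulrBl -!mulrA z1x z2x mx mulr0 subr0 subrr.
by rewrite !mulrBl -!mulrA z1y z2y my mulr0 subr0 subrr.
Qed.

End DualBasis.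

(** * The two kinds of rings that remain *)

Section Trichotomy.
Local Open Scope ring_scope.
Local Open Scope classical_set_scope.
Variable R : comNzRingType.

(** Modelled on k[z, y] / (z y, y ^ 2 - b z ^ 3) localized at the origin, the cusp
    cut by the coordinate axes; the socle is R z ^ 3. *)
Definition cusp_data (z y b : R) : Prop :=
  [/\ [/\ nilp z, nilp y, z * y = 0 & y * y = b * z ^+ 3],
      ~ nilp b, z ^+ 3 != 0, forall m, nilp m -> m * z ^+ 3 = 0 &
      forall m, nilp m -> exists a c d, m = a * z + c * y + d * z ^+ 2].

(** A pair (x, y) and a dual pair (z1, z2), which may share elements, for the
    multiplication with values in R u, and an anisotropic n orthogonal to both. *)
Definition quadric_data (x y n z1 z2 e u : R) : Prop :=
  [/\ [/\ nilp x, nilp y, nilp n, nilp z1 & nilp z2],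
      [/\ z1 * x = u, z1 * y = 0, z2 * x = 0 & z2 * y = u],
      [/\ n * x = 0, n * y = 0, n * z1 = 0 & n * z2 = 0],
      n * n = e * u /\ ~ nilp e & u != 0 /\ forall m, nilp m -> m * u = 0].

(** In such a ring R u is joined to every other vertex of the graph, and the
    remaining edges form a matching. *)
Definition star_ring (u : R) : Prop :=
  [/\ u != 0, nilp u, forall m, nilp m -> m * u = 0 &
   forall I J1 J2 : set R, is_ideal I -> is_ideal J1 -> is_ideal J2 ->
     I `<=` @nilp R -> J1 `<=` @nilp R -> J2 `<=` @nilp R ->
     I <> [set 0] -> J1 <> [set 0] -> J2 <> [set 0] ->
     I <> span u -> J1 <> span u -> J2 <> span u ->
     prodz I J1 -> prodz I J2 -> J1 = J2].

Hypothesis art : artinian R.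
Hypothesis nu : nilpotent_or_invertible R.
Notation M := (@nilp R).
Let hM : is_ideal M := nilp_ideal nu.

Hypothesis star : thin_annihilators R.
Hypothesis mR : many [set: R].
Hypothesis no_quadric : forall l : nat -> R, (forall i j, i <> j -> ~ M (l i - l j)) ->
  forall x y n z1 z2 e u, quadric_data x y n z1 z2 e u -> False.

Lemma many_three (W : set R) : many W -> exists A B C : set R,
  [/\ [/\ is_ideal A, is_ideal B & is_ideal C], [/\ A `<=` W, B `<=` W & C `<=` W],
      [/\ A <> [set 0], B <> [set 0] & C <> [set 0]] & [/\ A <> B, A <> C & B <> C]].
Proof.
move=> mW; have /infinite_seq[f [fi fP]] := infinite_setD mW (finite_set1 [set 0 : R]).
have ne i j : i <> j -> f i <> f j by move=> ij /fi.
exists (f 0%N), (f 1%N), (f 2%N).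
have [[h0 w0] n0] := fP 0%N; have [[h1 w1] n1] := fP 1%N; have [[h2 w2] n2] := fP 2%N.
by split; split=> //; exact: ne.
Qed.

Lemma span_neq0 (x : R) : x != 0 -> span x <> [set 0].
Proof. by move=> /eqP x0 E; apply: x0; have : span x x by [exact: span_self]; rewrite E. Qed.

(** Let N be the annihilator of W.

    If N = R u, then multiplication by an element r of I outside R u is a nonzero
    linear form on M / N, which has dimension two.  Its kernel is a line, and an
    ideal J other than 0 and R u with I J = 0 can only be the ideal over that line:
    this is the matching.

    Otherwise N = R n with n outside R u, since N has at most two nonzero
    subideals.  If n ^ 2 is not 0 it is a unit multiple of u, and n completes a
    dual basis of W to quadric data.  If n ^ 2 = 0, a rank argument shows that W
    meets N outside R u, so that a generator n = w of N is the first vector of a dual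
    basis (w, v) of W with dual (z, t2).  Then v ^ 2 = b u with b a unit, and z ^ 2
    lies in N = R w: if it does not generate N there are quadric data again, and if
    it does, z and v generate M and satisfy the equations of the cusp. *)
Theorem trichotomy : (exists u, star_ring u) \/ exists z y b, cusp_data z y b.
Proof.
pose F := [set I : set R | is_ideal I /\ many I].
have [||W [hW mW] Wmin0] := @ideal_min R art F.
- by move=> I [].
- by exists setT; split=> //; exact: full_ideal.
have Wmin U : is_ideal U -> U `<=` W -> many U -> U = W by move=> hU UW mU; apply: Wmin0.
have WM := W_sub_M nu hW mW Wmin.
have [l hl] := residues art nu hW mW Wmin.
have [u Vu] := V_principal art nu hW mW Wmin.
set V := prodI M W in Vu.
have hV : is_ideal V := prodI_ideal M W.
have Mu m : M m -> m * u = 0 by exact: (V_killed art nu hW mW Wmin Vu).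
have u0 : u != 0.
  apply/eqP => u0; have WW : prodz W W.
    move=> a b Wa Wb; have : V (a * b) by apply: prodI_mul => //; exact: WM.
    by rewrite Vu u0 => -[r ->]; rewrite mulr0.
  have [A [B [C [[hA hB hC] [AW BW CW] [A0 B0 C0] [AB AC BC]]]]] := many_three mW.
  exact: (star hW hW WW mW hA hB hC AW BW CW).
have hS := span_ideal u; have S0 := span_neq0 u0.
have Vself : V u by rewrite Vu; exact: span_self.
have Wu : W u := prodI_subr hW Vself.
have Mu1 : M u by exact: WM.
have Mcu c : c * u = 0 -> M c.
  move=> cu; have [//|[s sc]] := nu c; exfalso; move/eqP: u0; apply.
  by rewrite -[u]mul1r -sc -mulrA cu mulr0.
pose N := [set r | forall w, W w -> r * w = 0].
have hN : is_ideal N.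
  split; rewrite /N /mkset.
  - by move=> w _; rewrite mul0r.
  - by move=> a b ha hb w Ww; rewrite mulrDl ha // hb // addr0.
  by move=> r a ha w Ww; rewrite -mulrA ha // mulr0.
have NW : prodz N W by move=> r w Nr; exact: Nr.
have gen x y r : W x -> W y -> ~ V x -> ~ plus (span x) V y -> M r ->
    r * x = 0 -> r * y = 0 -> N r.
  move=> Wx Wy nx ny Mr rx ry w Ww.
  have [a [b [v [Vv ->]]]] := two_generators art nu hW mW Wmin Wx Wy nx ny Ww.
  move: Vv; rewrite -/V Vu => -[c ->].
  by rewrite !mulrDr !(mulrCA r) rx ry (Mu r Mr) !mulr0 !addr0.
have SN : span u `<=` N.
  by apply: span_sub => // w Ww; rewrite mulrC Mu //; exact: WM.
have MMN m m' : M m -> M m' -> N (m * m').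
  move=> Mm Mm' w Ww; have : V (m' * w) by exact: prodI_mul.
  by rewrite Vu -mulrA => -[c ->]; rewrite mulrCA Mu // mulr0.
have [x Wx nx] := exists_generator art nu hW mW.
have [y [z1 [z2 [[Wy ny Mz1 Mz2] [z1x z1y z2x z2y]]]]] := dual_basis art nu hW mW Wmin Vu Wx nx.
have Mx := WM x Wx; have My := WM y Wy.
have NM : N `<=` M by move=> r Nr; apply: Mcu; exact: Nr.
have decomp x' y' t1 t2 m : W x' -> W y' -> ~ V x' -> ~ plus (span x') V y' ->
    M t1 -> M t2 -> t1 * x' = u -> t1 * y' = 0 -> t2 * x' = 0 -> t2 * y' = u -> M m ->
    exists a b r, N r /\ m = a * t1 + b * t2 + r.
  move=> Wx' Wy' nx' ny' M1 M2 h1 h2 h3 h4 Mm.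
  have [a [b [r1 r2]]] := dual_decomposition Vu Wx' Wy' h1 h2 h3 h4 Mm.
  exists a, b, (m - a * t1 - b * t2); split; last by ring.
  apply: (gen x' y') => //.
  by apply: (idealB hM); [apply: (idealB hM) => //; exact: (idealMl _ hM)|exact: (idealMl _ hM)].
have dec m : M m -> exists a b r, N r /\ m = a * z1 + b * z2 + r by exact: (decomp x y).
have [NS|] := pselect (N `<=` span u).
  left; exists u; split=> // I J1 J2 hI hJ1 hJ2 IM J1M J2M I0 J10 J20 IS J1S J2S IJ1 IJ2.
  have uI (A : set R) : is_ideal A -> A `<=` M -> A <> [set 0] -> span u `<=` A.
    move=> hA AM A0; apply: span_sub => //.
    have cuA c : c * u != 0 -> A (c * u) -> A u.
      move=> /eqP cu Acu; have [Mc|[s sc]] := nu c; first by case: cu; exact: Mu.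
      by rewrite -[u]mul1r -sc -mulrA; exact: idealMl.
    have [r Ar r0] := ideal_neq0 hA A0.
    have [Nr|nN] := pselect (N r).
      by have [c rE] := NS r Nr; apply: (cuA c); rewrite -rE.
    have [w [Ww rw]] : exists w, W w /\ r * w <> 0.
      by apply: contrapT => nw; apply: nN => w Ww; apply: contrapT => h; apply: nw; exists w.
    have : V (r * w) by apply: prodI_mul => //; exact: AM.
    rewrite Vu => -[c E]; apply: (cuA c); rewrite -E; first exact/eqP.
    exact: idealMr.
  have outside (A : set R) : is_ideal A -> A `<=` M -> A <> [set 0] -> A <> span u ->
      exists2 r, A r & ~ span u r.
    move=> hA AM A0 AS; apply: contrapT => nr; apply: AS; apply/seteqP; split; last exact: uI.
    by move=> r Ar; apply: contrapT => nSr; apply: nr; exists r.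
  have [r Ir nSr] := outside I hI IM I0 IS.
  have Mr := IM r Ir.
  have [c1 rz1] := NS _ (MMN r z1 Mr Mz1).
  have [c2 rz2] := NS _ (MMN r z2 Mr Mz2).
  have r_on p q n : N n -> r * (p * z1 + q * z2 + n) = (p * c1 + q * c2) * u.
    move=> /NS[k ->]; rewrite !mulrDr !(mulrCA r) rz1 rz2 (Mu r Mr) mulr0 addr0 mulrDl.
    by rewrite !mulrA.
  have nc : ~ (M c1 /\ M c2).
    move=> [Mc1 Mc2]; apply: nSr; apply: NS; apply: (gen x y) => //.
      have [a [b [n [Nn xE]]]] := dec x Mx; rewrite {1}xE r_on // Mu //.
      by apply: idealD => //; exact: idealMl.
    have [a [b [n [Nn yE]]]] := dec y My; rewrite {1}yE r_on // Mu //.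
    by apply: idealD => //; exact: idealMl.
  have key j1 j2 : M j1 -> M j2 -> r * j1 = 0 -> r * j2 = 0 -> ~ span u j1 -> ~ span u j2 ->
      exists s t, [/\ ~ M s, ~ M t & span u (s * j1 + t * j2)].
    move=> Mj1 Mj2 rj1 rj2 nj1 nj2.
    have [p1 [q1 [n1 [Nn1 j1E]]]] := dec j1 Mj1.
    have [p2 [q2 [n2 [Nn2 j2E]]]] := dec j2 Mj2.
    have h1 : M (p1 * c1 + q1 * c2) by apply: Mcu; rewrite -(r_on _ _ n1) // -j1E.
    have h2 : M (p2 * c1 + q2 * c2) by apply: Mcu; rewrite -(r_on _ _ n2) // -j2E.
    have [s [t [st sp sq]]] := rank_two nu nc h1 h2.
    have Sst : span u (s * j1 + t * j2).
      rewrite j1E j2E.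
      have -> : s * (p1 * z1 + q1 * z2 + n1) + t * (p2 * z1 + q2 * z2 + n2) =
        (s * p1 + t * p2) * z1 + (s * q1 + t * q2) * z2 + (s * n1 + t * n2) by ring.
      apply: NS; apply: (idealD hN); first by apply: (idealD hN); exact: MMN.
      by apply: (idealD hN); exact: (idealMl _ hN).
    have swap a b ja jb : ~ span u ja -> M jb -> ~ (M a /\ M b) -> span u (a * ja + b * jb) -> ~ M b.
      move=> nja Mjb nab Sab Mb; apply: nja.
      have [Ma|[a' a'a]] := nu a; first by case: nab.
      have Sb : span u (b * jb) by apply: NS; exact: MMN.
      rewrite -[ja]mul1r -a'a -mulrA; apply: idealMl => //.
      by rewrite -[a * ja](addrK (b * jb)); exact: idealB.
    exists s, t; split=> //; last exact: (swap s t j1 j2).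
    by apply: (swap t s j2 j1) => //; [case=> ? ?; exact: st|rewrite addrC].
  have half (A B : set R) : is_ideal A -> is_ideal B -> A `<=` M -> B `<=` M -> A <> [set 0] ->
      B <> [set 0] -> B <> span u -> prodz I A -> prodz I B -> A `<=` B.
    move=> hA hB AM BM A0 B0 BS IA IB j Aj.
    have [Sj|nSj] := pselect (span u j); first exact: (uI B).
    have [k Bk nSk] := outside B hB BM B0 BS.
    have [||s [t [ns nt Sst]]] := key j k (AM j Aj) (BM k Bk) _ _ nSj nSk; [exact: IA|exact: IB|].
    have [//|[s' s's]] := nu s; rewrite -[j]mul1r -s's -mulrA; apply: idealMl => //.
    rewrite -[s * j](addrK (t * k)); apply: idealB => //; first exact: (uI B).
    exact: idealMl.
  by apply/seteqP; split; exact: half.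
move=> /existsNP[n /not_implyP[Nn nS]]; right.
have Nspan m : N m -> ~ span u m -> N = span m.
  move=> Nm mS; apply: contrapT => NE.
  have m0 : m != 0 by apply/eqP => m0; apply: mS; rewrite m0; exact: ideal0.
  apply: (star hN hW NW mW hS (span_ideal m) hN SN) => //.
  - exact: span_sub.
  - exact: span_neq0.
  - by move=> N0; move/eqP: m0; apply; have := Nm; rewrite N0.
  - by move=> E; apply: mS; rewrite E; exact: span_self.
  - by move=> E; apply: mS; rewrite E.
  exact/nesym.
have MnS m k : N k -> ~ span u k -> M m -> span u (m * k).
  move=> Nk nk Mm; apply: contrapT => nmk.
  have Nmk : N (m * k) by exact: (idealMl _ hN).
  have := Nk; rewrite (Nspan _ Nmk nmk) => -[r kE].
  have k0 : k = 0 by apply: (@fixed_by_nilp _ (r * m) k); [exact: nilpMl|rewrite -mulrA].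
  by apply: nk; rewrite k0; exact: ideal0.
have [e nn] := MnS n n Nn nS (NM n Nn).
have [d1 d1E] := MnS z1 n Nn nS Mz1.
have [d2 d2E] := MnS z2 n Nn nS Mz2.
(* n ^ 2 = e u with e a unit: subtracting multiples of n makes z1 and z2 orthogonal to n *)
have [Me|[e' e'e]] := nu e; last first.
  exfalso; apply: (@no_quadric l hl x y n (z1 - d1 * e' * n) (z2 - d2 * e' * n) e u).
  have nx0 : n * x = 0 by exact: Nn.
  have ny0 : n * y = 0 by exact: Nn.
  have Mn := NM n Nn.
  have zero d z : z * n = d * u -> n * (z - d * e' * n) = 0.
    move=> zn; rewrite mulrBr (mulrC n z) zn mulrCA nn.
    by rewrite -!mulrA (mulrA e' e) e'e mul1r subrr.
  split.
  - by split=> //; apply: idealB => //; exact: idealMl.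
  - by split; rewrite mulrBl -(mulrA _ n) ?nx0 ?ny0 mulr0 subr0.
  - by split=> //; exact: zero.
  - by split=> //; exact: unit_not_nilp e'e.
  by [].
have nn0 : n * n = 0 by rewrite nn Mu.
have NN k : N k -> k * n = 0.
  by rewrite (Nspan n Nn nS) => -[r ->]; rewrite -mulrA nn0 mulr0.
have [c cn] : span n u by rewrite -(Nspan n Nn nS); apply: SN; exact: span_self.
have Mc : M c.
  have [//|[s sc]] := nu c; exfalso; apply: nS; exists s; by rewrite cn mulrA sc mul1r.
have on_n p q k : N k -> (p * z1 + q * z2 + k) * n = (p * d1 + q * d2) * u.
  by move=> Nk; rewrite !mulrDl (NN k Nk) addr0 -!mulrA d1E d2E.
have nd : ~ (M d1 /\ M d2).
  move=> [Md1 Md2]; move/eqP: u0; apply; have [a [b [k [Nk cE]]]] := dec c Mc.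
  by rewrite cn cE on_n // Mu //; apply: idealD => //; exact: idealMl.
have [p1 [q1 [n1 [Nn1 xE]]]] := dec x Mx.
have [p2 [q2 [n2 [Nn2 yE]]]] := dec y My.
have h1 : M (p1 * d1 + q1 * d2).
  by apply: Mcu; rewrite -(on_n _ _ n1) // -xE mulrC; exact: Nn.
have h2 : M (p2 * d1 + q2 * d2).
  by apply: Mcu; rewrite -(on_n _ _ n2) // -yE mulrC; exact: Nn.
have [s [t [st sp sq]]] := rank_two nu nd h1 h2.
(* w lies both in W and in its annihilator, so it can serve as first basis vector *)
pose w := s * x + t * y.
have Ww : W w by apply: idealD => //; exact: idealMl.
have nw : ~ V w by move=> /(V_independent nu Wx Wy nx ny).
have Nw : N w.
  rewrite /w {1}xE {1}yE.
  have -> : s * (p1 * z1 + q1 * z2 + n1) + t * (p2 * z1 + q2 * z2 + n2) =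
        (s * p1 + t * p2) * z1 + (s * q1 + t * q2) * z2 + (s * n1 + t * n2) by ring.
  apply: (idealD hN); first by apply: (idealD hN); exact: MMN.
  by apply: (idealD hN); exact: (idealMl _ hN).
have nSw : ~ span u w by rewrite -Vu.
have NwE := Nspan w Nw nSw.
have Mw := NM w Nw.
have ww : w * w = 0 by exact: Nw.
have [v [z [t2 [[Wv nv Mz Mt2] [zw zv t2w t2v]]]]] := dual_basis art nu hW mW Wmin Vu Ww nw.
have Mv := WM v Wv.
have wv : w * v = 0 by exact: Nw.
have decw m : M m -> exists a b r, N r /\ m = a * z + b * t2 + r by exact: (decomp w v).
have [a [b [k [Nk vE]]]] := decw v Mv.
have Nww r : N r -> r * w = 0 by move=> Nr; exact: Nr.
have Ma : M a.
  apply: Mcu; have : v * w = 0 by rewrite mulrC.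
  by rewrite vE !mulrDl (Nww k Nk) -!mulrA zw t2w mulr0 !addr0.
pose k' := a * z + k.
have Nk' : N k' by apply: (idealD hN) => //; exact: MMN.
have vE' : v = b * t2 + k' by rewrite /k' {1}vE; ring.
have vv : v * v = b * u by rewrite {1}vE' mulrDl -mulrA t2v (Nk' v Wv) addr0.
have nMb : ~ M b.
  move=> Mb; apply: nv; have : N v by rewrite vE'; apply: (idealD hN) => //; exact: MMN.
  by rewrite NwE => /plus_subl; exact.
have [al zz] : span w (z * z) by rewrite -NwE; exact: MMN.
have [Mal|[al' al'al]] := nu al.
  have [ga gaE] := MnS al w Nw nSw Mal.
  exfalso; apply: (@no_quadric l hl w z v (z - ga * w) w b u); split.
  - by split=> //; apply: idealB => //; exact: idealMl.
  - split=> //.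
    + by rewrite mulrBl zw -mulrA ww mulr0 subr0.
    + by rewrite mulrBl zz gaE -mulrA (mulrC w) zw subrr.
    by rewrite mulrC.
  - split; [by rewrite mulrC|by rewrite mulrC| |by rewrite mulrC].
    by rewrite mulrBr (mulrC v z) zv mulrCA (mulrC v) wv mulr0 subrr.
  - by [].
  by [].
have z3 : z ^+ 3 = al * u by rewrite exprS expr2 zz mulrCA zw.
have nMal := unit_not_nilp al'al.
exists z, v, (b * al'); split.
- split=> //; rewrite vv z3; rewrite -mulrA (mulrA al') al'al mul1r. by [].
- move=> Mbal; apply: nMb; have -> : b = al * (b * al') by rewrite mulrCA (mulrC al) al'al mulr1.
  exact: idealMl.
- by rewrite z3; apply/eqP => /Mcu.
- by move=> m Mm; rewrite z3 mulrCA Mu // mulr0.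
move=> m Mm; have [b' b'b] := unit_of nu nMb.
have t2E : t2 = b' * (v - k') by rewrite vE' addrK mulrA b'b mul1r.
have wE : w = al' * z ^+ 2 by rewrite expr2 zz mulrA al'al mul1r.
have [p [q [r [Nr mE]]]] := decw m Mm.
move: Nr Nk'; rewrite NwE => -[r' rE] [k2 k2E].
exists p, (q * b'), (r' * al' - q * b' * k2 * al').
by rewrite mE t2E rE k2E wE; ring.
Qed.

End Trichotomy.

(** * The ideals of a cusp *)

Section Span.
Local Open Scope ring_scope.
Local Open Scope classical_set_scope.
Variable R : comNzRingType.

(** Principal ideals are told apart by multiplying their generators. *)
Lemma span_neq (c s t : R) : c * t = 0 -> c * s <> 0 -> span s <> span t.
Proof.
move=> ct cs E; have : span t s by rewrite -E; exact: span_self.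
by move=> [r sE]; apply: cs; rewrite sE mulrCA ct mulr0.
Qed.

Lemma span_nonzero (c s : R) : c * s <> 0 -> span s <> [set 0].
Proof.
move=> cs E; have : span s s by exact: span_self.
by rewrite E => s0; apply: cs; rewrite s0 mulr0.
Qed.

End Span.

Section Cusp.
Local Open Scope ring_scope.
Local Open Scope classical_set_scope.
Variable R : comNzRingType.
Hypothesis nu : nilpotent_or_invertible R.
Notation M := (@nilp R).
Let hM : is_ideal M := nilp_ideal nu.

Variables z y b : R.
Hypothesis cusp : cusp_data z y b.

Notation S := (span (z ^+ 3)).
Notation N := (span (z ^+ 2)).
Definition Y_line (l : R) : set R := span (y + l * z ^+ 2).
Definition Z_line (l : R) : set R := span (z + l * y).

Let Mz : M z. Proof. by case: cusp => -[]. Qed.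
Let My : M y. Proof. by case: cusp => -[]. Qed.
Let zy : z * y = 0. Proof. by case: cusp => -[]. Qed.
Let yy : y * y = b * z ^+ 3. Proof. by case: cusp => -[]. Qed.
Let nMb : ~ M b. Proof. by case: cusp. Qed.
Let u0 : z ^+ 3 != 0. Proof. by case: cusp. Qed.
Let Mu m : M m -> m * z ^+ 3 = 0. Proof. by case: cusp => _ _ _ + _; apply. Qed.
Let gen m : M m -> exists a c d, m = a * z + c * y + d * z ^+ 2.
Proof. by case: cusp => _ _ _ _; apply. Qed.

Let Mz2 : M (z ^+ 2). Proof. by rewrite expr2; exact: nilpMl. Qed.
Let Mu1 : M (z ^+ 3). Proof. by rewrite exprS; exact: (idealMr _ hM). Qed.

Lemma cusp_mul a c d a' c' d' :
  (a * z + c * y + d * z ^+ 2) * (a' * z + c' * y + d' * z ^+ 2) =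
  a * a' * z ^+ 2 + (a * d' + a' * d + c * c' * b) * z ^+ 3.
Proof.
transitivity (a * a' * z ^+ 2 + (a * d' + a' * d) * z ^+ 3 + c * c' * (y * y) +
  (a * c' + a' * c) * (z * y) + (c * d' + c' * d) * ((z * y) * z) + d * d' * (z * z ^+ 3)); first by ring.
by rewrite yy zy (Mu Mz) mul0r !mulr0; ring.
Qed.

Let Mcu c : c * z ^+ 3 = 0 -> M c.
Proof.
move=> cu; have [//|[s sc]] := nu c; exfalso; move/eqP: u0; apply.
by rewrite -[z ^+ 3]mul1r -sc -mulrA cu mulr0.
Qed.

(** Modulo the smaller ideals on the right, the coefficients of z, y and z ^ 2 matter
    only up to M. *)
Lemma small_z a : M a -> N (a * z).
Proof.
move=> /gen[a1 [c1 [d1 ->]]]; exists (a1 + d1 * z).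
transitivity (a1 * z ^+ 2 + d1 * z * z ^+ 2 + c1 * (z * y)); first by ring.
by rewrite zy; ring.
Qed.

Lemma small_y c : M c -> S (c * y).
Proof.
move=> /gen[a1 [c1 [d1 ->]]]; exists (c1 * b).
transitivity (c1 * (y * y) + (a1 + d1 * z) * (z * y)); first by ring.
by rewrite zy yy; ring.
Qed.

Lemma small_z2 d : M d -> S (d * z ^+ 2).
Proof.
move=> /gen[a1 [c1 [d1 ->]]]; exists (a1).
transitivity (a1 * z ^+ 3 + c1 * z * (z * y) + d1 * (z * z ^+ 3)); first by ring.
by rewrite zy (Mu Mz); ring.
Qed.

Section Ideal.
Variable I : set R.
Hypotheses (hI : is_ideal I) (IM : I `<=` M) (I0 : I <> [set 0]).

Let cancel_unit a x : ~ M a -> I (a * x) -> I x.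
Proof.
move=> /(unit_of nu)[s sa] Iax; rewrite -[x]mul1r -sa -mulrA; exact: (idealMl _ hI).
Qed.

Let lin a c d a' c' d' : I (a * z + c * y + d * z ^+ 2) ->
  I (a * a' * z ^+ 2 + (a * d' + a' * d + c * c' * b) * z ^+ 3).
Proof. by move=> h; rewrite -cusp_mul; exact: (idealMr _ hI). Qed.

Lemma socle_sub : S `<=` I.
Proof.
apply: span_sub => //.
have [m Im m0] := ideal_neq0 hI I0.
have [a [c [d mE]]] := gen (IM Im); rewrite mE in Im m0.
have [Ma|na] := pselect (M a); last first.
  apply: (cancel_unit na); have := @lin a c d 0 0 1 Im.
  by rewrite !(mulr0, mul0r, mulr1, add0r, addr0).
have [Mc|nc] := pselect (M c); last first.
  apply: (cancel_unit nMb); apply: (cancel_unit nc); have := @lin a c d 0 1 0 Im.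
  by rewrite !(mulr0, mul0r, mulr1, add0r, addr0) mulrA.
have [a1 aE] := small_z Ma; have [c1 cE] := small_y Mc.
have E : a * z + c * y + d * z ^+ 2 = (a1 + d) * z ^+ 2 + c1 * z ^+ 3 by rewrite aE cE; ring.
have [Md|nd] := pselect (M (a1 + d)); last first.
  apply: (cancel_unit nd); have := idealMl z hI Im; rewrite E.
  have -> : z * ((a1 + d) * z ^+ 2 + c1 * z ^+ 3) = (a1 + d) * z ^+ 3 + c1 * (z * z ^+ 3) by ring.
  by rewrite (Mu Mz) mulr0 addr0.
have [d1 dE] := small_z2 Md; rewrite E dE -mulrDl in Im m0.
apply: cancel_unit Im => /Mu h; by rewrite h eqxx in m0.
Qed.

Lemma Z_line_of_unit a c d : ~ M a -> I (a * z + c * y + d * z ^+ 2) ->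
  exists l, I (z + l * y).
Proof.
move=> na Im; have [s sa] := unit_of nu na; exists (s * c).
have Iz2 : I (z ^+ 2).
  apply: (cancel_unit na); have := @lin a c d 1 0 0 Im.
  rewrite !(mulr0, mul0r, mulr1, mul1r, add0r, addr0) => h.
  rewrite -[a * _](addrK (d * z ^+ 3)); apply: (idealB hI) => //.
  by apply: socle_sub; exists d.
have -> : z + s * c * y = s * (a * z + c * y + d * z ^+ 2) - s * d * z ^+ 2.
  transitivity (s * a * z + s * c * y); last by ring.
  by rewrite sa mul1r.
by apply: (idealB hI); exact: (idealMl _ hI).
Qed.

Lemma Z_line_z2 l : I (z + l * y) -> I (z ^+ 2).
Proof.
move=> h; have -> : z ^+ 2 = z * (z + l * y) - l * (z * y) by ring.
by rewrite zy mulr0 subr0; exact: (idealMl _ hI).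
Qed.

(** Either some element of I has a unit coefficient at z, or all of I lies in
    (y, z ^ 2) and some element has a unit coefficient at y; if neither holds, I
    lies in R z ^ 2. *)
Lemma ideal_types : I <> S -> I <> N ->
  (exists l, I (z + l * y)) \/
  ((exists l, I (y + l * z ^+ 2)) /\ I `<=` plus (span y) N).
Proof.
move=> nS nN; have [hasZ|noZ] := pselect (exists l, I (z + l * y)); [by left|right].
have form m : I m -> exists c d, m = c * y + d * z ^+ 2.
  move=> Im; have [a [c [d mE]]] := gen (IM Im).
  have [Ma|na] := pselect (M a); last first.
    by exfalso; apply: noZ; apply: (Z_line_of_unit (a := a) (c := c) (d := d)) => //; rewrite -mE.
  have [a1 aE] := small_z Ma; exists c, (a1 + d); rewrite mE aE; ring.
split; last first.
  move=> m /form[c [d ->]]; exists (c * y), (d * z ^+ 2).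
  by split=> //; [exists c|exists d].
apply: contrapT => noY.
have IN : I `<=` N.
  move=> m Im; have [c [d mE]] := form m Im.
  have [Mc|nc] := pselect (M c); last first.
    exfalso; apply: noY; have [s sc] := unit_of nu nc; exists (s * d).
    have -> : y + s * d * z ^+ 2 = s * m by rewrite mE mulrDr !mulrA sc mul1r.
    exact: (idealMl _ hI).
  have [k kE] := small_y Mc; exists (k * z + d); rewrite mE kE; ring.
have [Iz2|nIz2] := pselect (I (z ^+ 2)).
  by apply: nN; apply/seteqP; split=> //; exact: span_sub.
apply: nS; apply/seteqP; split; last exact: socle_sub.
move=> m Im; have [d mE] := IN m Im; rewrite mE; apply: small_z2.
by apply: contrapT => nd; apply: nIz2; apply: (cancel_unit nd); rewrite -mE.
Qed.

(** An ideal through a line of one of the two pencils that is larger than the line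
    contains the other generators of M, or of (y, z ^ 2). *)
Lemma cusp_classification : I <> S -> I <> N ->
  [\/ I = M, I = plus (span y) N, exists l, I = Y_line l | exists l, I = Z_line l].
Proof.
move=> nS nN.
have hY l := span_ideal (y + l * z ^+ 2); have hZ l := span_ideal (z + l * y).
have [[l Il]|[[l Il] IW]] := ideal_types nS nN.
  have [IZ|/existsNP[m /not_implyP[Im nm]]] := pselect (I `<=` Z_line l).
    by constructor 4; exists l; apply/seteqP; split=> //; exact: span_sub.
  constructor 1; apply/seteqP; split=> // x.
  have [a [c [d mE]]] := gen (IM Im).
  have Zz2 : Z_line l (z ^+ 2).
    by exists z; rewrite mulrDr mulrCA zy mulr0 addr0 expr2.
  have Iz2 := Z_line_z2 Il.
  have mE' : m = a * (z + l * y) + (c - a * l) * y + d * z ^+ 2 by rewrite mE; ring.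
  have Iy : I y.
    have [Mc|nc] := pselect (M (c - a * l)); last first.
      apply: (cancel_unit nc).
      have -> : (c - a * l) * y = m - a * (z + l * y) - d * z ^+ 2 by rewrite mE'; ring.
      by apply: (idealB hI); [apply: (idealB hI) => //|]; exact: (idealMl _ hI).
    exfalso; apply: nm; rewrite mE'; have [k ->] := small_y Mc.
    have -> : k * z ^+ 3 = k * z * z ^+ 2 by ring.
    by apply: (idealD (hZ l)); [apply: (idealD (hZ l)); [by exists a|]|]; exact: (idealMl _ (hZ l)).
  move=> /gen[a' [c' [d' ->]]].
  have -> : a' * z + c' * y + d' * z ^+ 2 = a' * (z + l * y) + (c' - a' * l) * y + d' * z ^+ 2 by ring.
  by do 2?apply: (idealD hI); exact: (idealMl _ hI).
have [IY|/existsNP[m /not_implyP[Im nm]]] := pselect (I `<=` Y_line l).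
  by constructor 3; exists l; apply/seteqP; split=> //; exact: span_sub.
constructor 2; apply/seteqP; split=> //.
have [_ [_ [[c ->] [d ->] mE]]] := IW m Im.
have mE' : m = c * (y + l * z ^+ 2) + (d - c * l) * z ^+ 2 by rewrite mE; ring.
have Yu : Y_line l (z ^+ 3).
  have [b' b'b] := unit_of nu nMb; exists (b' * y).
  transitivity (b' * (y * y) + b' * l * z * (z * y)); last by ring.
  by rewrite yy zy mulr0 addr0 mulrA b'b mul1r.
have Iz2 : I (z ^+ 2).
  have [Md|nd] := pselect (M (d - c * l)); last first.
    apply: (cancel_unit nd).
    have -> : (d - c * l) * z ^+ 2 = m - c * (y + l * z ^+ 2) by rewrite mE'; ring.
    by apply: (idealB hI) => //; exact: (idealMl _ hI).
  exfalso; apply: nm; rewrite mE'; have [k ->] := small_z2 Md.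
  by apply: (idealD (hY l)); [exists c|exact: (idealMl _ (hY l))].
apply: plus_sub => //; apply: span_sub => //.
by rewrite -[y](addrK (l * z ^+ 2)); apply: (idealB hI) => //; exact: (idealMl _ hI).
Qed.

End Ideal.

Lemma y_square_neq0 : b * z ^+ 3 <> 0. Proof. by move=> /Mcu. Qed.

Lemma Y_line_socle l : S `<=` Y_line l.
Proof.
apply: socle_sub; first exact: span_ideal.
  apply: span_sub => //; apply: (idealD hM) => //; exact: (idealMl _ hM).
move=> E; have : Y_line l (y + l * z ^+ 2) by exact: span_self.
rewrite E => e; apply: y_square_neq0.
have := cusp_mul 0 1 l 0 1 0; rewrite !(mulr0, mul0r, mulr1, mul1r, add0r, addr0) => <-.
by rewrite e mul0r.
Qed.

Lemma Z_line_socle k : S `<=` Z_line k.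
Proof.
apply: socle_sub; first exact: span_ideal.
  apply: span_sub => //; apply: (idealD hM) => //; exact: (idealMl _ hM).
move=> E; have : Z_line k (z + k * y) by exact: span_self.
rewrite E => e; move/eqP: u0; apply.
have := cusp_mul 0 0 1 1 k 0; rewrite !(mulr0, mul0r, mulr1, mul1r, add0r, addr0) => <-.
by rewrite e mulr0.
Qed.

Lemma Y_line_congr l l' : M (l - l') -> Y_line l = Y_line l'.
Proof.
suff sub l1 l2 : M (l1 - l2) -> Y_line l1 `<=` Y_line l2.
  by move=> h; apply/seteqP; split; apply: sub => //; rewrite -opprB; exact: (idealN hM).
move=> h; apply: span_sub; first exact: span_ideal.
have -> : y + l1 * z ^+ 2 = y + l2 * z ^+ 2 + (l1 - l2) * z ^+ 2 by ring.
apply: (idealD (span_ideal _)); first exact: span_self.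
by apply: Y_line_socle; exact: small_z2.
Qed.

Lemma Z_line_congr l l' : M (l - l') -> Z_line l = Z_line l'.
Proof.
suff sub l1 l2 : M (l1 - l2) -> Z_line l1 `<=` Z_line l2.
  by move=> h; apply/seteqP; split; apply: sub => //; rewrite -opprB; exact: (idealN hM).
move=> h; apply: span_sub; first exact: span_ideal.
have -> : z + l1 * y = z + l2 * y + (l1 - l2) * y by ring.
apply: (idealD (span_ideal _)); first exact: span_self.
by apply: Z_line_socle; exact: small_y.
Qed.

Lemma line_mul l k : (y + l * z ^+ 2) * (z + k * y) = (l + k * b) * z ^+ 3.
Proof.
have := cusp_mul 0 1 l 1 k 0.
by rewrite !(mulr0, mul0r, mulr1, mul1r, add0r, addr0) => ->.
Qed.

(** The generators have product (l + k b) z ^ 3, and to be orthogonal to one of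
    them is a linear equation modulo M that leaves no room beyond the other. *)
Lemma lines_orthogonal (I J : set R) l k : is_ideal I -> is_ideal J -> I `<=` M -> J `<=` M ->
  I (y + l * z ^+ 2) -> J (z + k * y) -> prodz I J ->
  [/\ I = Y_line l, J = Z_line k & M (l + k * b)].
Proof.
move=> hI hJ IM JM Il Jk IJ.
have Mlk : M (l + k * b) by apply: Mcu; rewrite -line_mul; exact: IJ.
have hY := span_ideal (y + l * z ^+ 2); have hZ := span_ideal (z + k * y).
split=> //; apply/seteqP; split; [|exact: span_sub| |exact: span_sub] => m hm.
  have [a [c [d mE]]] := gen (IM m hm).
  have Ma : M a.
    apply: Mcu; have := IJ m _ hm (Z_line_z2 hJ Jk).
    have := cusp_mul a c d 0 0 1; rewrite !(mulr0, mul0r, mulr1, mul1r, add0r, addr0) => e.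
    by rewrite mE e.
  have [a1 aE] := small_z Ma; have {}mE : m = 0 * z + c * y + (d + a1) * z ^+ 2 by rewrite mE aE; ring.
  have Md : M (d + a1 - c * l).
    have -> : d + a1 - c * l = (d + a1 + c * k * b) - c * (l + k * b) by ring.
    apply: (idealB hM); last exact: (idealMl _ hM).
    apply: Mcu; have := IJ m _ hm Jk; rewrite mE.
    have := cusp_mul 0 c (d + a1) 1 k 0.
    by rewrite !(mulr0, mul0r, mulr1, mul1r, add0r, addr0) => -> .
  have -> : m = c * (y + l * z ^+ 2) + (d + a1 - c * l) * z ^+ 2 by rewrite mE; ring.
  apply: (idealD hY); first by exists c.
  by apply: Y_line_socle; exact: small_z2.
have [a [c [d mE]]] := gen (JM m hm).
have Mc : M (c - a * k).
  have [b' b'b] := unit_of nu nMb.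
  have -> : c - a * k = b' * ((a * l + c * b) - a * (l + k * b)).
    transitivity (b' * b * (c - a * k)); last by ring.
    by rewrite b'b mul1r.
  apply: (idealMl _ hM); apply: (idealB hM); last exact: (idealMl _ hM).
  apply: Mcu; have := IJ _ m Il hm; rewrite mE mulrC.
  have := cusp_mul a c d 0 1 l.
  by rewrite !(mulr0, mul0r, mulr1, mul1r, add0r, addr0) => -> .
have -> : m = a * (z + k * y) + (c - a * k) * y + d * z ^+ 2 by rewrite mE; ring.
have Zz2 : Z_line k (z ^+ 2) by apply: (Z_line_z2 hZ); exact: span_self.
apply: (idealD hZ); last exact: (idealMl _ hZ).
apply: (idealD hZ); first by exists a.
by apply: Z_line_socle; exact: small_y.
Qed.

(** Two ideals through lines of the same pencil have a nonzero product, z ^ 3 or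
    y ^ 2. *)
Lemma cusp_pairs (I J : set R) : is_ideal I -> is_ideal J -> I `<=` M -> J `<=` M ->
  I <> [set 0] -> J <> [set 0] -> I <> S -> J <> S -> I <> N -> J <> N -> prodz I J ->
  exists l k, M (l + k * b) /\
    ((I = Y_line l /\ J = Z_line k) \/ (J = Y_line l /\ I = Z_line k)).
Proof.
move=> hI hJ IM JM I0 J0 IS JS IN JN IJ.
have JI : prodz J I by move=> p q Jp Iq; rewrite mulrC; exact: IJ.
have [[k Ik]|[[l Il] _]] := ideal_types hI IM I0 IS IN;
have [[k' Jk]|[[l' Jl] _]] := ideal_types hJ JM J0 JS JN.
- exfalso; move/eqP: u0; apply; have := IJ _ _ (Z_line_z2 hI Ik) Jk.
  have := cusp_mul 0 0 1 1 k' 0.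
  by rewrite !(mulr0, mul0r, mulr1, mul1r, add0r, addr0) => ->.
- have [E1 E2 E3] := lines_orthogonal hJ hI JM IM Jl Ik JI.
  by exists l', k; split=> //; right.
- have [E1 E2 E3] := lines_orthogonal hI hJ IM JM Il Jk IJ.
  by exists l, k'; split=> //; left.
exfalso; apply: y_square_neq0; have := IJ _ _ Il Jl.
have := cusp_mul 0 1 l 0 1 l'.
by rewrite !(mulr0, mul0r, mulr1, mul1r, add0r, addr0) => ->.
Qed.

Let Y_line_M l : Y_line l `<=` M.
Proof. by apply: span_sub => //; apply: (idealD hM) => //; exact: (idealMl _ hM). Qed.

Let Z_line_M k : Z_line k `<=` M.
Proof. by apply: span_sub => //; apply: (idealD hM) => //; exact: (idealMl _ hM). Qed.

Lemma lines_prodP l k : prodz (Y_line l) (Z_line k) <-> M (l + k * b).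
Proof.
have hY := span_ideal (y + l * z ^+ 2); have hZ := span_ideal (z + k * y).
split=> [h|h _ _ [r ->] [s ->]]; last by rewrite mulrACA line_mul Mu // mulr0.
have [_ _ //] := lines_orthogonal hY hZ (@Y_line_M l) (@Z_line_M k) (span_self _) (span_self _) h.
Qed.

Lemma z2_mul_Y l : z ^+ 2 * (y + l * z ^+ 2) = 0.
Proof.
have := cusp_mul 0 0 1 0 1 l.
by rewrite !(mulr0, mul0r, mulr1, mul1r, add0r, addr0).
Qed.

Lemma z2_mul_Z k : z ^+ 2 * (z + k * y) = z ^+ 3.
Proof.
have := cusp_mul 0 0 1 1 k 0.
by rewrite !(mulr0, mul0r, mulr1, mul1r, add0r, addr0).
Qed.

Lemma y_mul_Y l : y * (y + l * z ^+ 2) = b * z ^+ 3.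
Proof.
have := cusp_mul 0 1 0 0 1 l.
by rewrite !(mulr0, mul0r, mulr1, mul1r, add0r, addr0).
Qed.

Lemma Z_line_neq_Y_line k l : Z_line k <> Y_line l.
Proof.
apply: (@span_neq _ (z ^+ 2)); first exact: z2_mul_Y.
by rewrite z2_mul_Z; exact/eqP.
Qed.

Lemma cusp_matching (I J J' : set R) :
  is_ideal I -> is_ideal J -> is_ideal J' -> I `<=` M -> J `<=` M -> J' `<=` M ->
  I <> [set 0] -> J <> [set 0] -> J' <> [set 0] -> I <> S -> J <> S -> J' <> S ->
  I <> N -> J <> N -> J' <> N -> prodz I J -> prodz I J' -> J = J'.
Proof.
move=> hI hJ hJ' IM JM JM' I0 J0 J0' IS JS JS' IN JN JN' IJ IJ'.
have [l [k [Mlk [[IE JE]|[JE IE]]]]] := cusp_pairs hI hJ IM JM I0 J0 IS JS IN JN IJ;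
have [l' [k' [Mlk' [[IE' JE']|[JE' IE']]]]] := cusp_pairs hI hJ' IM JM' I0 J0' IS JS' IN JN' IJ'.
- rewrite JE JE'; apply: Z_line_congr; have [b' b'b] := unit_of nu nMb.
  have h : M (l + k' * b) by apply/lines_prodP; rewrite -IE -JE'.
  have -> : k - k' = b' * ((l + k * b) - (l + k' * b)).
    by transitivity (b' * b * (k - k')); [rewrite b'b mul1r|ring].
  by apply: (idealMl _ hM); exact: (idealB hM).
- by exfalso; apply: (@Z_line_neq_Y_line k' l); rewrite -IE -IE'.
- by exfalso; apply: (@Z_line_neq_Y_line k l'); rewrite -IE -IE'.
rewrite JE JE'; apply: Y_line_congr.
have h : M (l' + k * b).
  by apply/lines_prodP; rewrite -IE -JE' => p q Jp Iq; rewrite mulrC; exact: IJ'.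
have -> : l - l' = (l + k * b) - (l' + k * b) by ring.
exact: (idealB hM).
Qed.

End Cusp.

(** * Forbidden configurations of annihilating ideals *)

(** Used to drop the few indices at which a configuration degenerates. *)
Lemma eventually_avoid (P : nat -> Prop) : (forall i j, P i -> P j -> i = j) ->
  exists k, forall i, ~ P (k + i)%N.
Proof.
move=> P1; have [[i Pi]|none] := pselect (exists i, P i); last first.
  by exists 0%N => i Pi; apply: none; exists i.
by exists i.+1 => j /(P1 _ _ Pi); lia.
Qed.

Section Vertices.
Local Open Scope ring_scope.
Local Open Scope classical_set_scope.
Variable R : comNzRingType.
Implicit Types (I J : set R) (A B : AG R).

Lemma ideal_mul_eq0 I J : ideal_mul I J = [set 0] <-> prodz I J.
Proof.
split=> [E a b Ia Jb|h].
  have : ideal_mul I J (a * b) by exists 1%N, (fun=> a), (fun=> b); split=> //; rewrite big_ord1.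
  by rewrite E.
apply/seteqP; split=> [_ [n [a [b [Ia Jb ->]]]]|_ ->].
  by apply: big1 => i _; exact: h.
by exists 0%N, (fun=> 0), (fun=> 0); split=> [[]|[]|] //; rewrite big_ord0.
Qed.

Lemma prodzC I J : prodz I J -> prodz J I.
Proof. by move=> h a b Ja Ib; rewrite mulrC; exact: h. Qed.

Lemma prodz_span (p q : R) : p * q = 0 -> prodz (span p) (span q).
Proof. by move=> pq _ _ [r ->] [s ->]; rewrite mulrACA pq mulr0. Qed.

Lemma vertex_inj A B : sval A = sval B -> A = B.
Proof.
by case: A B => [I hI] [J hJ] /= E; subst J; congr exist; exact: Prop_irrelevance.
Qed.

Lemma vertexP I J : is_ideal I -> is_ideal J -> I <> [set 0] -> J <> [set 0] -> prodz I J ->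
  exists A : AG R, sval A = I.
Proof.
move=> hI hJ I0 J0 IJ.
have h : annihilating_ideal I /\ I <> [set 0].
  by split=> //; split=> //; exists J; split=> //; apply/ideal_mul_eq0.
by exists (exist _ I h).
Qed.

Lemma vertex_ideal A : is_ideal (sval A). Proof. by case: A => I [[]]. Qed.

Lemma vertex_neq0 A : sval A <> [set 0]. Proof. by case: A => I []. Qed.

Lemma adjP A B : adj A B <-> sval A <> sval B /\ prodz (sval A) (sval B).
Proof.
split=> [[AB /ideal_mul_eq0 h]|[AB h]]; first by split=> // /vertex_inj.
by split; [move=> E; apply: AB; rewrite E|apply/ideal_mul_eq0].
Qed.

Lemma vertex_nilp A : nilpotent_or_invertible R -> sval A `<=` @nilp R.
Proof.
move=> nu r Ar; have [//|[s sr]] := nu r; exfalso.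
case: A Ar => I [[hI [J [hJ J0 /ideal_mul_eq0 IJ]]] I0] /= Ir.
apply: J0; apply/seteqP; split=> x; last by move=> ->; exact: (ideal0 hJ).
by move=> Jx; rewrite -[x]mul1r -sr; apply: IJ => //; exact: (idealMl _ hI).
Qed.

End Vertices.

Section Obstructions.
Local Open Scope ring_scope.
Local Open Scope classical_set_scope.
Variables (K : realType) (R : comNzRingType) (g : nat).
Hypothesis emb : embeddable K (AG R) g.

(** A, B and C are joined to all subideals of J except possibly themselves and
    0. *)
Lemma embedded_thin : thin_annihilators R.
Proof.
move=> I J A B C hI hJ IJ mJ hA hB hC AI BI CI A0 B0 C0 AB AC BC.
have [pt [arc [[_ ps] aP _ ad]]] := emb.
have fin : finite_set [set [set 0 : R]; A; B; C].
  by rewrite !finite_setU; do ?split; exact: finite_set1.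
have /infinite_seq[f [fi fP]] := infinite_setD mJ fin.
have fne n X : [set [set 0 : R]; A; B; C] X -> f n <> X.
  by move=> hX E; case: (fP n) => _; rewrite E.
have f0 n : f n <> [set 0] by apply: fne; do 3 left.
have fA n : f n <> A by apply: fne; do 2 left; right.
have fB n : f n <> B by apply: fne; left; right.
have fC n : f n <> C by apply: fne; right.
have kill n X : X `<=` I -> prodz (f n) X.
  by move=> XI p q fp Xq; rewrite mulrC; apply: IJ; [exact: XI|case: (fP n) => -[_ h] _; exact: h].
have hf n : is_ideal (f n) by case: (fP n) => -[].
have [v vE] := choice (fun n => vertexP (hf n) hA (f0 n) A0 (kill n A AI)).
have vert X : is_ideal X -> X <> [set 0] -> X `<=` I -> exists x : AG R, sval x = X.
  by move=> hX X0 XI; exact: (vertexP hX (hf 0%N) X0 (f0 0%N) (prodzC (kill 0%N X XI))).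
have [a aE] := vert A hA A0 AI.
have [b bE] := vert B hB B0 BI.
have [c cE] := vert C hC C0 CI.
apply: (no_tripods_direct ps aP ad (a := a) (b := b) (c := c) (v := v)).
- by move=> i j E; apply: fi; rewrite -!vE E.
- by move=> E; apply: AB; rewrite -aE E.
- by move=> E; apply: AC; rewrite -aE E.
- by move=> E; apply: BC; rewrite -bE E.
by move=> i; split; apply/adjP; rewrite vE ?aE ?bE ?cE; split=> //; exact: kill.
Qed.

Hypothesis nu : nilpotent_or_invertible R.
Notation M := (@nilp R).
Let hM : is_ideal M := nilp_ideal nu.

(** The ideals R (x + l y) are joined to R u, to R n and to
    R (l z1 - z2 - l n / e), which is joined to R (n + x).  For infinitely many
    residue classes l this is a configuration excluded by
    [no_tripods_subdivided]. *)
Lemma no_quadric_data (l : nat -> R) : (forall i j, i <> j -> ~ M (l i - l j)) ->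
  forall (x y n z1 z2 e u : R), quadric_data x y n z1 z2 e u -> False.
Proof.
move=> hl0 x y n z1 z2 e u.
move=> [[Mx My Mn Mz1 Mz2] [z1x z1y z2x z2y] [nx ny nz1 nz2] [nn nMe] [u0 Mu]].
have [i0 hi0] := @eventually_avoid (fun i => M (l i)) (fun i j Mi Mj =>
  contrapT (fun ij => hl0 i j ij (idealB hM Mi Mj))).
have Mcu c : c * u = 0 -> M c.
  move=> cu; have [//|[s sc]] := nu c; exfalso; move/eqP: u0; apply.
  by rewrite -[u]mul1r -sc -mulrA cu mulr0.
have un0 : u <> 0 by exact/eqP.
have [e' e'e] := unit_of nu nMe.
pose p k := x + k * y; pose q k := k * z1 - z2 - k * e' * n.
have z1p k : z1 * p k = u by rewrite /p mulrDr mulrCA z1y mulr0 addr0.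
have z2p k : z2 * p k = k * u by rewrite /p mulrDr mulrCA z2y z2x add0r.
have np k : n * p k = 0 by rewrite /p mulrDr mulrCA ny nx mulr0 addr0.
have pu k : p k * u = 0 by apply: Mu; apply: (idealD hM) => //; exact: (idealMl _ hM).
have qE c k : c * q k = k * (z1 * c) - z2 * c - k * e' * (n * c) by rewrite /q; ring.
have yq k : y * q k = - u by rewrite qE z1y z2y ny !mulr0 sub0r subr0.
have xq k : x * q k = k * u by rewrite qE z1x z2x nx mulr0 !subr0.
have nq k : n * q k = - (k * u).
  rewrite qE (mulrC z1) (mulrC z2) nz1 nz2 nn mulr0 subr0 sub0r.
  by rewrite -mulrA (mulrA e') e'e mul1r.
have pq k : p k * q k = 0 by rewrite /p mulrDl -mulrA yq xq mulrN subrr.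
have qb k : q k * (n + x) = 0 by rewrite mulrC mulrDl nq xq addNr.
have un : n * u = 0 by exact: Mu.
have z1u : z1 * u = 0 by exact: Mu.
have yu : y * u = 0 by exact: Mu.
have z1b : z1 * (n + x) = u by rewrite mulrDr (mulrC z1 n) nz1 add0r.
have nb : n * (n + x) = e * u by rewrite mulrDr nn nx addr0.
have yb : y * (n + x) = y * x by rewrite mulrDr (mulrC y n) ny add0r.
have eu : e * u <> 0 by move=> /Mcu.
(* equality of principal ideals is tested by multiplying the generators *)
have test (s t : R) : span s = span t -> exists r, forall c, c * s = r * (c * t).
  move=> E; have : span t s by rewrite -E; exact: span_self.
  by move=> [r ->]; exists r => d; rewrite mulrCA.
have neg0 : - u <> 0 by move=> /eqP; rewrite oppr_eq0 => /eqP.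
have nS k : span (p k) <> span u by apply: (@span_neq _ z1 (p k) u z1u); rewrite z1p.
have nA k : span (p k) <> span n.
  by apply: (@span_neq _ z1 (p k) n); rewrite ?z1p // mulrC.
have nB k : span (p k) <> span (n + x).
  by apply/nesym; apply: (@span_neq _ n (n + x) (p k) (np k)); rewrite nb.
have qS k : span (q k) <> span u by apply: (@span_neq _ y (q k) u yu); rewrite yq.
have qA k : span (q k) <> span n by apply: (@span_neq _ y (q k) n); rewrite ?yq // mulrC.
have p_inj k k' : span (p k) = span (p k') -> M (k - k').
  move=> /test[r h]; have := h z1; have := h z2; rewrite !z1p !z2p => E2 E1.
  by apply: Mcu; rewrite mulrBl E2 mulrCA -E1 subrr.
have q_inj k k' : span (q k) = span (q k') -> M (k - k').
  move=> /test[r h]; have := h y; have := h x; rewrite !yq !xq mulrN => E2 /oppr_inj E1.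
  by apply: Mcu; rewrite mulrBl E2 mulrCA -E1 subrr.
have pq_neq k k' : ~ M k' -> span (p k) <> span (q k').
  move=> Mk'; apply/nesym; apply: (@span_neq _ n _ _ (np k)); rewrite nq => /eqP.
  by rewrite oppr_eq0 => /eqP /Mcu.
(* the ideals R (q k) are distinct, so at most one of them coincides with R (n + x) *)
have [i1 hi1] := @eventually_avoid (fun i => span (q (l i)) = span (n + x)) (fun i j Ei Ej =>
  contrapT (fun ij => hl0 i j ij (q_inj _ _ (etrans Ei (esym Ej))))).
pose m i := l ((i0 + i1) + i)%N.
have mM i : ~ M (m i) by rewrite /m -addnA; exact: hi0.
have mB i : span (q (m i)) <> span (n + x) by rewrite /m (addnC i0) -addnA; exact: hi1.
have m_inj i j : M (m i - m j) -> i = j.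
  by move=> h; apply: contrapT => ij; apply: (hl0 _ _ _ h) => /addnI.
have p0 k : span (p k) <> [set 0] by apply: (@span_nonzero _ z1); rewrite z1p.
have q0 k : span (q k) <> [set 0] by apply: (@span_nonzero _ y); rewrite yq.
have vert (s t : R) : span s <> [set 0] -> span t <> [set 0] -> s * t = 0 ->
    exists v : AG R, sval v = span s.
  by move=> s0 t0 st; apply: (vertexP (span_ideal s) (span_ideal t) s0 t0); exact: prodz_span.
have [v vE] := choice (fun i => vert _ _ (p0 (m i)) (q0 (m i)) (pq (m i))).
have qp k : q k * p k = 0 by rewrite mulrC.
have [w wE] := choice (fun i => vert _ _ (q0 (m i)) (p0 (m i)) (qp (m i))).
have uS : span u <> [set 0] by exact: span_neq0.
have [a aE] := vert u (p 0) uS (p0 0) (etrans (mulrC _ _) (pu 0)).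
have nA0 : span n <> [set 0] by apply: (@span_nonzero _ n); rewrite nn.
have [b bE] := vert n (p 0) nA0 (p0 0) (np 0).
have nB0 : span (n + x) <> [set 0] by apply: (@span_nonzero _ z1); rewrite z1b.
have [c cE] := vert (n + x) (q 0) nB0 (q0 0) (etrans (mulrC _ _) (qb 0)).
have [pt [arc [[_ ps] aP _ ad]]] := emb.
apply: (no_tripods_subdivided ps aP ad (a := a) (b := b) (c := c) (v := v) (w := w)).
- by move=> i j E; apply/m_inj/p_inj; rewrite -!vE E.
- by move=> i j E; apply/m_inj/q_inj; rewrite -!wE E.
- by move=> i j E; apply: (@pq_neq (m i) (m j)) => //; rewrite -vE -wE E.
- by move=> E; apply: (@span_neq _ n n u un); rewrite ?nn // -aE -bE E.
- by move=> E; apply: (@span_neq _ z1 (n + x) u z1u); rewrite ?z1b // -aE -cE E.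
- move=> E; apply: (@span_neq _ z1 (n + x) n); rewrite ?z1b //; first by rewrite mulrC.
  by rewrite -bE -cE E.
- move=> i; split=> E; first by apply: (qS (m i)); rewrite -wE E.
  by apply: (qA (m i)); rewrite -wE E.
- by move=> i E; apply: (nB (m i)); rewrite -vE E.
move=> i; split; apply/adjP; rewrite ?vE ?wE ?aE ?bE ?cE; split.
- exact: nS.
- exact/prodz_span/pu.
- exact: nA.
- by apply: prodz_span; rewrite mulrC.
- exact: pq_neq.
- exact/prodz_span/pq.
- exact: mB.
- exact/prodz_span/qb.
Qed.

End Obstructions.

(** * The remaining graphs are planar *)

Section PlanarCases.
Local Open Scope ring_scope.
Local Open Scope classical_set_scope.
Variables (K : realType) (R : comNzRingType).
Hypothesis nu : nilpotent_or_invertible R.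
Notation M := (@nilp R).
Let hM : is_ideal M := nilp_ideal nu.

Lemma star_planar (u : R) (k : AG R -> K) : injective k -> star_ring u -> embeddable K (AG R) 0.
Proof.
move=> ki [u0 Mu kill match_].
have S0 := span_neq0 u0; have hS := span_ideal u.
have [s sE] := vertexP hS hS S0 S0 (prodz_span (kill u Mu)).
apply: (embed_pencil (s := s) ki) => v x y vs xs ys.
have ne (w : AG R) : w <> s -> sval w <> span u by rewrite -sE => ws /vertex_inj.
move=> /adjP[_ vx] /adjP[_ vy]; apply: vertex_inj.
apply: (match_ (sval v)) => //; [exact: vertex_ideal|exact: vertex_ideal|exact: vertex_ideal
  |exact: vertex_nilp|exact: vertex_nilp|exact: vertex_nilp
  |exact: vertex_neq0|exact: vertex_neq0|exact: vertex_neq0|exact: ne|exact: ne|exact: ne].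
Qed.

Lemma fiber_countable (I : set R) : countable [set v : AG R | sval v = I].
Proof.
apply: finite_set_countable; have [[v vE]|none] := pselect (exists v : AG R, sval v = I).
  by apply: (sub_finite_set _ (finite_set1 v)) => w /= wE; apply: vertex_inj; rewrite wE vE.
by apply: (sub_finite_set _ (finite_set0 _)) => v vE; apply: none; exists v.
Qed.

Variables (z y b : R) (g : nat).
Hypothesis cusp : cusp_data z y b.
Hypothesis emb : embeddable K (AG R) g.

Notation S := (span (z ^+ 3)).
Notation N := (span (z ^+ 2)).

Let zy : z * y = 0. Proof. by case: cusp => -[]. Qed.
Let u0 : z ^+ 3 <> 0. Proof. by apply/eqP; case: cusp. Qed.
Let Mz : M z. Proof. by case: cusp => -[]. Qed.
Let Mu m : M m -> m * z ^+ 3 = 0. Proof. by case: cusp => _ _ _ + _; apply. Qed.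
Let z4 : z ^+ 2 * z ^+ 2 = 0.
Proof. by rewrite {1}expr2 -mulrA -exprS (Mu Mz). Qed.

Let yz2 : y * z ^+ 2 = 0.
Proof. by rewrite mulrC expr2 -mulrA zy mulr0. Qed.

Let bu0 : b * z ^+ 3 <> 0 := y_square_neq0 nu cusp.
Let z2Y := z2_mul_Y cusp.
Let z2Z := z2_mul_Z cusp.
Let yY := y_mul_Y cusp.

(** Every line of the first pencil is joined to R z ^ 3, to R z ^ 2 and to its
    orthogonal line in the second pencil, so the first pencil is countable by
    [triods_countable]; orthogonality carries this over to the second pencil. *)
Lemma cusp_vertices_countable : countable [set: AG R].
Proof.
have [[_ My _ _] nMb _ _ _] := cusp.
have Mu1 : M (z ^+ 3) by rewrite exprS; exact: (idealMr _ hM).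
have Mz2 : M (z ^+ 2) by rewrite expr2; exact: (idealMr _ hM).
have YM l : M (y + l * z ^+ 2) by apply: (idealD hM) => //; exact: (idealMl _ hM).
have hS := span_ideal (z ^+ 3); have hN := span_ideal (z ^+ 2).
have hY l : is_ideal (Y_line z y l) := span_ideal _.
have hZ l : is_ideal (Z_line z y l) := span_ideal _.
have S0 : S <> [set 0] by apply/span_neq0/eqP.
have N0 : N <> [set 0] by apply: (@span_nonzero _ z); rewrite -exprS.
have Y0 l : Y_line z y l <> [set 0] by apply: (@span_nonzero _ y); rewrite yY.
have Z0 l : Z_line z y l <> [set 0] by apply: (@span_nonzero _ (z ^+ 2)); rewrite z2Z.
have NS : N <> S by apply: (@span_neq _ z _ _ (Mu Mz)); rewrite -exprS.
have ZS k : Z_line z y k <> S by apply: (@span_neq _ (z ^+ 2) _ _ (Mu Mz2)); rewrite z2Z.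
have ZN k : Z_line z y k <> N by apply: (@span_neq _ (z ^+ 2) _ _ z4); rewrite z2Z.
have ZY := Z_line_neq_Y_line cusp.
have YS l : Y_line z y l <> S by apply: (@span_neq _ y _ _ (Mu My)); rewrite yY.
have YN l : Y_line z y l <> N by apply: (@span_neq _ y _ _ yz2); rewrite yY.
have [b' b'b] := unit_of nu nMb.
have lines l k : M (l + k * b) -> prodz (Y_line z y l) (Z_line z y k).
  by move=> /(lines_prodP nu cusp).
have linesP l k : prodz (Y_line z y l) (Z_line z y k) -> M (l + k * b).
  by move=> /(lines_prodP nu cusp).
have [s sE] := vertexP hS hS S0 S0 (prodz_span (Mu Mu1)).
have [t tE] := vertexP hN hN N0 N0 (prodz_span z4).
pose X := [set v : AG R | exists l, sval v = Y_line z y l].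
pose Z := [set v : AG R | exists l, sval v = Z_line z y l].
have Zex l : exists w : AG R, sval w = Z_line z y (- (l * b')) /\ M (l + - (l * b') * b).
  have h : M (l + - (l * b') * b).
    by rewrite mulNr -mulrA b'b mulr1 subrr; exact: (ideal0 hM).
  by have [w wE] := vertexP (hZ _) (hY l) (Z0 _) (Y0 l) (prodzC (lines _ _ h)); exists w.
have partner (v : AG R) : exists w : AG R, X v -> exists l k,
    [/\ sval v = Y_line z y l, sval w = Z_line z y k & M (l + k * b)].
  have [[l vE]|nX] := pselect (X v); last by exists v.
  by have [w [wE h]] := Zex l; exists w => _; exists l, (- (l * b')).
have [c cP] := choice partner.
have cX : countable X.
  have [pt [arc [[_ ps] aP av ad]]] := emb.
  apply: (triods_countable ps aP av ad (a := s) (b := t) (c := c)).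
  - by move=> E; apply: NS; rewrite -sE -tE E.
  - move=> v /cP[l [k [vE wE h]]]; split; apply/adjP; rewrite ?vE ?wE ?sE ?tE; split=> //.
    + by apply: prodz_span; exact: Mu.
    + by apply: prodz_span; rewrite mulrC z2Y.
    + by move/esym; exact: ZY.
    exact: lines.
  - move=> v /cP[l [k [vE wE h]]]; split.
    + by move=> E; apply: (ZS k); rewrite -wE E.
    + by move=> E; apply: (ZN k); rewrite -wE E.
    by move=> [l']; rewrite wE; exact: ZY.
  move=> v v' /cP[l [k [vE wE h]]] /cP[l' [k' [vE' wE' h']]] E; apply: vertex_inj.
  rewrite vE vE'; apply: (Y_line_congr nu cusp).
  have h2 : M (l + k' * b) by apply: linesP; rewrite -wE' -E wE; exact: lines.
  have -> : l - l' = (l + k' * b) - (l' + k' * b) by ring.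
  exact: (idealB hM).
have cZ : countable Z.
  apply: (sub_countable _ cX); apply: (card_le_trans _ (card_image_le c X)).
  apply: subset_card_le => w [k wE].
  have h : M (- (k * b) + k * b) by rewrite addNr; exact: (ideal0 hM).
  have [v vE] := vertexP (hY _) (hZ k) (Y0 _) (Z0 k) (lines _ _ h).
  have Xv : X v by exists (- (k * b)).
  exists v => //; have [l [k' [vE' wE' h']]] := cP v Xv; apply: vertex_inj.
  rewrite wE' wE; apply: (Z_line_congr nu cusp).
  have h2 : M (- (k * b) + k' * b) by apply: linesP; rewrite -vE vE'; exact: lines.
  have -> : k' - k = b' * (- (k * b) + k' * b).
    by transitivity (b' * b * (k' - k)); [rewrite b'b mul1r|ring].
  exact: (idealMl _ hM).
pose F I := [set v : AG R | sval v = I].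
have cover : [set: AG R] `<=` (X `|` Z) `|` ((F S `|` F N) `|` (F M `|` F (plus (span y) N))).
  move=> v _; have [vS|vS] := pselect (sval v = S); first by right; left; left.
  have [vN|vN] := pselect (sval v = N); first by right; left; right.
  have [?|?|?|?] := cusp_classification nu cusp (vertex_ideal v) (vertex_nilp nu) (@vertex_neq0 _ v) vS vN.
  - by right; right; left.
  - by right; right; right.
  - by left; left.
  by left; right.
apply: (sub_countable (subset_card_le cover)).
have cU (A B : set (AG R)) : countable A -> countable B -> countable (A `|` B).
  move=> cA cB; rewrite -bigcup2E; apply: bigcup_countable => // i _.
  by case: i => [|[|i]].
apply: (cU); first exact: cU.
apply: (cU); apply: (cU); exact: fiber_countable.
Qed.

Lemma cusp_planar : embeddable K (AG R) 0.
Proof.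
have [[_ My _ _] nMb _ _ _] := cusp.
have [k kinj] := countable_injP _ cusp_vertices_countable.
have hS := span_ideal (z ^+ 3); have hN := span_ideal (z ^+ 2).
have S0 : S <> [set 0] by apply/span_neq0/eqP.
have Mu1 : M (z ^+ 3) by rewrite exprS; exact: (idealMr _ hM).
have NS : N <> S by apply: (@span_neq _ z _ _ (Mu Mz)); rewrite -exprS.
have N0 : N <> [set 0].
  by move=> E; have : N (z ^+ 2) by [exact: span_self]; rewrite E => e; apply: u0; rewrite exprS e mulr0.
have [s sE] := vertexP hS hS S0 S0 (prodz_span (Mu Mu1)).
have [t tE] := vertexP hN hN N0 N0 (prodz_span z4).
apply: (@embed_book _ _ s t k).
- by move=> E; apply: NS; rewrite -sE -tE E.
- by move=> v w; apply: kinj; rewrite inE.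
move=> v x w vs vt xs xt ws wt /adjP[_ vx] /adjP[_ vw].
have nS (a : AG R) : a <> s -> sval a <> S by rewrite -sE => h /vertex_inj.
have nN (a : AG R) : a <> t -> sval a <> N by rewrite -tE => h /vertex_inj.
apply: vertex_inj; apply: (cusp_matching nu cusp (I := sval v)) => //;
  first [exact: vertex_ideal|exact: vertex_nilp|exact: vertex_neq0|exact: nS|exact: nN].
Qed.

End PlanarCases.

Theorem theorem3p2 (K : realType) (R : comNzRingType)
  (artR : artinian R)
  (genusR : exists g : nat, (0 < g)%N /\ has_genus K (AG R) g) :
  finite_set [set I : set R | is_ideal I]%classic.
Proof.
apply: contrapT => inf; have [g [g0 [emb gmin]]] := genusR.
suff planar : embeddable K (AG R) 0 by have := gmin 0%N planar; rewrite leqNgt g0.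
have mR : many [set: R]%classic.
  by move=> fin; apply: inf; apply: sub_finite_set fin => I hI; split.
have nu := nilpotent_or_unit artR (embedded_thin emb) mR.
have [[u star]|[z [y [b cusp]]]] := trichotomy artR nu (embedded_thin emb) mR (no_quadric_data emb nu).
  have [f fi] := space_injects K; have [pt [_ [[pti _] _ _ _]]] := emb.
  exact: (star_planar nu (inj_comp fi pti) star).
exact: (cusp_planar nu cusp emb).
Qed.
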